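(* Let $D\subset\mathbb{R}^3$ be a symmetric dimer and let $\lambda_j$ be a simple eigenvalue of the Newtonian potential $\mathcal{K}_D$ with normalized eigenfunction $\varphi_j$. Then $\varphi_j$ is either symmetric or antisymmetric, i.e. $\mathcal{R}[\varphi_j]=\varphi_j$ or $\mathcal{R}[\varphi_j]=-\varphi_j$. In particular, the principal (largest) eigenvalue $\lambda_0$ admits a positive and symmetric normalized eigenfunction $\varphi_0$. Moreover, let $(\omega(a,\tau),u(a,\tau))$ be the small-amplitude nonlinear dielectric resonance and resonant state associated with $(\lambda_j,\varphi_j)$, as described in the context. Then $u(a,\tau)$ has the same symmetry as $\varphi_j$.
   Context: $\mathcal{R}[\varphi](x_1,x_2,x_3)=\varphi(-x_1,x_2,x_3)$. Symmetric dimer: $D=D_1\cup D_2$, $D_1=D_0+(-L,0,0)$, $D_2=\mathcal{R}(D_0)+(L,0,0)$, with $D_0\subset\mathbb{R}^3$ a bounded connected open set with smooth boundary centered at the origin, $\mathcal{R}(D_0)$ its reflection in $\{x_1=0\}$, and $L>0$ such that $D_1,D_2$ are disjoint. $\mathcal{K}_D^\omega[\varphi](x)=\int_D\frac{e^{i\omega|x-y|}}{4\pi|x-y|}\varphi(y)\,dy$, $\mathcal{K}_D=\mathcal{K}_D^0$ on $L^2(D)$, $\langle f,g\rangle_D=\int_D\overline fg\,dx$; ''normalized'' means unit $L^2(D)$ norm. Small-amplitude family: for $\lambda_j$ simple and sufficiently small $\delta>0$, there exist on $\{(a,\tau)\in\mathbb{R}_+^2:a+\tau^{-1}<\delta\}$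 real-analytic functions $\omega(a,\tau)\in\mathbb{C}$ and $u(a,\tau)=a\varphi_j+h(a,\tau)\in H^2(D)$ with $\langle\varphi_j,h(a,\tau)\rangle_D=0$, solving $u=\tau\omega^2\mathcal{K}_D^\omega[u+|u|^2u]$, with $\sqrt\tau\,\omega(a,\tau)\to\lambda_j^{-1/2}$ and $h(a,\tau)\to0$ in $H^2(D)$ as $a\to0$, $\tau\to\infty$. It is locally unique up to phase: for some $\rho>0$, any solution $(\omega,u)$ with $|\sqrt\tau\,\omega-\lambda_j^{-1/2}|<\rho$, $\|u\|_{H^2(D)}<\rho$, $|\langle\varphi_j,u\rangle_D|=a$ equals $(\omega(a,\tau),e^{i\theta}u(a,\tau))$ for some $\theta\in\mathbb{R}$. *)

(* Defs.v *)
From HB Require Import structures.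
From mathcomp Require Import all_boot all_order all_algebra.
From mathcomp Require Import all_classical all_reals all_analysis.
From mathcomp.real_closed Require Import complex.
Import Order.TTheory GRing.Theory Num.Theory.
Import numFieldNormedType.Exports.

Set Implicit Arguments.
Unset Strict Implicit.
Unset Printing Implicit Defensive.

Local Open Scope classical_set_scope.
Local Open Scope ring_scope.
Local Open Scope complex_scope.

Local Notation normc := ComplexField.Normc.normc.

(* Points of the space are triples [(x1, x2, x3)]; functions on it take values
   in [R[i]]. *)
Notation R3 R := (R * R * R)%type.

Notation leb3 R :=
  ((@lebesgue_measure R \x @lebesgue_measure R) \x @lebesgue_measure R)%E.

(* The canonical norm of the product type [R3 R] is the sup norm. *)
Definition enorm {R : realType} (x : R3 R) : R :=
  Num.sqrt (x.1.1 ^+ 2 + x.1.2 ^+ 2 + x.2 ^+ 2).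

Definition reflect1 {R : realType} (x : R3 R) : R3 R := (- x.1.1, x.1.2, x.2).

Definition cexp {R : realType} (z : R[i]) : R[i] :=
  (expR (complex.Re z) * cos (complex.Im z)) +i*
  (expR (complex.Re z) * sin (complex.Im z)).

Definition cintegral {R : realType} (D : set (R3 R)) (f : R3 R -> R[i]) : R[i] :=
  (\int[leb3 R]_(x in D) complex.Re (f x)) +i*
  (\int[leb3 R]_(x in D) complex.Im (f x)).

Definition partial {R : realType} (i j k : nat) (f : R3 R -> R) : R3 R -> R :=
  iter i (fun g x => 'D_((1, 0, 0) : R3 R) g x)
  (iter j (fun g x => 'D_((0, 1, 0) : R3 R) g x)
  (iter k (fun g x => 'D_((0, 0, 1) : R3 R) g x) f)).

(* Differentiability of every [partial i j k f] makes all partial derivatives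
   of all orders exist, commute and be continuous. *)
Definition smooth {R : realType} (f : R3 R -> R) : Prop :=
  forall i j k x, differentiable (partial i j k f) x.

(* Near each boundary point, [A] is the negative side of a smooth function with
   nonzero gradient. *)
Definition smooth_boundary {R : realType} (A : set (R3 R)) : Prop :=
  forall p, (closure A `\` interior A) p ->
    exists (U : set (R3 R)) (f : R3 R -> R),
      [/\ nbhs p U, smooth f,
          exists v : R3 R, 'D_v f p != 0
        & A `&` U = [set x | f x < 0] `&` U].

(* The centroid is the origin. *)
Definition centered {R : realType} (A : set (R3 R)) : Prop :=
  [/\ \int[leb3 R]_(x in A) x.1.1 = 0,
      \int[leb3 R]_(x in A) x.1.2 = 0
    & \int[leb3 R]_(x in A) x.2 = 0].

Definition translate {R : realType} (v : R3 R) (A : set (R3 R)) : set (R3 R) :=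
  [set x + v | x in A].

Definition symmetric_dimer {R : realType} (D : set (R3 R)) : Prop :=
  exists (D0 : set (R3 R)) (L : R),
    let D1 := translate (- L, 0, 0) D0 in
    let D2 := translate (L, 0, 0) (reflect1 @` D0) in
    [/\ [/\ D0 !=set0, open D0, connected D0 & bounded_set D0],
        smooth_boundary D0, centered D0
      & [/\ 0 < L, D1 `&` D2 = set0 & D = D1 `|` D2]].

(* Elements of L^2(D) and H^2(D) are represented by functions on the whole
   space; only their values almost everywhere on D matter. *)

Definition eq_ae {R : realType} (D : set (R3 R)) (f g : R3 R -> R[i]) : Prop :=
  {ae leb3 R, forall x, D x -> f x = g x}.

Definition L2 {R : realType} (D : set (R3 R)) (f : R3 R -> R[i]) : Prop :=
  [/\ measurable_fun D (fun x => complex.Re (f x)),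
      measurable_fun D (fun x => complex.Im (f x))
    & (leb3 R).-integrable D (fun x => (normc (f x) ^+ 2)%:E)].

Definition L2inner {R : realType} (D : set (R3 R)) (f g : R3 R -> R[i]) : R[i] :=
  cintegral D (fun x => conjc (f x) * g x).

Definition L2norm {R : realType} (D : set (R3 R)) (f : R3 R -> R[i]) : R :=
  Num.sqrt (\int[leb3 R]_(x in D) (normc (f x) ^+ 2)).

Definition test_function {R : realType} (D : set (R3 R)) (psi : R3 R -> R) : Prop :=
  smooth psi /\ exists K, [/\ compact K, K `<=` D & forall x, ~ K x -> psi x = 0].

(* [g] is a square-integrable weak derivative of [f] of multi-index (i, j, k);
   it is unique up to equality almost everywhere. *)
Definition is_weak_partial {R : realType} (D : set (R3 R)) (i j k : nat)
    (f g : R3 R -> R[i]) : Prop :=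
  L2 D g /\ forall psi, test_function D psi ->
    cintegral D (fun x => f x * (partial i j k psi x)%:C) =
    (- 1) ^+ (i + j + k) * cintegral D (fun x => g x * (psi x)%:C).

Definition H2 {R : realType} (D : set (R3 R)) (f : R3 R -> R[i]) : Prop :=
  L2 D f /\ forall i j k : nat, (i + j + k <= 2)%N ->
    exists g, is_weak_partial D i j k f g.

Definition weak_partial {R : realType} (D : set (R3 R)) (i j k : nat)
    (f : R3 R -> R[i]) : R3 R -> R[i] :=
  xget (fun=> 0) [set g | is_weak_partial D i j k f g].

Definition H2norm {R : realType} (D : set (R3 R)) (f : R3 R -> R[i]) : R :=
  Num.sqrt (\sum_(i < 3) \sum_(j < 3) \sum_(k < 3 | (i + j + k <= 2)%N)
    L2norm D (weak_partial D i j k f) ^+ 2).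

(* The kernel takes the value 0 at x = y, by the convention 0^-1 = 0. *)
Definition helmholtz_pot {R : realType} (D : set (R3 R)) (om : R[i])
    (f : R3 R -> R[i]) : R3 R -> R[i] :=
  fun x => cintegral D (fun y =>
    cexp ('i%C * om * (enorm (x - y))%:C) / (4 * pi * enorm (x - y))%:C * f y).

Definition newton_pot {R : realType} (D : set (R3 R)) := helmholtz_pot D 0.

(* Eigenvalues are taken in [R]: the Newtonian potential is self-adjoint on
   L^2(D).  For the same reason, algebraic and geometric multiplicity agree, and
   simplicity means that the eigenspace is a line. *)

Definition eigenfunction {R : realType} (D : set (R3 R)) (lam : R)
    (f : R3 R -> R[i]) : Prop :=
  [/\ L2 D f, ~ eq_ae D f (fun=> 0)
    & eq_ae D (newton_pot D f) (fun x => lam%:C * f x)].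

Definition eigenvalue {R : realType} (D : set (R3 R)) (lam : R) : Prop :=
  exists f, eigenfunction D lam f.

Definition simple_eigenvalue {R : realType} (D : set (R3 R)) (lam : R) : Prop :=
  eigenvalue D lam /\
  forall f g, eigenfunction D lam f -> eigenfunction D lam g ->
    exists c : R[i], eq_ae D g (fun x => c * f x).

Definition largest_eigenvalue {R : realType} (D : set (R3 R)) (lam : R) : Prop :=
  eigenvalue D lam /\ forall nu, eigenvalue D nu -> nu <= lam.

Definition symmetric_mode {R : realType} (D : set (R3 R)) (f : R3 R -> R[i]) : Prop :=
  eq_ae D (f \o reflect1) f.

Definition antisymmetric_mode {R : realType} (D : set (R3 R)) (f : R3 R -> R[i]) : Prop :=
  eq_ae D (f \o reflect1) (fun x => - f x).

(* Real-analyticity, on the set [P] of parameters, of a function of two real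
   variables with values in the subspace [F] of [E], normed by [nrm]: local
   expansion in a power series that converges absolutely. *)
Definition real_analytic {R : realType} {E : lmodType R[i]} (F : set E)
    (nrm : E -> R) (P : set (R * R)) (f : R -> R -> E) : Prop :=
  forall a0 t0, P (a0, t0) ->
    exists (r M : R) (c : nat -> nat -> E),
      [/\ 0 < r,
          forall m n, F (c m n) /\ nrm (c m n) * r ^+ (m + n) <= M
        & forall a t, `|a - a0| < r -> `|t - t0| < r ->
            nrm (f a t - \sum_(m < N) \sum_(n < N)
                   ((a - a0) ^+ m * (t - t0) ^+ n)%:C *: c m n)
              @[N --> \oo] --> (0 : R)].

Definition resonance {R : realType} (D : set (R3 R)) (tau : R) (om : R[i])
    (u : R3 R -> R[i]) : Prop :=
  H2 D u /\
  eq_ae D u (fun x => tau%:C * om ^+ 2 *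
    helmholtz_pot D om (fun y => u y + (normc (u y) ^+ 2)%:C * u y) x).

(* At a = 0 every frequency admits the zero state, so that local uniqueness
   only makes sense for a > 0. *)
Definition parameters {R : realType} (delta : R) : set (R * R) :=
  [set p | [/\ 0 < p.1, 0 < p.2 & p.1 + p.2^-1 < delta]].

(* The limits are joint: a -> 0+ and tau -> +oo independently.  The Newtonian
   potential is positive, so that lam > 0 and (Num.sqrt lam)^-1 is lam^(-1/2). *)
Record small_amplitude_family {R : realType} (D : set (R3 R)) (lam : R)
    (phi : R3 R -> R[i]) (delta : R) (om : R -> R -> R[i])
    (u h : R -> R -> R3 R -> R[i]) : Prop := SmallAmplitudeFamily {
  om_analytic : real_analytic (E := R[i]^o) setT (@normc R) (parameters delta) om;
  u_analytic : real_analytic (E := R3 R -> R[i]^o) (H2 D) (H2norm D)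
    (parameters delta) u;
  u_decomposition : forall a tau, parameters delta (a, tau) ->
    [/\ H2 D (h a tau), L2inner D phi (h a tau) = 0
      & eq_ae D (u a tau) (fun x => a%:C * phi x + h a tau x)];
  u_resonance : forall a tau, parameters delta (a, tau) ->
    resonance D tau (om a tau) (u a tau);
  om_limit : normc ((Num.sqrt p.2)%:C * om p.1 p.2 - ((Num.sqrt lam)^-1)%:C)
    @[p --> filter_prod (0 : R)^'+ (pinfty_nbhs R)] --> (0 : R);
  h_limit : H2norm D (h p.1 p.2)
    @[p --> filter_prod (0 : R)^'+ (pinfty_nbhs R)] --> (0 : R);
  local_uniqueness : exists2 rho : R, 0 < rho &
    forall a tau om' v, parameters delta (a, tau) ->
      resonance D tau om' v ->
      normc ((Num.sqrt tau)%:C * om' - ((Num.sqrt lam)^-1)%:C) < rho ->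
      H2norm D v < rho ->
      normc (L2inner D phi v) = a ->
      om' = om a tau /\
      exists theta : R, eq_ae D v (fun x => cexp ('i%C * theta%:C) * u a tau x)
}.

(* Main.v *)
(** On a symmetric dimer the Newtonian potential commutes with the reflection
    [R], and so does the nonlinear resonance equation.  Hence [phi o R] spans
    the same eigenline as [phi], and [phi o R = c phi] with [c^2 = 1].
    The principal eigenvalue is reached by power iteration of the constant
    function: the iterates of the positive kernel converge pointwise after
    normalization, to a positive limit, and pairing any other eigenfunction with
    this limit bounds its eigenvalue.
    For the nonlinear state, [c (u o R)] solves the same equation with the same
    frequency, so that near [(0, oo)] local uniqueness gives
    [c (u o R) = exp(i theta) u]; pairing with [phi] yields
    [exp(i theta) = 1].  The equality [c (u o R) = u] then extends to all
    parameters because its pairing with any test function is real-analytic in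
    [a] and in [tau]. *)

(* Compactness and spectral theory are replaced by a bound, uniform in [x], on the integral over [D]
   of the squared kernel. It makes the potential send L^2-small functions to uniformly small ones,
   so that a sequence that is Cauchy in L^2 converges pointwise after one more application of the
   potential. The iteration uses even iterates and finds an eigenfunction [e] of the squared
   operator; with [m] the square root of its eigenvalue, [K e + m e] is an eigenfunction of [K]
   itself. Symmetry of the principal mode is then obtained by adding its reflection to it.

   For the nonlinear states, the obstacle is that local uniqueness speaks only about a corner of the
   parameter region, while the analytic expansions converge in the H^2 norm and not pointwise. They
   become real power series once paired with a test function, and the fundamental lemma, proved from
   explicit smooth bumps on boxes, leads back from pairings to functions. *)
From HB Require Import structures.
Require Import Defs.
From mathcomp Require Import all_boot all_order all_algebra.
From mathcomp Require Import all_classical all_reals all_analysis.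
From mathcomp Require Import measurable_realfun.
From mathcomp.real_closed Require Import complex.
From mathcomp Require Import ring lra.
Import Order.TTheory GRing.Theory Num.Theory.
Import numFieldNormedType.Exports.

Set Implicit Arguments.
Unset Strict Implicit.
Unset Printing Implicit Defensive.

Local Open Scope classical_set_scope.
Local Open Scope ring_scope.
Local Open Scope complex_scope.

Local Notation normc := ComplexField.Normc.normc.
Local Notation Re := complex.Re.
Local Notation Im := complex.Im.

(** * Reflections preserve Lebesgue measure *)

Section integral_involution.
Context d (T : measurableType d) (R : realType) (mu : {measure set T -> \bar R}).
Variable s : T -> T.
Hypotheses (ms : measurable_fun setT s) (sK : involutive s)
  (mus : forall A, measurable A -> mu (s @^-1` A) = mu A).

Import HBNNSimple.

Let nnsfun_comp (h : {nnsfun T >-> R}) :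
  exists h' : {nnsfun T >-> R}, h' =1 h \o s.
Proof.
pose mixm := isMeasurableFun.Build _ _ T _ _ (measurableT_comp (measurable_funP h) ms).
have fin : finite_set (range (h \o s)).
  by apply: sub_finite_set (@fimfunP _ _ h) => _ [x _ <-]; exists (s x).
pose mixf := FiniteImage.Build _ _ _ fin.
have ge0 x : 0 <= (h \o s) x by exact: fun_ge0.
pose mixn := isNonNegFun.Build _ _ _ ge0.
pose h' : {nnsfun T >-> R} := HB.pack (h \o s) mixm mixf mixn.
by exists h'.
Qed.

Let sintegral_comp (h h' : {nnsfun T >-> R}) : h' =1 h \o s ->
  sintegral mu h' = sintegral mu h.
Proof.
move=> hE; apply: eq_fsbigr => r _; congr (_ * _)%E.
rewrite -[RHS]mus//; congr (mu _); apply/seteqP.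
by split => x; rewrite /= hE.
Qed.

Let sup_comp (G : T -> \bar R) :
  ereal_sup [set sintegral mu h | h in [set h : {nnsfun T >-> R} | forall x, ((h x)%:E <= G (s x))%E]] =
  ereal_sup [set sintegral mu h | h in [set h : {nnsfun T >-> R} | forall x, ((h x)%:E <= G x)%E]].
Proof.
congr ereal_sup; apply/seteqP; split => _ [h hG <-];
    have [h' hE] := nnsfun_comp h; exists h'; rewrite /= ?(sintegral_comp hE)// => x;
    rewrite hE /=; last exact: hG.
by have := hG (s x); rewrite sK.
Qed.

(* No measurability of [f] is needed, since [s] also permutes the simple
   functions below [f]. *)
Lemma integral_involution (D : set T) (f : T -> \bar R) :
  (forall x, D x -> D (s x)) ->
  (\int[mu]_(x in D) f (s x) = \int[mu]_(x in D) f x)%E.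
Proof.
move=> Ds.
have E : (f \o s) \_ D = (f \_ D) \o s.
  apply/funext => x; rewrite /= !patchE; congr (if _ then _ else _).
  by apply/idP/idP => /set_mem H; apply/mem_set; [exact: Ds|rewrite -(sK x); exact: Ds].
rewrite /integral -[(fun x => f (s x))]/(f \o s) E.
have pE G : ((G \o s)^\+ = G^\+ \o s :> (T -> \bar R))%E.
  by apply/funext => x; rewrite /= !funeposE.
have nE G : ((G \o s)^\- = G^\- \o s :> (T -> \bar R))%E.
  by apply/funext => x; rewrite /= !funenegE.
by rewrite pE nE; congr (_ - _)%E; exact: sup_comp.
Qed.

End integral_involution.

(* The library's canonical [SigmaFiniteMeasure] on [_ \x _] is the one of
   products of subprobabilities, hence these aliases. *)
Definition leb2s (R : realType) := (@lebesgue_measure R \x @lebesgue_measure R)%E.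
Arguments leb2s R : clear implicits.
Definition leb3s (R : realType) := (leb2s R \x @lebesgue_measure R)%E.

Arguments leb3s R : clear implicits.

HB.instance Definition _ (R : realType) := Measure.on (leb2s R).
HB.instance Definition _ (R : realType) := Measure.on (leb3s R).

Lemma product_sigma_finite d1 d2 (T1 : measurableType d1) (T2 : measurableType d2)
    (R : realType) (m1 : {sigma_finite_measure set T1 -> \bar R})
    (m2 : {sigma_finite_measure set T2 -> \bar R}) :
  sigma_finite setT (m1 \x m2)%E.
Proof.
have /sigma_finiteP[F [TF ndF Foo]] := sigma_finiteT m1.
have /sigma_finiteP[G [TG ndG Goo]] := sigma_finiteT m2.
exists (fun n => F n `*` G n).
  apply/seteqP; split => // -[x y] _.
  have : [set: T1] x by []. rewrite TF => -[n _ Fn].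
  have : [set: T2] y by []. rewrite TG => -[k _ Gk].
  (* Both exhausting sequences increase, so the larger index serves for both. *)
  exists (maxn n k) => //; split.
    by move: x Fn; apply/subsetPset/ndF/leq_maxl.
  by move: y Gk; apply/subsetPset/ndG/leq_maxr.
move=> k; have [mF F0] := Foo k; have [mG G0] := Goo k.
split; first exact: measurableX.
by rewrite product_measure1E// lte_mul_pinfty// ge0_fin_numE.
Qed.

HB.instance Definition _ (R : realType) := Measure_isSigmaFinite.Build _ _ _ (leb2s R)
  (product_sigma_finite (@lebesgue_measure R) (@lebesgue_measure R)).
HB.instance Definition _ (R : realType) := Measure_isSigmaFinite.Build _ _ _ (leb3s R)
  (product_sigma_finite (leb2s R) (@lebesgue_measure R)).

Section reflection.
Context {R : realType}.
Local Notation leb := (@lebesgue_measure R).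

Let mopp : measurable_fun setT (-%R : measurableTypeR R -> measurableTypeR R).
Proof. exact: oppr_measurable. Qed.

(** The pushforward agrees with Lebesgue measure on the half-open intervals that determine it: the
    preimage of []a, b]] is half-open at the other end but has the same length. *)
Lemma lebesgue_measure_opp (A : set (measurableTypeR R)) : measurable A ->
  leb (-%R @^-1` A) = leb A.
Proof.
move=> mA; apply/esym.
have := @lebesgue_measure_unique R
  (measure_function_pushforward__canonical__measure_function_Measure leb mopp); apply=> //.
move=> _ [[a b] _ <-] /=; rewrite /pushforward.
rewrite (_ : -%R @^-1` _ = `[- b, - a[%classic); last first.
  by apply/seteqP; split => x /=; rewrite !in_itv/= => /andP[? ?]; apply/andP; split; lra.
rewrite !lebesgue_measure_itv/= !lte_fin ltrN2.
by case: ifP => // _; rewrite -!EFinB; congr EFin; ring.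
Qed.

Let r2 (x : measurableTypeR R * measurableTypeR R) : measurableTypeR R * measurableTypeR R :=
  (- x.1, x.2).

Let mr2 : measurable_fun setT r2.
Proof.
by apply: measurable_fun_pair => //; apply: measurableT_comp mopp _.
Qed.

Let leb2_r2 (A : set (measurableTypeR R * measurableTypeR R)) : measurable A ->
  leb2s R (r2 @^-1` A) = leb2s R A.
Proof.
move=> mA; apply/esym.
have := @product_measure_unique _ _ _ _ R leb leb
  (measure_function_pushforward__canonical__measure_function_Measure (leb2s R) mr2); apply=> //.
move=> B C mB mC; rewrite /= /pushforward.
rewrite (_ : r2 @^-1` _ = (-%R @^-1` B) `*` C); last by apply/seteqP; split => -[x y].
rewrite /leb2s product_measure1E//; last by rewrite -[X in measurable X]setTI; exact: mopp.
by rewrite -(lebesgue_measure_opp mB).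
Qed.

Lemma reflect1_measurable : measurable_fun setT
  (reflect1 : measurableTypeR R * measurableTypeR R * measurableTypeR R ->
              measurableTypeR R * measurableTypeR R * measurableTypeR R).
Proof.
apply: measurable_fun_pair => //; apply: measurable_fun_pair.
  by apply: measurableT_comp mopp _; exact: measurableT_comp.
exact: measurableT_comp.
Qed.

Lemma leb3_reflect (A : set (measurableTypeR R * measurableTypeR R * measurableTypeR R)) :
  measurable A -> leb3s R (reflect1 @^-1` A) = leb3s R A.
Proof.
move=> mA; apply/esym.
have := @product_measure_unique _ _ _ _ R (leb2s R) leb
  (measure_function_pushforward__canonical__measure_function_Measure (leb3s R) reflect1_measurable); apply=> //.
move=> B C mB mC; rewrite /= /pushforward.
rewrite (_ : reflect1 @^-1` _ = (r2 @^-1` B) `*` C); last by apply/seteqP; split => -[[x y] z].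
rewrite /leb3s product_measure1E//; last by rewrite -[X in measurable X]setTI; exact: mr2.
by rewrite -(leb2_r2 mB).
Qed.

End reflection.

(** * Principal eigenfunctions of positive kernels *)

(** Tonelli on the whole space, applied to [F] extended by 0 outside the square of [D]. *)
Lemma tonelli_on d (T : measurableType d) (R : realType)
    (mu : {sigma_finite_measure set T -> \bar R}) (D : set T) (F : T * T -> \bar R) :
  measurable D -> measurable_fun setT F -> (forall z, 0 <= F z)%E ->
  (\int[mu]_(x in D) \int[mu]_(y in D) F (x, y) =
   \int[mu]_(y in D) \int[mu]_(x in D) F (x, y))%E.
Proof.
move=> mD mF F0.
have mDD : measurable (D `*` D) by exact: measurableX.
have mFD : measurable_fun setT (F \_ (D `*` D)).
  by apply/(measurable_restrictT _ mDD); exact: measurable_funTS.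
have FD0 z : (0 <= (F \_ (D `*` D)) z)%E by exact: erestrict_ge0.
have := @fubini_tonelli _ _ T T R mu mu (F \_ (D `*` D)) mFD FD0.
have E x y : (F \_ (D `*` D)) (x, y) = if x \in D then ((fun y => F (x, y)) \_ D) y else 0%E.
  rewrite !patchE in_setX; case: (x \in D) => //=.
have -> : (\int[mu]_x \int[mu]_y (F \_ (D `*` D)) (x, y) =
    \int[mu]_(x in D) \int[mu]_(y in D) F (x, y))%E.
  rewrite [RHS]integral_mkcond; apply: eq_integral => x _; rewrite patchE.
  case: ifPn => xD; last by rewrite integral0_eq// => y _; rewrite E (negbTE xD).
  by rewrite [RHS]integral_mkcond; apply: eq_integral => y _; rewrite E xD.
move=> ->; rewrite [RHS]integral_mkcond; apply: eq_integral => y _; rewrite patchE.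
case: ifPn => yD.
  rewrite [RHS]integral_mkcond; apply: eq_integral => x _.
  by rewrite E !patchE yD.
rewrite integral0_eq// => x _; rewrite E patchE (negbTE yD); by case: ifP.
Qed.

Lemma cvg_Rintegral_dominated d (T : measurableType d) (R : realType)
    (mu : {measure set T -> \bar R}) (D : set T) (w : nat -> T -> R) (v G : T -> R) :
  measurable D ->
  (forall n, measurable_fun D (w n)) ->
  (forall x, D x -> w ^~ x @ \oo --> v x) ->
  mu.-integrable D (EFin \o G) ->
  (forall n x, D x -> `|w n x| <= G x) ->
  (fun n => \int[mu]_(x in D) w n x) @ \oo --> \int[mu]_(x in D) v x.
Proof.
move=> mD mw wv iG wG.
have mv : measurable_fun D v by exact: measurable_fun_cvg wv.
have [||||iv _ H] := @dominated_convergence _ T R mu D mD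
    (fun n => EFin \o w n) (EFin \o v) (EFin \o G) _ _ _ iG.
- by move=> n; exact/measurable_EFinP.
- exact/measurable_EFinP.
- by apply: nearW => x Dx; apply: cvg_EFin; [exact: nearW|exact: wv].
- by apply: nearW => x n Dx; rewrite lee_fin wG.
apply: fine_cvg; rewrite fineK; first exact: H.
exact: integrable_fin_num.
Qed.

Section positive_kernel.
Context d (T : measurableType d) (R : realType).
Variables (mu : {sigma_finite_measure set T -> \bar R}) (D : set T).
Hypotheses (mD : measurable D) (Doo : (mu D < +oo)%E) (D0 : (0 < mu D)%E).
Variables (k : T -> T -> R) (B : R).
Hypotheses (mk : measurable_fun setT (fun z : T * T => k z.1 z.2))
  (k0 : forall x y, 0 <= k x y) (kC : forall x y, k x y = k y x)
  (kB : forall x, (\int[mu]_(y in D) ((k x y) ^+ 2)%:E <= B%:E)%E)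
  (k_gt0 : forall x, {ae mu, forall y, D y -> 0 < k x y}).

Definition kernel_op (f : T -> R) (x : T) : R := \int[mu]_(y in D) (k x y * f y).

(** Bounds are asked on [D] only, but measurability everywhere: [kernel_op f] is defined at every
    point, and this makes the class of nonnegative members stable under iteration. *)
Definition bounded_on (f : T -> R) :=
  measurable_fun setT f /\ exists M, forall x, D x -> `|f x| <= M.

Definition nonneg_bounded_on (f : T -> R) :=
  bounded_on f /\ forall x, D x -> 0 <= f x.

Local Notation K := kernel_op.
Local Notation bd := bounded_on.
Local Notation nbd := nonneg_bounded_on.

Let mkx x : measurable_fun setT (k x).
Proof. exact: (measurableT_comp mk (measurable_pair1 x)). Qed.

Lemma bounded_onM f g : bd f -> bd g -> bd (fun x => f x * g x).
Proof.
move=> [mf [M fM]] [mg [N gN]]; split; first exact: measurable_funM.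
by exists (M * N) => x Dx; rewrite normrM ler_pM// ?fM// gN.
Qed.

Lemma bounded_onZ c f : bd f -> bd (fun x => c * f x).
Proof.
by move=> bf; apply: (bounded_onM _ bf); split=> //; exists `|c|.
Qed.

Lemma bounded_onD f g : bd f -> bd g -> bd (fun x => f x + g x).
Proof.
move=> [mf [M fM]] [mg [N gN]]; split; first exact: measurable_funD.
by exists (M + N) => x Dx; rewrite (le_trans (ler_normD _ _))// lerD// ?fM// gN.
Qed.

Lemma bounded_onB f g : bd f -> bd g -> bd (fun x => f x - g x).
Proof.
move=> bf bg; rewrite (_ : (fun _ => _) = fun x => f x + -1 * g x).
  by apply: bounded_onD => //; exact: bounded_onZ.
by apply/funext => x; rewrite mulN1r.
Qed.

Lemma bounded_on_int f : bd f -> mu.-integrable D (EFin \o f).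
Proof.
move=> [mf [M fM]]; apply: measurable_bounded_integrable => //.
  exact: measurable_funTS.
exists M; split; first exact: num_real.
by move=> N MN x Dx; apply: (le_trans (fM _ Dx)); exact: ltW.
Qed.

Lemma kernel_sq_int x : mu.-integrable D (fun y => (k x y ^+ 2)%:E).
Proof.
apply/integrableP; split.
  by apply/measurable_EFinP; apply: measurable_funTS; exact: measurable_funX.
rewrite (le_lt_trans _ (ltry B))// (le_trans _ (kB x))//.
rewrite le_eqVlt; apply/orP; left; apply/eqP; apply: eq_integral => y _.
by rewrite gee0_abs// lee_fin sqr_ge0.
Qed.

Lemma kernel_sq_le x : \int[mu]_(y in D) (k x y ^+ 2) <= B.
Proof.
rewrite -lee_fin /Rintegral fineK ?kB//.
exact: integrable_fin_num (kernel_sq_int x).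
Qed.

Let B0 : 0 <= B.
Proof.
have := point : T => x; apply: le_trans (kernel_sq_le x).
by apply: Rintegral_ge0 => y _; exact: sqr_ge0.
Qed.

(** On a set of finite measure the square-integrable kernel is integrable, because
    [k <= 1 + k^2]. *)
Lemma kernel_int x f : bd f -> mu.-integrable D (fun y => (k x y * f y)%:E).
Proof.
move=> [mf [M fM]].
pose g y := M * (1 + k x y ^+ 2).
have ig : mu.-integrable D (EFin \o g).
  rewrite /g (_ : EFin \o _ = fun y => M%:E * (1%:E + (k x y ^+ 2)%:E))%E; last first.
    by apply/funext => y.
  apply: integrableZl => //; apply: integrableD => //; last exact: kernel_sq_int.
  by apply: (@bounded_on_int (cst 1)); split=> //; exists 1 => y _; rewrite normr1.
apply: (le_integrable mD _ _ ig).
  by apply/measurable_EFinP; apply: measurable_funTS; exact: measurable_funM.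
move=> y Dy; rewrite lee_fin /g.
have M0 : 0 <= M by exact: le_trans (fM _ Dy).
rewrite (le_trans _ (ler_norm _))// normrM mulrC ler_pM ?fM//.
rewrite ger0_norm//; have := sqr_ge0 (k x y - 1/2); nra.
Qed.

Lemma kernel_opD f g x : bd f -> bd g -> K (fun y => f y + g y) x = K f x + K g x.
Proof.
move=> bf bg; rewrite /K -RintegralD//; try exact: kernel_int.
by apply: eq_Rintegral => y _; rewrite mulrDr.
Qed.

Lemma kernel_opZ c f x : bd f -> K (fun y => c * f y) x = c * K f x.
Proof.
move=> bf; rewrite /K -RintegralZl//; try exact: kernel_int.
by apply: eq_Rintegral => y _; rewrite mulrCA.
Qed.

Lemma kernel_opB f g x : bd f -> bd g -> K (fun y => f y - g y) x = K f x - K g x.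
Proof.
move=> bf bg; rewrite /K -RintegralB//; try exact: kernel_int.
by apply: eq_Rintegral => y _; rewrite mulrBr.
Qed.

Lemma le_kernel_op f g x : bd f -> bd g -> (forall y, D y -> f y <= g y) ->
  K f x <= K g x.
Proof.
move=> bf bg fg; apply: le_Rintegral => //; try exact: kernel_int.
by move=> y Dy; rewrite ler_wpM2l// fg.
Qed.

Lemma kernel_op_cst_le x : K (cst 1) x <= fine (mu D) + B.
Proof.
have b1 : bd (cst 1) by split=> //; exists 1 => y _; rewrite normr1.
have i1 := bounded_on_int b1.
rewrite -[fine _]mul1r -Rintegral_cst//.
apply: le_trans (lerD (lexx _) (kernel_sq_le x)).
rewrite -RintegralD//; last exact: kernel_sq_int.
apply: le_Rintegral => //; first exact: kernel_int.
  exact: (integrableD mD i1 (kernel_sq_int x)).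
by move=> y Dy /=; have := sqr_ge0 (k x y - 1/2); nra.
Qed.

(** If the integral of the nonnegative function [k x y * f y] were 0, it would vanish almost
    everywhere, and so would [f], since [k x] is positive almost everywhere. *)
Lemma kernel_op_gt0 f x : bd f -> (forall y, D y -> 0 <= f y) ->
  0 < \int[mu]_(y in D) f y -> 0 < K f x.
Proof.
move=> bf f0 If; rewrite lt_neqAle Rintegral_ge0 ?andbT; last first.
  by move=> y Dy; rewrite mulr_ge0// f0.
apply/negP => /eqP /esym; rewrite /K /Rintegral => I0.
have ik := kernel_int x bf.
have : (\int[mu]_(y in D) (k x y * f y)%:E = 0)%E.
  by rewrite -(fineK (integrable_fin_num mD ik)) I0.
rewrite (eq_integral (fun y => `|(k x y * f y)%:E|%E)); last first.
  by move=> y /set_mem Dy; rewrite gee0_abs// lee_fin mulr_ge0// f0.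
move/(ae_eq_integral_abs mu mD (measurable_int _ ik)) => kf0.
suff : (\int[mu]_(y in D) (f y)%:E = \int[mu]_(y in D) (cst 0) y)%E.
  by rewrite integral0 => I0'; move: If; rewrite /Rintegral I0' ltxx.
apply: ae_eq_integral => //.
  exact: measurable_int (bounded_on_int bf).
near=> y => Dy /=.
have : 0 < k x y by move: Dy; near: y; exact: k_gt0.
have : (k x y * f y)%:E = 0%E by move: Dy; near: y; exact: kf0.
by move=> [] /eqP; rewrite mulf_eq0 => /orP[/eqP ->|/eqP ->//]; rewrite ltxx.
Unshelve. all: by end_near. Qed.

(** Nonnegativity is what gives measurability: [K f] is then a partial integral in the sense of
    Tonelli's theorem. *)
Lemma nonneg_bounded_on_kernel_op f : nbd f -> nbd (K f).
Proof.
move=> [bf f0].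
have Kf0 x : 0 <= K f x by apply: Rintegral_ge0 => y Dy; rewrite mulr_ge0// f0.
split=> //; split; last first.
  have [_ [M fM]] := bf; exists (`|M| * (fine (mu D) + B)) => x Dx.
  rewrite ger0_norm//.
  have b1 : bd (cst 1) by split=> //; exists 1 => y _; rewrite normr1.
  apply: (@le_trans _ _ (K (fun y => `|M| * cst 1 y) x)).
    apply: le_kernel_op => //; first exact: bounded_onZ.
    move=> y Dy /=; rewrite mulr1 (le_trans (ler_norm _))//.
    by rewrite (le_trans (fM _ Dy))// ler_norm.
  by rewrite kernel_opZ// ler_wpM2l// kernel_op_cst_le.
pose F (z : T * T) := (k z.1 z.2 * (f \_ D) z.2)%:E.
have F0 z : (0 <= F z)%E.
  by rewrite lee_fin mulr_ge0// patchE; case: ifPn => // /set_mem; exact: f0.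
have mF : measurable_fun setT F.
  apply/measurable_EFinP; apply: measurable_funM => //.
  apply: measurableT_comp => //; apply/(measurable_restrictT _ mD).
  by apply: measurable_funTS; case: bf.
rewrite (_ : K f = fine \o fubini_F mu F).
  by apply: measurableT_comp; [exact: fine_measurable|exact: measurable_fun_fubini_tonelli_F].
apply/funext => x; rewrite /K /Rintegral /fubini_F /=; congr fine.
rewrite integral_mkcond; apply: eq_integral => y _; rewrite /F !patchE/=.
by case: ifP => //; rewrite mulr0.
Qed.

Lemma kernel_op_sym f g : nbd f -> nbd g ->
  \int[mu]_(x in D) (f x * K g x) = \int[mu]_(x in D) (g x * K f x).
Proof.
move=> nf ng.
have rec h : nbd h -> forall z : T, 0 <= (h \_ D) z.
  by move=> [_ h0] z; rewrite patchE; case: ifPn => // /set_mem; exact: h0.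
have mr h : nbd h -> measurable_fun setT (h \_ D).
  move=> [[mh _] _]; apply/(measurable_restrictT _ mD); exact: measurable_funTS.
pose F (z : T * T) := ((f \_ D) z.1 * (k z.1 z.2 * (g \_ D) z.2))%:E.
have F0 z : (0 <= F z)%E by rewrite lee_fin !mulr_ge0// rec.
have mF : measurable_fun setT F.
  apply/measurable_EFinP; apply: measurable_funM.
    exact: measurableT_comp (mr _ nf) _.
  apply: measurable_funM => //; exact: measurableT_comp (mr _ ng) _.
have := @tonelli_on _ T R mu D F mD mF F0.
have E x : x \in D -> (\int[mu]_(y in D) F (x, y))%E = (f x * K g x)%:E.
  move=> xD; rewrite EFinM /K /Rintegral fineK; last first.
    by apply: integrable_fin_num => //; apply: kernel_int; case: ng.
  rewrite -integralZl//; last by apply: kernel_int; case: ng.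
  by apply: eq_integral => y yD; rewrite /F /= !patchE xD yD.
have E' y : y \in D -> (\int[mu]_(x in D) F (x, y))%E = (g y * K f y)%:E.
  move=> yD; rewrite EFinM /K /Rintegral fineK; last first.
    by apply: integrable_fin_num => //; apply: kernel_int; case: nf.
  rewrite -integralZl//; last by apply: kernel_int; case: nf.
  apply: eq_integral => x xD; rewrite /F /= !patchE xD yD -!EFinM kC.
  by congr (_%:E); ring.
rewrite (eq_integral _ _ E) (eq_integral _ _ E').
by rewrite /Rintegral => ->.
Qed.

(** Integrating [k |h| <= e k^2 + e^-1 h^2] plays the role of the Cauchy-Schwarz inequality. The
    bound does not depend on [x], which turns convergence in L^2 into uniform convergence. *)
Lemma kernel_op_l2_le h x e : bd h -> 0 < e ->
  \int[mu]_(y in D) (h y ^+ 2) <= e ^+ 2 -> `|K h x| <= e * (B + 1).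
Proof.
move=> bh e0 he; rewrite /K.
apply: (le_trans (le_normr_Rintegral mD (kernel_int x bh))).
have bh2 : bd (fun y => h y ^+ 2) by exact: bounded_onM.
have ih2 := bounded_on_int bh2.
have ik2 := kernel_sq_int x.
apply: (@le_trans _ _ (\int[mu]_(y in D) (e * (k x y ^+ 2) + e^-1 * (h y ^+ 2)))).
  apply: le_Rintegral => //.
  - exact: integrable_norm (kernel_int x bh).
  - exact: (integrableD mD (integrableZl mD e ik2) (integrableZl mD e^-1 ih2)).
  - move=> y Dy; rewrite normrM (ger0_norm (k0 _ _)) -[h y ^+ 2]real_normK ?num_real//.
    rewrite -(ler_pM2l e0) mulrDr (mulrA e e^-1) divff ?gt_eqF// mul1r.
    have := sqr_ge0 (e * k x y - `|h y|); have := normr_ge0 (h y); have := k0 x y.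
    nra.
rewrite RintegralD//; [|exact: (integrableZl mD e ik2)|exact: (integrableZl mD e^-1 ih2)].
rewrite (RintegralZl e mD ik2) (RintegralZl e^-1 mD ih2) mulrDr mulr1 lerD//.
  by rewrite ler_wpM2l ?(ltW e0)//; exact: kernel_sq_le.
by rewrite ler_pdivrMl// -expr2.
Qed.

Lemma Rintegral_eq0_ae f : bd f -> (forall x, D x -> 0 <= f x) ->
  \int[mu]_(x in D) f x = 0 -> {ae mu, forall x, D x -> f x = 0}.
Proof.
move=> bf f0 I0; have intf := bounded_on_int bf.
have : (\int[mu]_(y in D) `|(f y)%:E| = 0)%E.
  rewrite (eq_integral (fun y => (f y)%:E)); last first.
    by move=> y /set_mem Dy; rewrite gee0_abs// lee_fin f0.
  by rewrite -(fineK (integrable_fin_num mD intf)) [fine _]I0.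
move/(ae_eq_integral_abs mu mD (measurable_int _ intf)).
by apply: filterS => x H Dx; have [] := H Dx.
Qed.

Lemma Rintegral_pos f : bd f -> (forall x, D x -> 0 < f x) ->
  0 < \int[mu]_(x in D) f x.
Proof.
move=> bf f0; rewrite lt_neqAle Rintegral_ge0 ?andbT; last first.
  by move=> x Dx; exact/ltW/f0.
apply/negP => /eqP/esym/Rintegral_eq0_ae H.
have : {ae mu, forall x, ~ D x}.
  near=> x => Dx; have : f x = 0.
    by move: Dx; near: x; apply: H => // x Dx; exact/ltW/f0.
  by apply/eqP; rewrite gt_eqF// f0.
rewrite /almost_everywhere => nD.
have : mu.-negligible D by apply: negligibleS nD => x Dx /=; apply.
by move/(negligibleP _ mD) => D00; move: D0; rewrite D00 ltxx.
Unshelve. all: by end_near. Qed.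

Let g n := iter n K (cst 1).

Let nbd_g n : nbd (g n).
Proof.
elim: n => [|n ih]; last exact: nonneg_bounded_on_kernel_op.
by split=> //; split=> //; exists 1 => x _; rewrite normr1.
Qed.

Let bd_g n : bd (g n). Proof. by case: (nbd_g n). Qed.

Let g_gt0 n x : D x -> 0 < g n x.
Proof.
elim: n x => [//|n ih] x Dx /=.
apply: kernel_op_gt0 => // [y Dy|]; first exact/ltW/ih.
exact: Rintegral_pos.
Qed.

Let sig n := \int[mu]_(x in D) g n x.

Let sig_gt0 n : 0 < sig n.
Proof. exact: Rintegral_pos (g_gt0 n). Qed.

(** Moving [K] across the inner product shows that only [i + j] matters. All L^2 computations with
    the iterates thus reduce to the numerical sequence [sig]. *)
Let ip_g i j : \int[mu]_(x in D) (g i x * g j x) = sig (i + j).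
Proof.
elim: i j => [|i ih] j.
  by apply: eq_Rintegral => x _; rewrite mul1r.
rewrite addSnnS -ih /= kernel_op_sym; [|exact: nbd_g|exact: nbd_g].
by apply: eq_Rintegral => x _; rewrite mulrC.
Qed.

Let sqr_g p q i j : \int[mu]_(x in D) ((p * g i x - q * g j x) ^+ 2) =
  p ^+ 2 * sig (i + i) - p * q *+ 2 * sig (i + j) + q ^+ 2 * sig (j + j).
Proof.
have bg i' j' := bounded_onM (bd_g i') (bd_g j').
transitivity (\int[mu]_(x in D) ((p ^+ 2 * (g i x * g i x) - p * q *+ 2 * (g i x * g j x)) +
   q ^+ 2 * (g j x * g j x))).
  by apply: eq_Rintegral => x _; ring.
have Z c i' j' := bounded_on_int (bounded_onZ c (bg i' j')).
have B' := bounded_on_int (bounded_onB (bounded_onZ (p^+2) (bg i i)) (bounded_onZ (p * q*+2) (bg i j))).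
rewrite RintegralD// RintegralB// !RintegralZl ?ip_g//; exact: bounded_on_int.
Qed.

Let s n := sig (n + n).

Let s_gt0 n : 0 < s n. Proof. exact: sig_gt0. Qed.

Let rho n := s n.+1 / s n.

Let rho_gt0 n : 0 < rho n. Proof. by rewrite divr_gt0. Qed.

Let sE n : s n.+1 = rho n * s n. Proof. by rewrite /rho divfK// gt_eqF. Qed.

(* By Cauchy-Schwarz, [||K^(n+1) 1||^2 <= ||K^n 1|| ||K^(n+2) 1||]. *)
Let rho_nd : {homo rho : n m / (n <= m)%N >-> n <= m}.
Proof.
apply/nondecreasing_seqP => n.
rewrite /rho ler_pdivrMr// mulrAC ler_pdivlMr//.
(* This combination of [g n] and [g n.+2] is the one orthogonal to [g n], up to a factor. *)
have : 0 <= \int[mu]_(x in D) ((s n.+1 * g n x - s n * g n.+2 x) ^+ 2).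
  by apply: Rintegral_ge0 => x _; exact: sqr_ge0.
rewrite sqr_g.
have -> : (n + n.+2 = n.+1 + n.+1)%N by rewrite addSnnS.
rewrite -/(s n) -/(s n.+1) -/(s n.+2).
have := s_gt0 n => sn /[dup].
rewrite (_ : _ + _ = s n * (s n.+2 * s n - s n.+1 * s n.+1)); last ring.
by rewrite pmulr_rge0// subr_ge0.
Qed.

Let c := fine (mu D) + B.

Let K_le f x : nbd f -> forall M, (forall y, D y -> f y <= M) -> K f x <= `|M| * c.
Proof.
move=> [bf f0] M fM.
have b1 : bd (cst 1) by exact: (bd_g 0).
apply: (@le_trans _ _ (K (fun y => `|M| * cst 1 y) x)).
  apply: le_kernel_op => //; first exact: bounded_onZ.
  by move=> y Dy /=; rewrite mulr1 (le_trans (fM _ Dy))// ler_norm.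
by rewrite kernel_opZ// ler_wpM2l// kernel_op_cst_le.
Qed.

(** By [ip_g], the integral of [g n.+1] is that of [g n] times [K 1], and [K 1 <= c]. *)
Let sigS n : sig n.+1 <= c * sig n.
Proof.
rewrite -[n.+1]addn1 -ip_g /sig -RintegralZl//; last exact/bounded_on_int/bd_g.
apply: le_Rintegral => //.
- by apply: bounded_on_int; apply: bounded_onM; exact: bd_g.
- by apply: bounded_on_int; apply: bounded_onZ; exact: bd_g.
- move=> x Dx; rewrite mulrC ler_wpM2r//; first exact/ltW/g_gt0.
  exact: kernel_op_cst_le.
Qed.

Let c_gt0 : 0 < c.
Proof.
have := lt_le_trans (sig_gt0 1) (sigS 0).
by rewrite pmulr_lgt0.
Qed.

Let rho_ub n : rho n <= c ^+ 2.
Proof.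
rewrite /rho ler_pdivrMr// /s addSn addnS (le_trans (sigS _))//.
by rewrite expr2 -mulrA ler_pM2l// sigS.
Qed.

Let rho_cvg : cvgn rho.
Proof. by apply: nondecreasing_is_cvgn => //; exists (c ^+ 2) => _ [n _ <-]. Qed.

(** The square of the eigenvalue sought: [rho] compares the squared norms of consecutive
    iterates. *)
Let M2 : R := limn rho.

Let rho_le n : rho n <= M2.
Proof. exact: nondecreasing_cvgn_le. Qed.

Let M2_gt0 : 0 < M2. Proof. exact: lt_le_trans (rho_gt0 0) (rho_le 0). Qed.

Let t n := s n / M2 ^+ n.

Let t_gt0 n : 0 < t n. Proof. by rewrite divr_gt0// exprn_gt0. Qed.

Let t_ni : {homo t : n m / (n <= m)%N >-> m <= n}.
Proof.
apply/nonincreasing_seqP => n.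
rewrite /t exprS invfM mulrA ler_pM2r ?invr_gt0 ?exprn_gt0//.
by rewrite ler_pdivrMr// sE mulrC ler_pM2l// rho_le.
Qed.

Let t_cvg : cvgn t.
Proof. by apply: nonincreasing_is_cvgn => //; exists 0 => _ [n _ <-]; exact/ltW. Qed.

(** Even iterates only, so that the normalization involves powers of [M2] and not of its square
    root. By [ip_g] the inner product of [h n] and [h m] is [t (n + m)], hence convergence of [t]
    makes [h] Cauchy in L^2. *)
Let h n x := (M2 ^+ n)^-1 * g (n + n) x.

Let bd_h n : bd (h n). Proof. by apply: bounded_onZ; exact: bd_g. Qed.

Let nbd_h n : nbd (h n).
Proof.
by split=> // x Dx; rewrite mulr_ge0 ?invr_ge0 ?exprn_ge0// ltW// g_gt0.
Qed.

Let sqr_h n m : \int[mu]_(x in D) ((h n x - h m x) ^+ 2) =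
  t (n + n) - t (n + m) *+ 2 + t (m + m).
Proof.
rewrite sqr_g /t !exprD (addnACA n n m m) -/(s (n + n)) -/(s (n + m)) -/(s (m + m)).
by field; rewrite !gt_eqF// exprn_gt0.
Qed.

Let sqr_h0 n : \int[mu]_(x in D) (h n x ^+ 2) = t (n + n).
Proof.
transitivity (\int[mu]_(x in D) (((M2 ^+ n)^-1 * g (n + n) x - 0 * g 0 x) ^+ 2)).
  by apply: eq_Rintegral => x _; rewrite mul0r subr0.
rewrite sqr_g mulr0 mul0rn mul0r subr0 expr0n mul0r addr0 /t /s exprD.
by field; rewrite gt_eqF// exprn_gt0.
Qed.

(** The extra application of [K] upgrades the L^2 Cauchy property of [h] to pointwise
    convergence. *)
Let f n := K (h n).

Let fE n x : f n x = (M2 ^+ n)^-1 * g (n + n).+1 x.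
Proof. by rewrite /f kernel_opZ. Qed.

Let nbd_f n : nbd (f n). Proof. exact: nonneg_bounded_on_kernel_op. Qed.

Let a : R := limn t.

(* If the normalized iterates tended to 0, they would do so uniformly, and
   [K^(2N) 1 <= M2^N / 2] for some [N] would contradict that [rho] tends to
   [M2]. *)
Let a_gt0 : 0 < a.
Proof.
have : 0 <= a by apply: limr_ge => //; apply: nearW => n; exact/ltW.
rewrite le_eqVlt => /orP[/eqP a0|//]; exfalso.
(* Chosen so that [f n <= eta] yields [K (f n) <= eta * c = M2 / 2], that is,
   [g (N + N) <= M2 ^+ N / 2] for [N = n.+1]. *)
pose eta := M2 / (c *+ 2).
have eta0 : 0 < eta by rewrite divr_gt0// pmulrn_rgt0.
pose eps := eta / (B + 1).
have B1 : 0 < B + 1 by rewrite ltr_wpDl.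
have eps0 : 0 < eps by rewrite divr_gt0.
have [n _ tn] : \forall n \near \oo, t n <= eps ^+ 2.
  by have := @cvgr_le _ _ _ _ _ _ t_cvg; apply; rewrite -/a -a0 exprn_gt0.
have fn x : f n x <= eta.
  apply: le_trans (ler_norm _) _; rewrite -(divfK (lt0r_neq0 B1) eta).
  apply: kernel_op_l2_le => //; rewrite sqr_h0; apply: tn => /=.
  by rewrite leq_addr.
pose N := n.+1.
have gN x : g (N + N) x <= M2 ^+ N / 2.
  have Kfn : K (f n) x = (M2 ^+ n)^-1 * g (n + n).+2 x.
    rewrite (_ : f n = fun x => (M2 ^+ n)^-1 * g (n + n).+1 x).
      by rewrite kernel_opZ.
    exact/funext/fE.
  have : K (f n) x <= `|eta| * c by apply: K_le => // y _; exact: fn.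
  rewrite Kfn (ger0_norm (ltW eta0)) ler_pdivrMl ?exprn_gt0//.
  rewrite /N addSn addnS => /le_trans; apply.
  rewrite le_eqVlt; apply/orP; left; apply/eqP; rewrite /eta exprS.
  by field; rewrite gt_eqF.
have gNj j x : g (N + N + j) x <= M2 ^+ N / 2 * g j x.
  elim: j x => [|j ih] x; first by rewrite addn0 /= mulr1; exact: gN.
  rewrite addnS [leLHS]/= -[X in _ <= _ * X]/(K (g j) x) -kernel_opZ//.
  by apply: le_kernel_op => [||y _]; [exact: (bd_g (N + N + j))|exact: bounded_onZ|exact: ih].
have sNj j : s (N + j) <= M2 ^+ N / 2 * s j.
  rewrite /s addnACA /sig -RintegralZl//; last exact: bounded_on_int.
  apply: le_Rintegral => //; first exact: bounded_on_int.
  exact/bounded_on_int/bounded_onZ.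
(* Since the ratios increase, [N] steps from [j] multiply [s] by at least [rho j ^+ N], whereas
   [sNj] allows at most [M2 ^+ N / 2]. Letting [j] tend to infinity gives the contradiction. *)
have rs j m : rho j ^+ m * s j <= s (m + j).
  elim: m => [|m ih]; first by rewrite mul1r.
  have r0 := ltW (rho_gt0 j); have s0 := ltW (s_gt0 j).
  rewrite addSn sE exprS -mulrA; apply: ler_pM => //; first by rewrite mulr_ge0 ?exprn_ge0.
  by apply: rho_nd; exact: leq_addl.
have rN j : rho j ^+ N <= M2 ^+ N / 2.
  by rewrite -(ler_pM2r (s_gt0 j)) (le_trans (rs _ _)).
have rc : (fun j => rho j ^+ N) @ \oo --> M2 ^+ N.
  exact: (continuous_cvg _ (@exprn_continuous _ N M2) rho_cvg).
have : M2 ^+ N <= M2 ^+ N / 2.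
  rewrite -{1}(cvg_lim (@Rhausdorff R) rc); apply: limr_le.
    by apply/cvg_ex; exists (M2 ^+ N).
  exact: nearW.
have : 0 < M2 ^+ N by exact: exprn_gt0.
lra.
Qed.

Lemma cvg_kernel_op (w : nat -> T -> R) v M x :
  (forall n, bd (w n)) -> (forall x, D x -> w ^~ x @ \oo --> v x) ->
  (forall n x, D x -> `|w n x| <= M) ->
  (fun n => K (w n) x) @ \oo --> K v x.
Proof.
move=> bw wv wM.
apply: (@cvg_Rintegral_dominated _ _ _ mu D _ _ (fun y => k x y * M) mD).
- by move=> n; apply: measurable_funTS; apply: measurable_funM => //; case: (bw n).
- by move=> y Dy; apply: cvgM; [exact: cvg_cst|exact: wv].
- by apply: kernel_int; split => //; exists `|M| => y _.
- by move=> n y Dy; rewrite normrM (ger0_norm (k0 _ _)) ler_wpM2l// wM.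
Qed.

(** The squared L^2 distance of [h n] and [h N] is a second difference of the convergent sequence
    [t], hence small; [kernel_op_l2_le] carries this over to [f]. *)
Let f_cvg x : cvgn (f ^~ x).
Proof.
apply/cauchy_cvgP; apply: cauchy_exP => eps eps0.
have B1 : 0 < B + 1 by rewrite ltr_wpDl.
pose e := eps / 2 / (B + 1).
have e0 : 0 < e by rewrite !divr_gt0.
(* A quarter, because the expanded square contains [t (n + n)], [t (N + N)] and twice
   [t (n + N)]. *)
have [N _ tN] : \forall n \near \oo, `|a - t n| <= e ^+ 2 / 4.
  by have := @cvgr_dist_le _ _ _ _ _ _ _ t_cvg; apply; rewrite divr_gt0// exprn_gt0.
exists (f N x); exists N => // n /= Nn.
rewrite /ball /= /f -kernel_opB//.
apply: (@le_lt_trans _ _ (e * (B + 1))); last by rewrite divfK ?gt_eqF//; lra.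
apply: kernel_op_l2_le => //; first exact: bounded_onB.
rewrite sqr_h.
have tt i : (N <= i)%N -> `|a - t (N + i)| <= e ^+ 2 / 4.
  by move=> _; apply: tN => /=; rewrite leq_addr.
have := tt N (leqnn _); have := tt n Nn.
have : `|a - t (n + n)| <= e ^+ 2 / 4 by apply: tN => /=; rewrite (leq_trans Nn)// leq_addr.
rewrite !ler_norml => /andP[? ?] /andP[? ?] /andP[? ?]; lra.
Qed.

Let M := (1 + t 0) * (B + 1).

Let f_le n x : `|f n x| <= M.
Proof.
have := t_gt0 0 => t0.
apply: kernel_op_l2_le => //; first by rewrite ltr_wpDr// ltW.
rewrite sqr_h0; apply: (@le_trans _ _ (t 0)); first exact: t_ni.
by nra.
Qed.

Let e x : R := limn (f ^~ x).

Let fe x : f ^~ x @ \oo --> e x. Proof. exact: f_cvg. Qed.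

Let nbd_e : nbd e.
Proof.
split; last first.
  by move=> x Dx; apply: limr_ge => //; apply: nearW => n; case: (nbd_f n) => _; apply.
split.
  by apply: (measurable_fun_cvg (h := f)) => // n; case: (nbd_f n) => -[].
exists M => x _; rewrite ler_norml; apply/andP; split.
  by apply: limr_ge => //; apply: nearW => n; have := f_le n x; rewrite ler_norml => /andP[].
by apply: limr_le => //; apply: nearW => n; have := f_le n x; rewrite ler_norml => /andP[].
Qed.

Let bd_f n : bd (f n). Proof. by case: (nbd_f n). Qed.
Let bd_e : bd e. Proof. by case: nbd_e. Qed.

(** Two more applications of [K] are one more step of the even iteration, up to the factor [M2] of
    its normalization. *)
Let KKf n x : K (K (f n)) x = M2 * f n.+1 x.
Proof.
have E1 : f n = fun x => (M2 ^+ n)^-1 * g (n + n).+1 x by exact/funext/fE.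
have E2 : K (f n) = fun x => (M2 ^+ n)^-1 * g (n + n).+2 x.
  by apply/funext => y; rewrite E1 kernel_opZ.
rewrite E2 kernel_opZ// fE addSn addnS exprS.
rewrite -[K _ x]/(g (n + n).+3 x).
by field; rewrite !gt_eqF// exprn_gt0.
Qed.

Let KKe x : K (K e) x = M2 * e x.
Proof.
have c1 : (fun n => K (K (f n)) x) @ \oo --> K (K e) x.
  apply: (@cvg_kernel_op _ _ (`|M| * c)).
  - by move=> n; case: (nonneg_bounded_on_kernel_op (nbd_f n)).
  - by move=> y _; apply: (@cvg_kernel_op _ _ M) => // z _; exact: fe.
  - move=> n y Dy; rewrite ger0_norm; last first.
      by case: (nonneg_bounded_on_kernel_op (nbd_f n)) => _; apply.
    by apply: K_le => // z _; rewrite (le_trans (ler_norm _)).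
have c2 : (fun n => K (K (f n)) x) @ \oo --> M2 * e x.
  rewrite (_ : (fun n => _) = fun n => M2 * f n.+1 x); last by apply/funext => n; exact: KKf.
  by apply: cvgM; [exact: cvg_cst|rewrite (cvg_shiftS (f ^~ x)); exact: fe].
by rewrite -(cvg_lim (@Rhausdorff R) c1) -(cvg_lim (@Rhausdorff R) c2).
Qed.

(** This is where [a > 0] is used: the integral of [f n ^+ 2] is [M2 * t (n + n).+1 >= M2 * a],
    which survives in the limit, and the integral of [e ^+ 2] is at most [M] times that of [e]. *)
Let int_e : 0 < \int[mu]_(x in D) e x.
Proof.
have i2 : \int[mu]_(x in D) (f n x ^+ 2) @[n --> \oo] --> \int[mu]_(x in D) (e x ^+ 2).
  apply: (@cvg_Rintegral_dominated _ _ _ mu D _ _ (cst (M ^+ 2)) mD).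
  - by move=> n; apply: measurable_funTS; apply: measurable_funX; case: (bd_f n).
  - by move=> x _; rewrite expr2; under eq_cvg do rewrite expr2; apply: cvgM; exact: fe.
  - by apply: bounded_on_int; split => //; exists `|M ^+ 2| => y _.
  - by move=> n x Dx; rewrite normrX lerXn2r// ?nnegrE//; exact: le_trans (f_le n x).
have ff n : \int[mu]_(x in D) (f n x ^+ 2) = M2 * t (n + n).+1.
  transitivity (\int[mu]_(x in D) (((M2 ^+ n)^-1 * g (n + n).+1 x - 0 * g 0 x) ^+ 2)).
    by apply: eq_Rintegral => x _; rewrite mul0r subr0 fE.
  rewrite sqr_g mulr0 mul0rn mul0r subr0 expr0n mul0r addr0 /t /s (exprS M2) (exprD M2).
  by field; rewrite !gt_eqF// exprn_gt0.
have ce2 : M2 * a <= \int[mu]_(x in D) (e x ^+ 2).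
  rewrite -(cvg_lim (@Rhausdorff R) i2); apply: limr_ge.
    by apply/cvg_ex; eexists; exact: i2.
  by apply: nearW => n; rewrite ff ler_pM2l//; exact: nonincreasing_cvgn_ge.
have : \int[mu]_(x in D) (e x ^+ 2) <= M * \int[mu]_(x in D) e x.
  rewrite -RintegralZl//; last exact: bounded_on_int.
  apply: le_Rintegral => //.
  - exact: bounded_on_int (bounded_onM bd_e bd_e).
  - exact: bounded_on_int (bounded_onZ _ bd_e).
  - move=> x Dx; rewrite expr2 ler_wpM2r//; first by case: nbd_e => _; apply.
    by apply: limr_le => //; apply: nearW => n; rewrite (le_trans (ler_norm _)).
move/(le_trans ce2) => H; have : 0 < M * \int[mu]_(x in D) e x.
  by apply: lt_le_trans H; rewrite mulr_gt0.
by rewrite pmulr_rgt0// /M mulr_gt0 ?ltr_wpDl// ltr_wpDr// ltW.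
Qed.

(** With [m] the square root of [M2], the equation [K (K e) = M2 e] reads [(K - m) (K + m) e = 0],
    so that [K e + m e] is an eigenfunction. It is positive because [K e] already is. *)
Lemma positive_kernel_eigenfunction : exists (m : R) (E : T -> R),
  [/\ 0 < m, bd E, forall x, D x -> 0 < E x & forall x, D x -> K E x = m * E x].
Proof.
have bKe : bd (K e) by case: (nonneg_bounded_on_kernel_op nbd_e).
exists (Num.sqrt M2), (fun x => K e x + Num.sqrt M2 * e x); split.
- by rewrite sqrtr_gt0.
- by apply: bounded_onD => //; exact: bounded_onZ.
- move=> x Dx; rewrite ltr_wpDr// ?mulr_ge0 ?sqrtr_ge0//; first by case: nbd_e => _; apply.
  by apply: kernel_op_gt0 => // y Dy; case: nbd_e => _; apply.
- move=> x Dx; rewrite kernel_opD//; last exact: bounded_onZ.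
  rewrite kernel_opZ// KKe -{1}(sqr_sqrtr (ltW M2_gt0)); ring.
Qed.

End positive_kernel.

(** Pairing with [E] gives [nu <psi, E> <= <K psi, E> = <psi, K E> = m <psi, E>], and [<psi, E>] is
    positive and finite. Only an inequality is asked of [psi] because it will be the absolute value
    of an eigenfunction. The integrals stay in the extended reals, where Tonelli applies before
    [K psi] is known to be finite. *)
Lemma kernel_eigenvalue_le d (T : measurableType d) (R : realType)
    (mu : {sigma_finite_measure set T -> \bar R}) (D : set T) (k : T -> T -> R)
    (m nu : R) (E psi : T -> R) :
  measurable D -> measurable_fun setT (fun z : T * T => k z.1 z.2) ->
  (forall x y, 0 <= k x y) -> (forall x y, k x y = k y x) ->
  0 < m -> bounded_on D E -> (forall x, D x -> 0 < E x) ->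
  (forall x, D x -> (\int[mu]_(y in D) (k x y * E y)%:E = (m * E x)%:E)%E) ->
  mu.-integrable D (EFin \o psi) -> (forall x, D x -> 0 <= psi x) ->
  ~ {ae mu, forall x, D x -> psi x = 0} ->
  {ae mu, forall x, D x ->
    ((nu * psi x)%:E <= \int[mu]_(y in D) (k x y * psi y)%:E)%E} ->
  nu <= m.
Proof.
move=> mD mk k0 kC m0 [mE [M EM]] E0 KE ipsi psi0 npsi nupsi.
have [nu0|/ltW nu0] := leP nu 0; first exact: le_trans (ltW m0).
have mpsi : measurable_fun D psi by apply/measurable_EFinP; exact: measurable_int ipsi.
have mpsir : measurable_fun setT (psi \_ D) by apply/(measurable_restrictT _ mD).
have mEr : measurable_fun setT (E \_ D).
  by apply/(measurable_restrictT _ mD); exact: measurable_funTS.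
have psir0 z : 0 <= (psi \_ D) z by rewrite patchE; case: ifPn => // /set_mem /psi0.
have Er0 z : 0 <= (E \_ D) z by rewrite patchE; case: ifPn => // /set_mem /E0 /ltW.
have mkx x : measurable_fun setT (k x) by exact: (measurableT_comp mk (measurable_pair1 x)).
pose F (z : T * T) := ((E \_ D) z.1 * (k z.1 z.2 * (psi \_ D) z.2))%:E.
have F0 z : (0 <= F z)%E by rewrite lee_fin !mulr_ge0.
have mF : measurable_fun setT F.
  apply/measurable_EFinP; apply: measurable_funM; first exact: measurableT_comp mEr _.
  apply: measurable_funM => //; exact: measurableT_comp mpsir _.
have ton := @tonelli_on _ T R mu D F mD mF F0.
have F1 x : x \in D -> (\int[mu]_(y in D) F (x, y) =
    (E x)%:E * \int[mu]_(y in D) (k x y * psi y)%:E)%E.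
  move=> xD; have Ex : 0 <= E x by apply/ltW/E0/set_mem.
  have p1 y : D y -> (0 <= (k x y * psi y)%:E)%E by move=> Dy; rewrite lee_fin mulr_ge0 ?psi0.
  have p2 : measurable_fun D (fun y => (k x y * psi y)%:E).
    by apply/measurable_EFinP; apply: measurable_funM mpsi; exact: measurable_funTS (mkx x).
  rewrite -(ge0_integralZl_EFin mu mD p1 p2 Ex).
  by apply: eq_integral => y yD; rewrite /F /= !patchE xD yD.
have F2 y : y \in D -> (\int[mu]_(x in D) F (x, y) = (m * (psi y * E y))%:E)%E.
  move=> yD; have py : 0 <= psi y by apply/psi0/set_mem.
  have p1 x : D x -> (0 <= (k y x * E x)%:E)%E.
    by move=> Dx; rewrite lee_fin; exact: mulr_ge0 (k0 _ _) (ltW (E0 _ Dx)).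
  have p2 : measurable_fun D (fun x => (k y x * E x)%:E).
    apply/measurable_EFinP; apply: measurable_funM; first exact: measurable_funTS (mkx y).
    exact: measurable_funTS mE.
  rewrite mulrCA EFinM -KE; last exact: set_mem.
  rewrite -(ge0_integralZl_EFin mu mD p1 p2 py).
  by apply: eq_integral => x xD; rewrite /F /= !patchE xD yD kC -EFinM; congr EFin; ring.
rewrite (eq_integral _ _ F2) in ton.
have mpE : measurable_fun D (fun y => psi y * E y).
  by apply: measurable_funM => //; exact: measurable_funTS.
have ipE : mu.-integrable D (fun y => (psi y * E y)%:E).
  apply: (le_integrable mD _ _ (integrableZl mD `|M| ipsi)); first exact/measurable_EFinP.
  move=> y Dy /=; rewrite lee_fin !normrM mulrC (normr_id M).
  by rewrite ler_wpM2r// (le_trans (EM _ Dy))// ler_norm.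
have pE0 : (0 < \int[mu]_(y in D) (psi y * E y)%:E)%E.
  rewrite lt_neqAle integral_ge0 ?andbT; last first.
    by move=> y Dy; rewrite lee_fin mulr_ge0 ?psi0// ltW// E0.
  apply/negP => /eqP/esym I0; apply: npsi.
  have : (\int[mu]_(y in D) `|(psi y * E y)%:E| = 0)%E.
    rewrite -I0; apply: eq_integral => y /set_mem Dy.
    by rewrite gee0_abs// lee_fin mulr_ge0 ?psi0// ltW// E0.
  move/(ae_eq_integral_abs mu mD (measurable_int _ ipE)).
  apply: filterS => x H Dx; have [/eqP] := H Dx.
  by rewrite mulf_eq0 => /orP[/eqP//|/eqP Ex]; have := E0 _ Dx; rewrite Ex ltxx.
have : (\int[mu]_(x in D) (nu * (psi x * E x))%:E <=
        \int[mu]_(x in D) \int[mu]_(y in D) F (x, y))%E.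
  apply: ae_ge0_le_integral => //.
  - by move=> x Dx; rewrite lee_fin !mulr_ge0 ?psi0// ltW// E0.
  - by apply/measurable_EFinP; apply: measurable_funM.
  - by move=> x _; apply: integral_ge0.
  - apply: measurable_funTS; rewrite (_ : (fun x => _) = fubini_F mu F).
      exact: measurable_fun_fubini_tonelli_F.
    apply/funext => x; rewrite integral_mkcond; apply: eq_integral => y _.
    rewrite patchE; case: ifPn => yD; rewrite /F/=; first by rewrite !patchE yD.
    by rewrite (_ : (psi \_ D) y = 0) ?mulr0 ?patchE ?(negbTE yD).
  - apply: filterS nupsi => x H Dx; rewrite F1 ?inE// mulrA mulrC EFinM.
    by rewrite lee_wpmul2l ?H// lee_fin ltW// E0.
rewrite ton (_ : (\int[mu]_(x in D) (nu * _)%:E = nu%:E * \int[mu]_(x in D) (psi x * E x)%:E)%E);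
  last exact: (integralZl mD ipE).
rewrite (_ : (\int[mu]_(x in D) (m * _)%:E = m%:E * \int[mu]_(x in D) (psi x * E x)%:E)%E);
  last exact: (integralZl mD ipE).
rewrite -(fineK (integrable_fin_num mD ipE)) -!EFinM lee_fin.
rewrite ler_pM2r//; rewrite fine_gt0// pE0 /=.
exact: integrable_lty.
Qed.

(** * Test functions on boxes and the fundamental lemma *)

Section flat.
Context {R : realType}.
Implicit Types (P : {poly R}) (s : R).

(** The polynomial factor makes the family closed under derivation, starting from [exp (- 1 / s)] at
    [P = 1]. *)
Definition flat_exp P s : R := if 0 < s then P.[s^-1] * expR (- s^-1) else 0.

(** The quadratic bound near 0 is what gives differentiability there, with derivative 0. *)
Lemma flat_exp_sqr_bound P : exists2 C, 0 < C &
  forall s, s <= 1 -> `|flat_exp P s| <= C * s ^+ 2.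
Proof.
pose N := size P; pose A := \sum_(i < N) `|P`_i|.
have A0 : 0 <= A by apply: sumr_ge0.
have PA y : 1 <= y -> `|P.[y]| <= A * y ^+ N.
  move=> y1; rewrite horner_coef (le_trans (ler_norm_sum _ _ _))// mulr_suml.
  apply: ler_sum => i _; rewrite normrM ler_wpM2l// ger0_norm ?exprn_ge0 ?(le_trans ler01)//.
  by rewrite ler_weXn2l// ltnW.
exists (1 + A * (N.+2)`!%:R) => [|s s1]; first by rewrite ltr_wpDr// mulr_ge0.
rewrite /flat_exp; case: ifPn => [s0|_]; last first.
  by rewrite normr0 mulr_ge0 ?sqr_ge0// addr_ge0// mulr_ge0.
set y := s^-1; have y1 : 1 <= y by rewrite /y invf_ge1.
have y0 : 0 < y by rewrite invr_gt0.
have F0 : 0 < (N.+2)`!%:R :> R by rewrite ltr0n fact_gt0.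
(* The two powers of [y = s^-1] beyond the growth of [P] become the factor [s ^+ 2]. *)
have e1 : expR (- y) * y ^+ N.+2 <= (N.+2)`!%:R.
  rewrite expRN mulrC ler_pdivrMr ?expR_gt0//.
  have := expR_ge1Dxn N.+1 (ltW y0).
  rewrite -ler_pdivrMl// => /(le_trans _); apply.
  by rewrite mulrC lerDr.
rewrite normrM (ger0_norm (expR_ge0 _)).
apply: (@le_trans _ _ (A * y ^+ N * expR (- y))).
  by rewrite ler_wpM2r ?expR_ge0// PA.
rewrite (_ : A * y ^+ N * expR (- y) = A * (expR (- y) * y ^+ N.+2) * s ^+ 2); last first.
  by rewrite /y !exprS; field; rewrite gt_eqF.
rewrite ler_wpM2r ?sqr_ge0// (le_trans (ler_wpM2l A0 e1))//.
by rewrite lerDr.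
Qed.

(** The factor ['X^2] comes from the derivative of [s^-1], evaluated in the variable [s^-1]. At 0,
    Caratheodory's criterion applies to the quotient [flat_exp P z / z], which tends to 0 by
    [flat_exp_sqr_bound]. *)
Lemma is_derive_flat_exp P s :
  is_derive s 1 (flat_exp P) (flat_exp ('X^2 * (P - P^`())) s).
Proof.
have [s0|s0|->] := ltgtP s 0.
- have -> : flat_exp ('X^2 * (P - P^`())) s = 0 by rewrite /flat_exp ltNge (ltW s0).
  apply: (@near_eq_is_derive _ _ _ (cst 0)).
  near=> t; rewrite /flat_exp /= ifF//; apply/negbTE; rewrite -leNgt ltW//.
  by near: t; exact: lt_nbhsl.
- rewrite [X in is_derive _ _ _ X]/flat_exp s0.
  have dV : is_derive s 1 (fun t : R => t^-1) (- s ^- 2).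
    have := @is_deriveV R id s 1 1 (lt0r_neq0 s0) (is_derive_id _ _).
    by rewrite /GRing.scale /= mulr1.
  have dP := @is_derive1_comp _ (horner P) _ s _ _ (is_derive_poly P s^-1) dV.
  have dN : is_derive s 1 (fun t : R => - t^-1) (s ^- 2).
    by have := is_deriveN dV; rewrite opprK.
  have dE := @is_derive1_comp _ expR _ s _ _ (is_derive_expR (- s^-1)) dN.
  apply: (@is_derive_eq _ _ _ _ _ _ _ _ (near_eq_is_derive _ (is_deriveM dP dE))).
    near=> t; rewrite /flat_exp ifT//; near: t; exact: lt_nbhsr.
  rewrite /GRing.scale /= hornerM hornerXn hornerD hornerN. field; exact: lt0r_neq0.
- have fl0 Q : flat_exp Q 0 = 0 by rewrite /flat_exp ltxx.
  rewrite fl0; apply/is_derive1_caratheodory.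
  have [C C0 HC] := flat_exp_sqr_bound P.
  exists (fun z => flat_exp P z / z); split.
  + move=> z; rewrite fl0 !subr0.
    have [->|z0] := eqVneq z 0; first by rewrite fl0 mulr0.
    by rewrite divfK.
  + apply/cvgrPdist_le => e e0; rewrite invr0 mulr0.
    near=> z; rewrite sub0r normrN normrM normfV.
    have [->|z0] := eqVneq z 0; first by rewrite normr0 invr0 mulr0 ltW.
    rewrite ler_pdivrMr ?normr_gt0//.
    have z1 : z <= 1 by near: z; exact: nbhs0_ltW.
    apply: (le_trans (HC _ z1)); rewrite -real_normK ?num_real// expr2 mulrA.
    rewrite ler_wpM2r// mulrC -ler_pdivlMr//.
    near: z; apply: (@nbhs0_le _ R); exact: divr_gt0.
  + by rewrite invr0 mulr0.
Unshelve. all: by end_near. Qed.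

End flat.

Section flat_algebra.
Context {R : realType} {V : normedModType R}.

(* The point of this class is its closure under directional derivatives, which
   gives the smoothness of its members without computing their derivatives. *)
Inductive flat_algebra : (V -> R) -> Prop :=
| flat_base (P : {poly R}) (l : {linear V -> R}) (c : R) :
    continuous l -> flat_algebra (fun x => flat_exp P (l x + c))
| flat_scale (c : R) f : flat_algebra f -> flat_algebra (fun x => c * f x)
| flat_add f g : flat_algebra f -> flat_algebra g -> flat_algebra (fun x => f x + g x)
| flat_mul f g : flat_algebra f -> flat_algebra g -> flat_algebra (fun x => f x * g x).

Lemma flat_algebra_differentiable f x : flat_algebra f -> differentiable f x.
Proof.
elim=> [P l c cl|c g _ dg|g h _ dg _ dh|g h _ dg _ dh].
- apply: (@differentiable_comp _ _ _ _ (fun x => l x + c) (flat_exp P)).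
    by apply: differentiableD => //; exact: linear_differentiable.
  by apply/derivable1_diffP; case: (is_derive_flat_exp P (l x + c)).
- exact: differentiableZ.
- exact: differentiableD.
- exact: differentiableM.
Qed.

Lemma flat_algebra_derive f v : flat_algebra f -> flat_algebra (fun x => 'D_v f x).
Proof.
elim=> [P l c cl|c g fg dg|g h fg dg fh dh|g h fg dg fh dh].
- rewrite (_ : (fun x => _) = fun x => l v * flat_exp ('X^2 * (P - P^`())) (l x + c)).
    by apply: flat_scale; exact: flat_base.
  apply/funext => x.
  have dl : differentiable (fun x => l x + c) x.
    by apply: differentiableD => //; exact: linear_differentiable.
  have dF : differentiable (flat_exp P) (l x + c).
    by apply/derivable1_diffP; case: (is_derive_flat_exp P (l x + c)).
  rewrite deriveE; last exact: (@differentiable_comp _ _ _ _ (fun x => l x + c) (flat_exp P)).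
  rewrite (_ : (fun x => _) = flat_exp P \o (fun x => l x + c))//.
  rewrite diff_comp//=.
  have -> : 'd (fun x => l x + c) x v = l v.
    rewrite (@diffD _ _ _ l (cst c))//; last exact: linear_differentiable.
    by rewrite /= diff_lin// diff_cst addr0.
  rewrite -[l v]mulr1 -[_ * 1]/(l v *: 1) linearZ /= -deriveE//.
  by rewrite (derive_val (is_derive := is_derive_flat_exp _ _)) /GRing.scale/= !mulr1.
- rewrite (_ : (fun x => _) = fun x => c * 'D_v g x); first exact: flat_scale.
  apply/funext => x; rewrite (@deriveZ _ _ _ g c)//.
  exact/diff_derivable/flat_algebra_differentiable.
- rewrite (_ : (fun x => _) = fun x => 'D_v g x + 'D_v h x); first exact: flat_add.
  apply/funext => x; rewrite (@deriveD _ _ _ g h)//;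
    exact/diff_derivable/flat_algebra_differentiable.
- rewrite (_ : (fun x => _) = fun x => g x * 'D_v h x + h x * 'D_v g x).
    by apply: flat_add; exact: flat_mul.
  apply/funext => x; rewrite (@deriveM _ _ g h)//;
    exact/diff_derivable/flat_algebra_differentiable.
Qed.

End flat_algebra.

Lemma flat_algebra_smooth {R : realType} (f : R3 R -> R) : flat_algebra f -> smooth f.
Proof.
move=> ff i j k x; apply: flat_algebra_differentiable; rewrite /partial.
have iterD n (v : R3 R) (g : R3 R -> R) : flat_algebra g ->
    flat_algebra (iter n (fun g x => 'D_v g x) g).
  by move=> fg; elim: n => [//|n ih]; exact: flat_algebra_derive.
by apply: (iterD i); apply: (iterD j); apply: (iterD k).
Qed.

Section boxes.
Context {R : realType}.
Implicit Types (p q x : R3 R) (D : set (R3 R)).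

Definition obox p q : set (R3 R) :=
  (`]p.1.1, q.1.1[ `*` `]p.1.2, q.1.2[) `*` `]p.2, q.2[.
Definition cbox p q : set (R3 R) :=
  (`[p.1.1, q.1.1] `*` `[p.1.2, q.1.2]) `*` `[p.2, q.2].

Lemma oboxE p q x : obox p q x <->
  [/\ p.1.1 < x.1.1 < q.1.1, p.1.2 < x.1.2 < q.1.2 & p.2 < x.2 < q.2].
Proof.
rewrite /obox /= !in_itv /=; split; first by move=> [[]].
by move=> [].
Qed.

Lemma cboxE p q x : cbox p q x <->
  [/\ p.1.1 <= x.1.1 <= q.1.1, p.1.2 <= x.1.2 <= q.1.2 & p.2 <= x.2 <= q.2].
Proof.
rewrite /cbox /= !in_itv /=; split; first by move=> [[]].
by move=> [].
Qed.

Lemma cbox_compact p q : compact (cbox p q).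
Proof. by apply: compact_setX; [apply: compact_setX|]; exact: segment_compact. Qed.

Lemma obox_measurable p q : measurable (obox p q).
Proof. by apply: measurableX; [apply: measurableX|]; exact: measurable_itv. Qed.

Lemma oboxI p q p' q' : obox p q `&` obox p' q' =
  obox (Num.max p.1.1 p'.1.1, Num.max p.1.2 p'.1.2, Num.max p.2 p'.2)
       (Num.min q.1.1 q'.1.1, Num.min q.1.2 q'.1.2, Num.min q.2 q'.2).
Proof.
apply/seteqP; split => x.
  move=> [/oboxE[/andP[? ?] /andP[? ?] /andP[? ?]] /oboxE[/andP[? ?] /andP[? ?] /andP[? ?]]].
  by apply/oboxE; split; rewrite /= gt_max lt_min; apply/andP; split; apply/andP.
move=> /oboxE[]; rewrite /= !gt_max !lt_min.
move=> /andP[/andP[? ?] /andP[? ?]] /andP[/andP[? ?] /andP[? ?]] /andP[/andP[? ?] /andP[? ?]].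
by split; apply/oboxE; split; apply/andP.
Qed.

Lemma cboxI_sub p q p' q' :
  cbox (Num.max p.1.1 p'.1.1, Num.max p.1.2 p'.1.2, Num.max p.2 p'.2)
       (Num.min q.1.1 q'.1.1, Num.min q.1.2 q'.1.2, Num.min q.2 q'.2) `<=` cbox p q.
Proof.
move=> x /cboxE[]; rewrite /= !ge_max !le_min.
move=> /andP[/andP[? ?] /andP[? ?]] /andP[/andP[? ?] /andP[? ?]] /andP[/andP[? ?] /andP[? ?]].
by apply/cboxE; split; apply/andP.
Qed.

(** A number that codes no pair of corners yields an empty open box. *)
Definition rat_box (n : nat) : R3 R * R3 R :=
  if @unpickle (rat * rat * rat * (rat * rat * rat))%type n is Some (a, b)
  then ((ratr a.1.1, ratr a.1.2, ratr a.2), (ratr b.1.1, ratr b.1.2, ratr b.2))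
  else (0, 0).

(** Countability of the union makes open sets measurable and lets almost-everywhere statements be
    checked box by box. Asking that the closed box lie in [D] leaves room for test functions
    supported in it. *)
Lemma open_rat_boxes D : open D ->
  D = \bigcup_(n in [set n | cbox (rat_box n).1 (rat_box n).2 `<=` D])
        obox (rat_box n).1 (rat_box n).2.
Proof.
move=> oD; apply/seteqP; split => [x Dx|x [n /= nD xn]]; last first.
  by apply: nD; move/oboxE : xn => -[/andP[? ?] /andP[? ?] /andP[? ?]];
    apply/cboxE; split; apply/andP; split; exact: ltW.
have [e /= e0 xe] := (nbhs_ballP _ _).1 (open_nbhs_nbhs (conj oD Dx)).
have lo t : exists a : rat, t - e < ratr a < t.
  have [a] := @rat_in_itvoo R (t - e) t ltac:(by rewrite ltrBlDr ltrDl).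
  by rewrite in_itv/= => ?; exists a.
have hi t : exists a : rat, t < ratr a < t + e.
  have [a] := @rat_in_itvoo R t (t + e) ltac:(by rewrite ltrDl).
  by rewrite in_itv/= => ?; exists a.
have [a1 /andP[a1l a1r]] := lo x.1.1; have [a2 /andP[a2l a2r]] := lo x.1.2.
have [a3 /andP[a3l a3r]] := lo x.2; have [b1 /andP[b1l b1r]] := hi x.1.1.
have [b2 /andP[b2l b2r]] := hi x.1.2; have [b3 /andP[b3l b3r]] := hi x.2.
have [N NE] : exists N, rat_box N =
    ((ratr a1, ratr a2, ratr a3), (ratr b1, ratr b2, ratr b3)).
  exists (@pickle (rat * rat * rat * (rat * rat * rat))%type ((a1, a2, a3), (b1, b2, b3))).
  by rewrite /rat_box pickleK.
exists N; rewrite /= NE.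
  move=> y /cboxE[/= /andP[? ?] /andP[? ?] /andP[? ?]]; apply: xe.
  rewrite -ball_normE /ball_ /=; do 2 (rewrite prod_normE gt_max /=).
  rewrite !ltr_norml; lra.
by apply/oboxE; split; apply/andP.
Qed.

Lemma open_measurable3 D : open D -> measurable D.
Proof.
move=> /open_rat_boxes ->; apply: bigcup_measurable => n _; exact: obox_measurable.
Qed.

(** The factor [n.+1] steepens each side: [exp (- 1 / (n.+1 s))] tends to 1 for every [s > 0], so
    the bumps fill the open box while their support stays in the closed one. *)
Definition bump p q (n : nat) x : R :=
  let z s := flat_exp 1 (n.+1%:R * s) in
  z (x.1.1 - p.1.1) * z (q.1.1 - x.1.1) * (z (x.1.2 - p.1.2) * z (q.1.2 - x.1.2)) *
  (z (x.2 - p.2) * z (q.2 - x.2)).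

Lemma flat_exp1_itv (s : R) : 0 <= flat_exp 1 s <= 1.
Proof.
rewrite /flat_exp; case: ifPn => [s0|_]; last by rewrite lexx ler01.
rewrite hornerC mul1r expR_ge0 -[leRHS]expR0 ler_expR oppr_le0 invr_ge0 ltW//.
Qed.

Lemma flat_exp1_cvg (s : R) : (fun n => flat_exp 1 (n.+1%:R * s)) @ \oo -->
  (if 0 < s then 1 else 0 : R).
Proof.
case: ifPn => s0; last first.
  rewrite (_ : (fun _ => _) = cst 0); first exact: cvg_cst.
  by apply/funext => n; rewrite /flat_exp ifF// pmulr_rgt0// (negbTE s0).
rewrite (_ : (fun _ => _) = fun n => expR (- (n.+1%:R^-1 * s^-1))); last first.
  by apply/funext => n; rewrite /flat_exp pmulr_rgt0// s0 hornerC mul1r invfM.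
rewrite -[X in _ --> X]expR0; apply: continuous_cvg; first exact: continuous_expR.
rewrite -oppr0 -[X in - X](mul0r s^-1); apply: cvgN; apply: cvgMr_tmp.
exact: cvg_harmonic.
Qed.

Lemma bump_itv p q n x : 0 <= bump p q n x <= 1.
Proof.
have z0 s : 0 <= flat_exp 1 s :> R by case/andP: (flat_exp1_itv s).
have z1 s : flat_exp 1 s <= 1 :> R by case/andP: (flat_exp1_itv s).
by rewrite /bump /= !mulr_ile1 ?mulr_ge0.
Qed.

Lemma bump_cvg p q x : bump p q ^~ x @ \oo --> (\1_(obox p q) x : R).
Proof.
have -> : \1_(obox p q) x =
    (if 0 < x.1.1 - p.1.1 then 1 else 0) * (if 0 < q.1.1 - x.1.1 then 1 else 0) *
    ((if 0 < x.1.2 - p.1.2 then 1 else 0) * (if 0 < q.1.2 - x.1.2 then 1 else 0)) *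
    ((if 0 < x.2 - p.2 then 1 else 0) * (if 0 < q.2 - x.2 then 1 else 0)) :> R.
  rewrite indicE !subr_gt0; have [/set_mem/oboxE|/negP xo] := boolP (x \in _).
    by move=> [/andP[-> ->] /andP[-> ->] /andP[-> ->]]; rewrite !mulr1.
  do 6 (case: ifPn => ?; rewrite ?(mul0r, mulr0)//).
  by exfalso; apply: xo; apply/mem_set/oboxE; split; apply/andP.
have z s := @flat_exp1_cvg s.
by apply: cvgM; [apply: cvgM|]; apply: cvgM; exact: z.
Qed.

Lemma bump_test p q n D : cbox p q `<=` D -> test_function D (bump p q n).
Proof.
move=> pqD; split.
  have c1 (k : R) : continuous (k \*: (fst \o fst) : R3 R -> R).
    move=> x; apply: cvgZl_tmp; apply: (@cvg_comp _ _ _ fst fst _ (nbhs x.1)); exact: cvg_fst.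
  have c2 (k : R) : continuous (k \*: (snd \o fst) : R3 R -> R).
    move=> x; apply: cvgZl_tmp; apply: (@cvg_comp _ _ _ fst snd _ (nbhs x.1)); [exact: cvg_fst|exact: cvg_snd].
  have c3 (k : R) : continuous (k \*: snd : R3 R -> R).
    move=> x; apply: cvgZl_tmp; exact: cvg_snd.
  have base (l : {linear R3 R -> R}) f c : continuous l -> (forall x, f x = l x + c) ->
      flat_algebra (fun x => flat_exp 1 (f x)).
    move=> cl fE; rewrite (_ : (fun x => _) = fun x => flat_exp 1 (l x + c)).
      exact: flat_base.
    by apply/funext => x; rewrite fE.
  pose m : R := n.+1%:R.
  apply: flat_algebra_smooth; apply: flat_mul; [apply: flat_mul|]; apply: flat_mul.
  - by apply: (base (m \*: (fst \o fst)) _ (- (m * p.1.1))) => [|x]; [exact: c1|rewrite /= mulrBr].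
  - by apply: (base ((- m) \*: (fst \o fst)) _ (m * q.1.1)) => [|x]; [exact: c1|rewrite /= mulrBr /GRing.scale/= mulNr addrC].
  - by apply: (base (m \*: (snd \o fst)) _ (- (m * p.1.2))) => [|x]; [exact: c2|rewrite /= mulrBr].
  - by apply: (base ((- m) \*: (snd \o fst)) _ (m * q.1.2)) => [|x]; [exact: c2|rewrite /= mulrBr /GRing.scale/= mulNr addrC].
  - by apply: (base (m \*: snd) _ (- (m * p.2))) => [|x]; [exact: c3|rewrite /= mulrBr].
  - by apply: (base ((- m) \*: snd) _ (m * q.2)) => [|x]; [exact: c3|rewrite /= mulrBr /GRing.scale/= mulNr addrC].
exists (cbox p q); split=> // [|x]; first exact: cbox_compact.
have z0 (s : R) : s <= 0 -> flat_exp 1 (n.+1%:R * s) = 0.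
  by move=> s0; rewrite /flat_exp ltNge pmulr_rle0// s0.
move=> xpq; rewrite /bump; apply: contra_notP xpq => /eqP.
rewrite !mulf_eq0 !negb_or => /andP[/andP[/andP[h1 h2] /andP[h3 h4]] /andP[h5 h6]].
by apply/cboxE; split; apply/andP; split; rewrite leNgt; apply/negP => H;
  [move: h1|move: h2|move: h3|move: h4|move: h5|move: h6];
  rewrite z0 ?eqxx// ltW// subr_lt0.
Qed.

End boxes.

(** The measurability and sign of [f] are arguments, so that the measure structure can be inferred
    from the term alone. *)
Definition density d (T : measurableType d) (R : realType)
    (mu : {measure set T -> \bar R}) (f : T -> \bar R)
    of measurable_fun setT f & (forall x, 0 <= f x)%E :=
  fun A => (\int[mu]_(x in A) f x)%E.

Section density_measure.
Context d (T : measurableType d) (R : realType) (mu : {measure set T -> \bar R}).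
Variables (f : T -> \bar R) (mf : measurable_fun setT f) (f0 : (forall x, 0 <= f x)%E).

Let density0 : density mu mf f0 set0 = 0%E. Proof. exact: integral_set0. Qed.
Let density_ge0 A : (0 <= density mu mf f0 A)%E. Proof. exact: integral_ge0. Qed.
Let density_additive : semi_sigma_additive (density mu mf f0).
Proof. exact: semi_sigma_additive_nng_induced. Qed.

HB.instance Definition _ := isMeasure.Build _ _ _ (density mu mf f0)
  density0 density_ge0 density_additive.

End density_measure.

(** The positive and negative parts of [g] are densities of two finite measures that agree on a
    class stable under intersection, hence on all measurable sets. *)
Lemma ae_eq0_generator d (T : measurableType d) (R : realType)
    (mu : {measure set T -> \bar R}) (G : set (set T)) (c : nat -> set T) (g : T -> R) :
  measurable = <<s G >> -> setI_closed G -> (forall n, G (c n)) ->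
  \bigcup_n c n = setT -> mu.-integrable setT (EFin \o g) ->
  (forall A, G A -> \int[mu]_(x in A) g x = 0) ->
  {ae mu, forall x, g x = 0}.
Proof.
move=> mG GI Gc cT ig g0.
have mg := measurable_int _ ig.
have mGm A : G A -> measurable A by move=> GA; rewrite mG; exact: sub_sigma_algebra.
have igA A : measurable A -> mu.-integrable A (EFin \o g).
  by move=> mA; apply: integrableS ig.
pose mup := density mu (measurable_funepos mg) (fun x => funepos_ge0 _ x).
pose mun := density mu (measurable_funeneg mg) (fun x => funeneg_ge0 _ x).
have E A : measurable A -> (mup A = mun A)%E -> (\int[mu]_(x in A) (g x)%:E = 0)%E.
  move=> mA pn; rewrite integralE.
  rewrite -[X in (X - _)%E]/(mup A) pn subee//.
  exact: integrable_neg_fin_num (igA A mA).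
have pn A : measurable A -> mup A = mun A.
  apply: (measure_unique G c mG GI Gc cT) => [B GB|n].
    have pf := integrable_pos_fin_num (mGm _ GB) (igA _ (mGm _ GB)).
    have nf := integrable_neg_fin_num (mGm _ GB) (igA _ (mGm _ GB)).
    have := g0 B GB; rewrite /Rintegral integralE fineB// => /subr0_eq pn.
    by rewrite -[LHS](fineK pf) -[RHS](fineK nf); congr EFin.
  exact: (integral_funepos_lt_pinfty (mGm _ (Gc n)) (igA _ (mGm _ (Gc n)))).
have : ae_eq mu setT (EFin \o g) (cst 0%E).
  apply: (@integral_ae_eq _ _ _ mu setT measurableT (cst 0%E) (EFin \o g)) => //.
  by move=> A _ mA; rewrite integral0; exact/E/pn.
by apply: filterS => x /(_ Logic.I) [].
Qed.


#[local] Instance ae_leb3_filter (R : realType) : Filter (almost_everywhere (leb3 R)).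
Proof. exact: ae_filter_ringOfSetsType. Qed.

(** * The fundamental lemma of the calculus of variations on open sets *)

Section fundamental_lemma.
Context {R : realType}.

Definition oboxes : set (set (R3 R)) := [set A | exists p q, A = obox p q].

Lemma obox_cover (x : R3 R) :
  exists n : nat, obox (- n%:R, - n%:R, - n%:R) (n%:R, n%:R, n%:R) x.
Proof.
have [n xn] : exists n : nat, `|x.1.1| + `|x.1.2| + `|x.2| < n%:R.
  exists (Num.truncn (`|x.1.1| + `|x.1.2| + `|x.2|)).+1.
  exact: truncnS_gt.
exists n; apply/oboxE => /=; rewrite -!ltr_norml.
have := normr_ge0 x.1.1; have := normr_ge0 x.1.2; have := normr_ge0 x.2.
by split; lra.
Qed.

(** Each slab [a < x_i < b] is a countable union of boxes. The coordinates, and with them the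
    identity map, are therefore measurable from the sigma-algebra generated by the boxes to the
    product one. *)
Lemma oboxesE : measurable = <<s oboxes >>.
Proof.
apply/seteqP; split; last first.
  apply: smallest_sub; first exact: sigma_algebra_measurable.
  by move=> _ [p [q ->]]; exact: obox_measurable.
pose T' := g_sigma_algebraType oboxes.
have mbox p q : measurable (obox p q : set T').
  by apply: sub_sigma_algebra; exists p, q.
have m1 : measurable_fun setT (fun x : T' => (x : R3 R).1.1).
  apply: (measurability _ (RGenOpens.measurableE R)) => _ [_ [a [b ->]] <-].
  rewrite setTI (_ : _ @^-1` _ = \bigcup_n obox (a, - n%:R, - n%:R) (b, n%:R, n%:R)).
    exact: bigcupT_measurable.
  apply/seteqP; split => [x|x [n _ /oboxE[]]]; rewrite /= ?in_itv//= => xab.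
  have [n /oboxE[_ ? ?]] := obox_cover x; exists n => //; exact/oboxE.
have m2 : measurable_fun setT (fun x : T' => (x : R3 R).1.2).
  apply: (measurability _ (RGenOpens.measurableE R)) => _ [_ [a [b ->]] <-].
  rewrite setTI (_ : _ @^-1` _ = \bigcup_n obox (- n%:R, a, - n%:R) (n%:R, b, n%:R)).
    exact: bigcupT_measurable.
  apply/seteqP; split => [x|x [n _ /oboxE[]]]; rewrite /= ?in_itv//= => xab.
  have [n /oboxE[? _ ?]] := obox_cover x; exists n => //; exact/oboxE.
have m3 : measurable_fun setT (fun x : T' => (x : R3 R).2).
  apply: (measurability _ (RGenOpens.measurableE R)) => _ [_ [a [b ->]] <-].
  rewrite setTI (_ : _ @^-1` _ = \bigcup_n obox (- n%:R, - n%:R, a) (n%:R, n%:R, b)).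
    exact: bigcupT_measurable.
  apply/seteqP; split => [x|x [n _ /oboxE[]]]; rewrite /= ?in_itv//= => xab.
  have [n /oboxE[? ? _]] := obox_cover x; exists n => //; exact/oboxE.
have mid : measurable_fun setT (fun x : T' => (((x : R3 R).1.1, (x : R3 R).1.2), (x : R3 R).2)).
  by apply: measurable_fun_pair => //; exact: measurable_fun_pair.
move=> A mA; have := mid measurableT A mA.
rewrite setTI (_ : _ @^-1` A = A)//.
by apply/seteqP; split => -[[]].
Qed.

Lemma continuous_measurable3 (f : R3 R -> R) : continuous f -> measurable_fun setT f.
Proof.
move=> cf; apply: (measurability _ (RGenOpens.measurableE R)) => _ [_ [a [b ->]] <-].
rewrite setTI; apply: open_measurable3; apply: open_comp => [x _|]; first exact: cf.
exact: interval_open.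
Qed.

Lemma smooth_continuous (f : R3 R -> R) : smooth f -> continuous f.
Proof. by move=> /(_ 0%N 0%N 0%N) sf x; exact: differentiable_continuous. Qed.

(** Dominated convergence along the bumps turns vanishing against test functions into vanishing
    integrals over boxes, which form a class stable under intersection. *)
Lemma test_function_ae_eq0 (D : set (R3 R)) (g : R3 R -> R) : open D ->
  (leb3 R).-integrable D (EFin \o g) ->
  (forall psi, test_function D psi -> \int[leb3 R]_(x in D) (g x * psi x) = 0) ->
  {ae leb3 R, forall x, D x -> g x = 0}.
Proof.
move=> oD ig gpsi; have mD := open_measurable3 oD.
have mg : measurable_fun D g by apply/measurable_EFinP; exact: measurable_int ig.
have int0 p q : cbox p q `<=` D -> \int[leb3 R]_(x in obox p q) g x = 0.
  move=> pqD.
  have bcvg : \int[leb3 R]_(x in D) (g x * bump p q n x) @[n --> \oo] -->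
      \int[leb3 R]_(x in D) (g x * \1_(obox p q) x).
    have mb n : measurable_fun D (g \* bump p q n).
      apply: measurable_funM => //; apply: measurable_funTS.
      apply: continuous_measurable3; apply: smooth_continuous.
      by case: (bump_test n pqD).
    apply: (cvg_Rintegral_dominated (mu := leb3 R) mD (w := fun n x => g x * bump p q n x)
      (v := fun x => g x * \1_(obox p q) x) (G := fun x => `|g x|)).
    - exact: mb.
    - by move=> x _; apply: cvgM; [exact: cvg_cst|exact: bump_cvg].
    - exact: integrable_norm ig.
    - move=> n x _; rewrite normrM ler_piMr// ger0_norm; have /andP[] := bump_itv p q n x => //.
  have : \int[leb3 R]_(x in D) (g x * \1_(obox p q) x) = 0.
    rewrite -(cvg_lim (@Rhausdorff R) bcvg) (_ : (fun _ => _) = cst 0) ?lim_cst//.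
    by apply/funext => n; rewrite gpsi//; exact: bump_test.
  move=> <-; rewrite Rintegral_mkcond [RHS]Rintegral_mkcond.
  apply: eq_Rintegral => x _; rewrite !patchE indicE.
  have [xo|xo] := boolP (x \in obox p q); last by rewrite mulr0; case: ifP.
  rewrite mulr1 ifT//; apply/mem_set/pqD.
  move/set_mem/oboxE : xo => -[/andP[? ?] /andP[? ?] /andP[? ?]].
  by apply/cboxE; split; apply/andP; split; exact: ltW.
pose Q n := obox (rat_box n).1 (rat_box n).2 : set (R3 R).
have Qae n : cbox (rat_box n).1 (rat_box n).2 `<=` D -> {ae leb3 R, forall x, Q n x -> g x = 0}.
  move=> QD; have mQ : measurable (Q n) by exact: obox_measurable.
  have QD' : Q n `<=` D.
    move=> x /oboxE[/andP[? ?] /andP[? ?] /andP[? ?]]; apply: QD.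
    by apply/cboxE; split; apply/andP; split; exact: ltW.
  (* Restriction to [Q n] is needed because integrals are known to vanish only on boxes whose
     closure lies in [D]; the intersection of any box with [Q n] is of this kind. *)
  have : {ae leb3 R, forall x, (g \_ (Q n)) x = 0}.
    apply: (@ae_eq0_generator _ _ _ (leb3 R) oboxes
      (fun n => obox (- n%:R, - n%:R, - n%:R) (n%:R, n%:R, n%:R))).
    - exact: oboxesE.
    - by move=> _ _ [p [q ->]] [p' [q' ->]]; rewrite oboxI; do 2 eexists.
    - by move=> k; do 2 eexists.
    - by apply/seteqP; split => // x _; have [k ?] := obox_cover x; exists k.
    - have := @integrableS _ _ _ (leb3 R) D (Q n) _ mD mQ QD' ig.
      move/(@integrable_mkcond _ _ _ (leb3 R) (Q n) (EFin \o g) mQ).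
      by rewrite restrict_EFin.
    - move=> _ [p [q ->]]; rewrite -Rintegral_mkcondr setIC /Q oboxI int0//.
      by apply: subset_trans QD; exact: cboxI_sub.
  apply: filterS => x H Qx; by move: H; rewrite patchE (mem_set Qx).
have : {ae leb3 R, forall x n, cbox (rat_box n).1 (rat_box n).2 `<=` D -> Q n x -> g x = 0}.
  apply: ae_foralln => n.
  have [QD|nQD] := pselect (cbox (rat_box n).1 (rat_box n).2 `<=` D).
    by apply: filterS (Qae n QD) => x H _.
  by apply: nearW => x /nQD.
apply: filterS => x H; rewrite (open_rat_boxes oD) => -[n /= QD Qx].
exact: (H n).
Qed.

End fundamental_lemma.

(** * The identity principle for analytic functions of one variable *)

Section identity_theorem.
Context {R : realType}.

(** Comparison with a geometric series of ratio at most 1/2, whence the factor 2. *)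
Lemma power_series_tail_le (d : nat -> R) (r M s : R) (p k : nat) :
  0 < r -> (forall n, `|d n| * r ^+ n <= M) -> `|s| <= r / 2 ->
  `|\sum_(i < k) s ^+ (p + i) * d (p + i)%N| <= M *+ 2 * (`|s| / r) ^+ p.
Proof.
move=> r0 dM sr; pose q := `|s| / r.
have q0 : 0 <= q by rewrite divr_ge0// ltW.
have q2 : q <= 2^-1 by rewrite /q ler_pdivrMr// mulrC.
have M0 : 0 <= M by apply: le_trans (dM 0%N); rewrite mulr_ge0// exprn_ge0// ltW.
apply: (le_trans (ler_norm_sum _ _ _)).
apply: (@le_trans _ _ (\sum_(i < k) M * q ^+ p * q ^+ i)).
  apply: ler_sum => i _; rewrite -mulrA -exprD normrM normrX.
  have -> : `|s| = q * r by rewrite /q divfK// gt_eqF.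
  rewrite exprMn mulrAC -mulrA mulrC ler_wpM2r ?exprn_ge0//.
rewrite -mulr_sumr mulrAC -[M *+ 2]mulr_natr ler_wpM2r ?exprn_ge0// ler_wpM2l//.
have : (1 - q) * \sum_(i < k) q ^+ i <= 1.
  by rewrite -opprB mulNr -subrX1 opprB lerBlDr lerDl exprn_ge0.
have : 0 <= \sum_(i < k) q ^+ i by apply: sumr_ge0 => i _; rewrite exprn_ge0.
nra.
Qed.

(** Strong induction: if all coefficients before [d p] vanish, then at a zero [t0 + s] of [f] the
    term [s ^+ p * d p] is balanced by a tail of order [p.+1]. Dividing by [s ^+ p] and letting [s]
    tend to 0 gives [d p = 0]. *)
Lemma power_series_eq0 (I : set R) (d : nat -> R) (r M t0 : R) (f : R -> R) :
  0 < r -> (forall n, `|d n| * r ^+ n <= M) ->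
  (forall t, I t -> `|t - t0| < r ->
     (fun N => \sum_(n < N) (t - t0) ^+ n * d n) @ \oo --> f t) ->
  (forall e, 0 < e -> exists t, [/\ I t, 0 < `|t - t0| < e & f t = 0]) ->
  forall n, d n = 0.
Proof.
move=> r0 dM cf acc; elim/ltn_ind => p ih.
have M0 : 0 <= M by apply: le_trans (dM 0%N); rewrite mulr_ge0// exprn_ge0// ltW.
apply/eqP; rewrite -normr_le0; apply/ler_addgt0Pl => e e0; rewrite addr0.
(* The tail bound after division by [|s| ^+ p] is at most [K * |s|]; the added 1 keeps [K] positive
   when [M] is 0. *)
pose K := (M *+ 2 + 1) / r ^+ p.+1.
have K0 : 0 < K by rewrite divr_gt0 ?exprn_gt0// ltr_wpDl// mulrn_wge0.
have [|t [It /andP[s0 st] ft0]] := acc (Num.min (r / 2) (e / K)).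
  by rewrite lt_min; apply/andP; split; apply: divr_gt0.
move: st; rewrite lt_min => /andP[/ltW sr /ltW se].
set s := t - t0 in s0 sr se.
have s_lt : `|s| < r by rewrite (le_lt_trans sr)// ltr_pdivrMr// ltr_pMr// ltr1n.
have := cf t It; rewrite -/s ft0 => /(_ s_lt) c0.
have c1 : (fun N => \sum_(n < (p.+1 + N)) s ^+ n * d n) @ \oo --> (0 : R).
  rewrite -(cvg_shiftn p.+1) in c0.
  by under eq_fun do rewrite addnC; exact: c0.
have c2 : (fun N => `|\sum_(n < (p.+1 + N)) s ^+ n * d n - s ^+ p * d p|) @ \oo -->
    `|0 - s ^+ p * d p|.
  by apply: cvg_norm; apply: cvgB => //; exact: cvg_cst.
rewrite sub0r normrN in c2.
have : `|s ^+ p * d p| <= M *+ 2 * (`|s| / r) ^+ p.+1.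
  rewrite -(cvg_lim (@Rhausdorff R) c2); apply: limr_le.
    by apply/cvg_ex; eexists; exact: c2.
  apply: nearW => N; rewrite big_split_ord /= big_ord_recr/= big1 ?add0r; last first.
    by move=> i _; rewrite ih// mulr0.
  rewrite addrAC subrr add0r; exact: power_series_tail_le.
rewrite normrM normrX exprMn exprS -mulrA mulrCA mulrA
  [X in _ <= X](_ : _ = `|s| ^+ p * (M *+ 2 * `|s| / r ^+ p.+1)); last first.
  by rewrite exprVn; ring.
rewrite ler_pM2l ?exprn_gt0// => /le_trans; apply.
apply: (@le_trans _ _ (K * `|s|)).
  have -> : K * `|s| = (M *+ 2 + 1) * `|s| / r ^+ p.+1 by rewrite /K mulrAC.
  rewrite ler_wpM2r ?invr_ge0 ?exprn_ge0 ?(ltW r0)//.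
  by rewrite ler_wpM2r// lerDl.
by rewrite -ler_pdivlMl// mulrC.
Qed.

(** The points near which [f] vanishes form a set that is open and closed in the connected set [I]:
    at a limit point the zeros accumulate, so all coefficients of the local expansion are 0. *)
Lemma analytic_eq0 (I : set R) (f : R -> R) (s e : R) : is_interval I ->
  (forall t0, I t0 -> exists (r M : R) (d : nat -> R),
     [/\ 0 < r, forall n, `|d n| * r ^+ n <= M
       & forall t, I t -> `|t - t0| < r ->
         (fun N => \sum_(n < N) (t - t0) ^+ n * d n) @ \oo --> f t]) ->
  I s -> 0 < e -> (forall t, I t -> `|t - s| < e -> f t = 0) ->
  forall t, I t -> f t = 0.
Proof.
move=> /connected_intervalP cI fI Is e0 fs.
pose C := [set t | exists2 n, 0 < n & forall u, I u -> `|u - t| < n -> f u = 0].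
suff IC : I `&` C = I.
  by move=> t It; move: (It); rewrite -IC => -[_ [n n0]]; apply; rewrite ?subrr ?normr0.
have oC : open C.
  rewrite openE => t [n n0 nC]; apply/nbhs_ballP; exists (n / 2) => /=; first exact: divr_gt0.
  move=> u; rewrite -ball_normE /= => tu; exists (n / 2); first exact: divr_gt0.
  move=> v Iv vu; apply: nC => //; rewrite -(subrK u v) -addrA (le_lt_trans (ler_normD _ _))//.
  by rewrite (splitr n) ltrD// distrC.
apply: cI.
- by exists s; split => //; exists e.
- by exists C.
exists (closure (I `&` C)); first exact: closed_closure.
apply/seteqP; split=> [t ICt|t [It clt]].
  by split; [case: ICt|exact: subset_closure].
split=> //; apply: contrapT => nCt.
have [r [M [d [r0 dM cf]]]] := fI t It.
have d0 : forall n, d n = 0.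
  apply: (power_series_eq0 r0 dM cf) => n n0.
  have [|u [[Iu Cu] tu]] := clt (ball t n); first exact: nbhsx_ballx.
  have [ut|ut] := eqVneq u t; first by move: Cu; rewrite ut.
  exists u; split => //.
    by rewrite normr_gt0 subr_eq0 ut /= distrC; move: tu; rewrite -ball_normE.
  by case: Cu => m m0; apply; rewrite ?subrr ?normr0.
apply: nCt; exists r => // u Iu ur.
have := cf u Iu ur; rewrite (_ : (fun _ => _) = cst 0); last first.
  by apply/funext => N; rewrite big1// => i _; rewrite d0 mulr0.
move=> c0; rewrite -(cvg_lim (@Rhausdorff R) c0).
exact: lim_cst.
Qed.

End identity_theorem.

(** * Square-integrable functions and weak derivatives *)

Section complex_parts.
Context {R : realType}.
Implicit Types z w : R[i].

Lemma Re_add z w : Re (z + w) = Re z + Re w. Proof. by case: z w => [? ?] [? ?]. Qed.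
Lemma Im_add z w : Im (z + w) = Im z + Im w. Proof. by case: z w => [? ?] [? ?]. Qed.
Lemma Re_opp z : Re (- z) = - Re z. Proof. by case: z. Qed.
Lemma Im_opp z : Im (- z) = - Im z. Proof. by case: z. Qed.
Lemma Re_mul z w : Re (z * w) = Re z * Re w - Im z * Im w.
Proof. by case: z w => [? ?] [? ?]. Qed.
Lemma Im_mul z w : Im (z * w) = Re z * Im w + Im z * Re w.
Proof. by case: z w => [? ?] [? ?]. Qed.
Lemma ReZ (a : R) z : Re (a%:C * z) = a * Re z.
Proof. by rewrite Re_mul /= mul0r subr0. Qed.
Lemma ImZ (a : R) z : Im (a%:C * z) = a * Im z.
Proof. by rewrite Im_mul /= mul0r addr0. Qed.
Lemma ReMr (a : R) z : Re (z * a%:C) = Re z * a.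
Proof. by rewrite mulrC ReZ mulrC. Qed.
Lemma ImMr (a : R) z : Im (z * a%:C) = Im z * a.
Proof. by rewrite mulrC ImZ mulrC. Qed.
Lemma complex_eq z w : Re z = Re w -> Im z = Im w -> z = w.
Proof. by case: z w => [? ?] [? ?] /= -> ->. Qed.
Lemma normc_sqr z : normc z ^+ 2 = Re z ^+ 2 + Im z ^+ 2.
Proof. by case: z => a b; rewrite /normc sqr_sqrtr// addr_ge0// sqr_ge0. Qed.

End complex_parts.

Section Rintegral_extra.
Context d (T : measurableType d) (R : realType) (mu : {measure set T -> \bar R}).

(** [fine] sends infinite values to 0, so that the rule holds for every [f]. It will be applied to
    integrands of potentials. *)
Lemma RintegralN (D : set T) (f : T -> R) :
  \int[mu]_(x in D) (- f x) = - \int[mu]_(x in D) f x.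
Proof.
rewrite /Rintegral.
have -> : (\int[mu]_(x in D) (- f x)%:E = \int[mu]_(x in D) (EFin \o f)^\- x -
    \int[mu]_(x in D) (EFin \o f)^\+ x)%E.
  rewrite integralE; congr (_ - _)%E; apply: eq_integral => x _.
    by rewrite funeposE funenegE.
  by rewrite funeposE funenegE /= opprK.
rewrite [in RHS]integralE.
have : (0 <= \int[mu]_(x in D) (EFin \o f)^\- x)%E by apply: integral_ge0 => x _; exact: funeneg_ge0.
have : (0 <= \int[mu]_(x in D) (EFin \o f)^\+ x)%E by apply: integral_ge0 => x _; exact: funepos_ge0.
case: (integral _ _ _) => [p| |]; case: (integral _ _ _) => [n| |] //= _ _; rewrite ?oppr0//.
by rewrite opprB.
Qed.

Lemma ae_eq_Rintegral (D : set T) (f g : T -> R) : measurable D ->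
  measurable_fun D f -> measurable_fun D g ->
  {ae mu, forall x, D x -> f x = g x} ->
  \int[mu]_(x in D) f x = \int[mu]_(x in D) g x.
Proof.
move=> mD mf mg fg; congr fine; apply: ae_eq_integral => //.
- exact/measurable_EFinP.
- exact/measurable_EFinP.
- by apply: filterS fg => x H Dx /=; rewrite H.
Qed.

End Rintegral_extra.

Lemma normcD_sqr_le {R : realType} (z w : R[i]) :
  normc (z + w) ^+ 2 <= 2 * (normc z ^+ 2 + normc w ^+ 2).
Proof.
rewrite !normc_sqr Re_add Im_add.
have := sqr_ge0 (Re z - Re w); have := sqr_ge0 (Im z - Im w); nra.
Qed.

Lemma normcM_sqr {R : realType} (z w : R[i]) :
  normc (z * w) ^+ 2 = normc z ^+ 2 * normc w ^+ 2.
Proof. by rewrite !normc_sqr Re_mul Im_mul; ring. Qed.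

Section L2_space.
Context {R : realType} (D : set (R3 R)).
Hypotheses (oD : open D) (bD : bounded_set D).
Local Notation mu := (leb3 R).
Implicit Types f g : R3 R -> R[i].

Lemma bounded_open_measurable : measurable D. Proof. exact: open_measurable3. Qed.
Let mD := bounded_open_measurable.

Lemma bounded_open_finite : (mu D < +oo)%E.
Proof.
have [M [_ MD]] := bD; pose N := `|M| + 1.
have DN x : D x -> cbox (- N, - N, - N) (N, N, N) x.
  move=> Dx; have : `|x| <= N by apply: MD => //; rewrite /N ltr_pwDr// ler_norm.
  by rewrite prod_normE ge_max prod_normE ge_max -andbA !ler_norml => /and3P[? ? ?]; apply/cboxE.
have mc : measurable (cbox (- N, - N, - N) (N, N, N)).
  by apply: measurableX; [apply: measurableX|]; exact: measurable_itv.
apply: (@le_lt_trans _ _ (mu (cbox (- N, - N, - N) (N, N, N)))).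
  by apply: le_measure; rewrite ?inE.
rewrite /cbox product_measure1E//=; last exact: measurableX.
rewrite product_measure1E//= !lebesgue_measure_itv/=.
by case: ifP => _; rewrite ?mule0 ?lt0y// -!EFinB -!EFinM ltry.
Qed.

Lemma bounded_int (chi : R3 R -> R) (C : R) : measurable_fun D chi ->
  (forall x, D x -> `|chi x| <= C) -> mu.-integrable D (EFin \o chi).
Proof.
move=> mchi chiC; apply: (@measurable_bounded_integrable _ _ _ mu chi D mD) => //.
  exact: bounded_open_finite.
exists C; split; first exact: num_real.
by move=> M CM x Dx /=; apply: (le_trans (chiC _ Dx)); exact: ltW.
Qed.

Lemma L2_sqr_measurable f : L2 D f -> measurable_fun D (fun x => normc (f x) ^+ 2).
Proof.
move=> [mre mim _]; rewrite (_ : (fun x => _) = fun x => Re (f x) ^+ 2 + Im (f x) ^+ 2).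
  by apply: measurable_funD; exact: measurable_funX.
by apply/funext => x; rewrite normc_sqr.
Qed.

Lemma L2_le (f : R3 R -> R[i]) (g : R3 R -> R) :
  measurable_fun D (fun x => Re (f x)) -> measurable_fun D (fun x => Im (f x)) ->
  mu.-integrable D (EFin \o g) -> (forall x, D x -> normc (f x) ^+ 2 <= g x) -> L2 D f.
Proof.
move=> mre mim ig fg; split => //; apply: (@le_integrable _ _ _ mu D mD _ (EFin \o g) _ _ ig).
  apply/measurable_EFinP; rewrite (_ : (fun x => _) = fun x => Re (f x) ^+ 2 + Im (f x) ^+ 2).
    by apply: measurable_funD; exact: measurable_funX.
  by apply/funext => x; rewrite normc_sqr.
by move=> x Dx; rewrite lee_fin ger0_norm ?sqr_ge0// (le_trans (fg _ Dx))// ler_norm.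
Qed.

(** Here and below [p] stands for [Re] or [Im]. On a set of finite measure [|p| <= 1 + |f|^2]
    suffices. *)
Lemma L2_part f (p : R[i] -> R) : L2 D f -> measurable_fun D (p \o f) ->
  (forall z, p z ^+ 2 <= normc z ^+ 2) -> mu.-integrable D (EFin \o (p \o f)).
Proof.
move=> [mre mim i2] mp pn.
have i1 : mu.-integrable D (EFin \o cst 1) by apply: (@bounded_int _ 1) => // x _; rewrite normr1.
apply: (@le_integrable _ _ _ mu D mD _ (fun x => 1%:E + (normc (f x) ^+ 2)%:E)%E).
- exact/measurable_EFinP.
- move=> x Dx; rewrite -EFinD lee_fin /=.
  rewrite [leRHS]ger0_norm ?addr_ge0 ?sqr_ge0//.
  have := pn (f x); have := sqr_ge0 (`|p (f x)| - 1); rewrite -[p (f x) ^+ 2]real_normK ?num_real//.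
  nra.
- exact: (@integrableD _ _ _ mu D mD _ _ i1 i2).
Qed.

Lemma L2_Re_int f : L2 D f -> mu.-integrable D (EFin \o (fun x => Re (f x))).
Proof.
move=> Lf; apply: (@L2_part f (@complex.Re R)) => // [|z]; first by case: Lf.
by rewrite normc_sqr lerDl sqr_ge0.
Qed.

Lemma L2_Im_int f : L2 D f -> mu.-integrable D (EFin \o (fun x => Im (f x))).
Proof.
move=> Lf; apply: (@L2_part f (@complex.Im R)) => // [|z]; first by case: Lf.
by rewrite normc_sqr lerDr sqr_ge0.
Qed.

Lemma L2D f g : L2 D f -> L2 D g -> L2 D (fun x => f x + g x).
Proof.
move=> Lf Lg; have [rf jf if2] := Lf; have [rg jg ig2] := Lg.
have i3 := @integrableZl _ _ _ mu D mD 2 _ (@integrableD _ _ _ mu D mD _ _ if2 ig2).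
apply: (@L2_le _ (fun x => 2 * (normc (f x) ^+ 2 + normc (g x) ^+ 2)) _ _ i3).
- by rewrite (_ : (fun x => _) = fun x => Re (f x) + Re (g x));
    [exact: measurable_funD|apply/funext => x; rewrite Re_add].
- by rewrite (_ : (fun x => _) = fun x => Im (f x) + Im (g x));
    [exact: measurable_funD|apply/funext => x; rewrite Im_add].
- by move=> x _; exact: normcD_sqr_le.
Qed.

Lemma L2Z (c : R[i]) f : L2 D f -> L2 D (fun x => c * f x).
Proof.
move=> Lf; have [rf jf if2] := Lf.
have i3 := @integrableZl _ _ _ mu D mD (normc c ^+ 2) _ if2.
apply: (@L2_le _ (fun x => normc c ^+ 2 * normc (f x) ^+ 2) _ _ i3).
- rewrite (_ : (fun x => _) = fun x => Re c * Re (f x) - Im c * Im (f x));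
    last by apply/funext => x; rewrite Re_mul.
  by apply: measurable_funB; apply: measurable_funM.
- rewrite (_ : (fun x => _) = fun x => Re c * Im (f x) + Im c * Re (f x));
    last by apply/funext => x; rewrite Im_mul.
  by apply: measurable_funD; apply: measurable_funM.
- by move=> x _; rewrite normcM_sqr.
Qed.

Lemma L2_0 : L2 D (fun=> 0).
Proof.
have i0 := @integrable0 _ _ _ mu D.
apply: (@L2_le _ (cst 0) _ _ i0) => //.
by move=> x _; rewrite normc_sqr /= expr0n addr0.
Qed.

Lemma L2_sum (I : Type) (s : seq I) (F : I -> R3 R -> R[i]) :
  (forall i, L2 D (F i)) -> L2 D (fun x => \sum_(i <- s) F i x).
Proof.
move=> LF; elim: s => [|i s ih].
  by rewrite (_ : (fun x => _) = fun=> 0); [exact: L2_0|apply/funext => x; rewrite big_nil].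
rewrite (_ : (fun x => _) = fun x => F i x + \sum_(j <- s) F j x); first exact: L2D.
by apply/funext => x; rewrite big_cons.
Qed.

Lemma L2norm_ge0 f : 0 <= L2norm D f. Proof. exact: sqrtr_ge0. Qed.

Lemma L2norm_sqr f : L2norm D f ^+ 2 = \int[mu]_(x in D) (normc (f x) ^+ 2).
Proof. by rewrite sqr_sqrtr//; apply: Rintegral_ge0 => x _; exact: sqr_ge0. Qed.

Lemma L2norm_ae f g : L2 D f -> L2 D g -> eq_ae D f g -> L2norm D f = L2norm D g.
Proof.
move=> Lf Lg fg; congr Num.sqrt; apply: (@ae_eq_Rintegral _ _ _ mu D) => //.
- exact: L2_sqr_measurable.
- exact: L2_sqr_measurable.
- by apply: filterS fg => x H Dx; rewrite H.
Qed.

(** The pointwise inequality [|z + w|^2 <= 2 (|z|^2 + |w|^2)] integrates directly and replaces the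
    triangle inequality. *)
Lemma L2normD_sqr_le f g : L2 D f -> L2 D g ->
  L2norm D (fun x => f x + g x) ^+ 2 <= 2 * (L2norm D f ^+ 2 + L2norm D g ^+ 2).
Proof.
move=> Lf Lg; have [_ _ if2] := Lf; have [_ _ ig2] := Lg.
have [_ _ ifg2] := L2D Lf Lg.
have i3 := @integrableD _ _ _ mu D mD _ _ if2 ig2.
rewrite !L2norm_sqr -(@RintegralD _ _ _ mu D _ _ mD if2 ig2) -(@RintegralZl _ _ _ mu D _ 2 mD i3).
apply: (@le_Rintegral _ _ _ mu D _ _ mD ifg2) => [|x _]; last exact: normcD_sqr_le.
exact: (@integrableZl _ _ _ mu D mD 2 _ i3).
Qed.

Lemma L2normZ_sqr (c : R[i]) f : L2 D f ->
  L2norm D (fun x => c * f x) ^+ 2 = normc c ^+ 2 * L2norm D f ^+ 2.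
Proof.
move=> [_ _ if2]; rewrite !L2norm_sqr -(@RintegralZl _ _ _ mu D _ _ mD if2).
by apply: eq_Rintegral => x _; rewrite normcM_sqr.
Qed.

Lemma integrableM_bounded (p : R3 R -> R) (chi : R3 R -> R) (C : R) :
  mu.-integrable D (EFin \o p) -> measurable_fun D chi ->
  (forall x, D x -> `|chi x| <= C) -> mu.-integrable D (fun x => (p x * chi x)%:E).
Proof.
move=> ip mchi chiC.
apply: (@le_integrable _ _ _ mu D mD _ _ _ _ (@integrableZl _ _ _ mu D mD C _ ip)).
  apply/measurable_EFinP; apply: measurable_funM => //.
  by apply/measurable_EFinP; exact: measurable_int ip.
move=> x Dx /=; rewrite lee_fin mulrC !normrM.
by rewrite ler_wpM2r// (le_trans (chiC _ Dx))// ler_norm.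
Qed.

(** For [e] above the norm of [f], integrating [|p| <= e + e^-1 |f|^2] gives the bound with [e] in
    place of the norm. Since the norm may be 0, [e] is then sent down to it. *)
Lemma L2_pairing_le f (p : R[i] -> R) (chi : R3 R -> R) (C : R) : L2 D f ->
  measurable_fun D (p \o f) -> (forall z, p z ^+ 2 <= normc z ^+ 2) ->
  measurable_fun D chi -> (forall x, D x -> `|chi x| <= C) ->
  `|\int[mu]_(x in D) (p (f x) * chi x)| <= `|C| * (fine (mu D) + 1) * L2norm D f.
Proof.
move=> Lf mp pn mchi chiC.
have ip := L2_part Lf mp pn.
have ipc := integrableM_bounded ip mchi chiC.
have [_ _ if2] := Lf.
have i1 : mu.-integrable D (EFin \o cst 1) by apply: (@bounded_int _ 1) => // x _; rewrite normr1.
have muD0 : 0 <= fine (mu D) by exact: fine_ge0.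
suff H e : 0 < e -> L2norm D f <= e ->
    `|\int[mu]_(x in D) (p (f x) * chi x)| <= `|C| * (fine (mu D) + 1) * e.
  apply/ler_addgt0Pl => e e0; pose K := `|C| * (fine (mu D) + 1).
  have K0 : 0 <= K by rewrite mulr_ge0// addr_ge0.
  have e' : 0 < L2norm D f + e / (K + 1).
    by rewrite ltr_wpDl ?L2norm_ge0// divr_gt0// ltr_wpDl.
  apply: (le_trans (H _ e' _)); first by rewrite lerDl divr_ge0 ?ltW// ltr_wpDl.
  rewrite -/K mulrDr addrC lerD2r mulrCA ler_piMr ?(ltW e0)//.
  by rewrite ler_pdivrMr ?ltr_wpDl// mul1r lerDl.
move=> e0 fe.
apply: (le_trans (@le_normr_Rintegral _ _ _ mu D _ mD ipc)).
apply: (@le_trans _ _ (\int[mu]_(x in D) (`|C| * (e * 1 + e^-1 * normc (f x) ^+ 2)))).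
  apply: (@le_Rintegral _ _ _ mu D _ _ mD).
  - exact: (@integrable_norm _ _ _ mu D _ ipc).
  - exact: (@integrableZl _ _ _ mu D mD `|C| _ (@integrableD _ _ _ mu D mD _ _
      (@integrableZl _ _ _ mu D mD e _ i1) (@integrableZl _ _ _ mu D mD e^-1 _ if2))).
  - move=> x Dx; rewrite normrM mulrC ler_pM//.
      by rewrite (le_trans (chiC _ Dx))// ler_norm.
    rewrite mulr1 -(ler_pM2l e0) mulrDr mulVKf ?gt_eqF//.
    have := pn (f x); rewrite -[p (f x) ^+ 2]real_normK ?num_real//.
    have := sqr_ge0 (e - `|p (f x)|); have := normr_ge0 (p (f x)); nra.
rewrite (@RintegralZl _ _ _ mu D _ `|C| mD) -?mulrA ?ler_wpM2l//; last first.
  exact: (@integrableD _ _ _ mu D mD _ _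
      (@integrableZl _ _ _ mu D mD e _ i1) (@integrableZl _ _ _ mu D mD e^-1 _ if2)).
rewrite (@RintegralD _ _ _ mu D _ _ mD); last 2 first.
  - exact: (@integrableZl _ _ _ mu D mD e _ i1).
  - exact: (@integrableZl _ _ _ mu D mD e^-1 _ if2).
rewrite (@RintegralZl _ _ _ mu D _ e mD i1) (@RintegralZl _ _ _ mu D _ e^-1 mD if2).
rewrite (@Rintegral_cst _ _ _ mu D mD) mul1r -L2norm_sqr mulrDl mul1r mulrC lerD2l.
rewrite -(ler_pM2l e0) mulVKf ?gt_eqF// -expr2 lerXn2r// nnegrE ?L2norm_ge0 ?ltW//.
Qed.

End L2_space.

(** * Weak derivatives and the H^2 norm *)

Section weak_partial_theory.
Context {R : realType} (D : set (R3 R)).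
Hypotheses (oD : open D) (bD : bounded_set D).
Local Notation mu := (leb3 R).
Implicit Types (f g : R3 R -> R[i]) (chi psi : R3 R -> R).

Let mD : measurable D := bounded_open_measurable oD.

Definition bounded_weight chi :=
  measurable_fun D chi /\ exists C, forall x, D x -> `|chi x| <= C.

Lemma continuous_bounded_weight chi : continuous chi -> bounded_weight chi.
Proof.
move=> cchi; split; first by apply: measurable_funTS; exact: continuous_measurable3.
have [M [_ MD]] := bD; pose N := `|M| + 1.
have DN x : D x -> cbox (- N, - N, - N) (N, N, N) x.
  move=> Dx; have : `|x| <= N by apply: MD => //; rewrite /N ltr_pwDr// ler_norm.
  by rewrite prod_normE ge_max prod_normE ge_max -andbA !ler_norml => /and3P[? ? ?]; apply/cboxE.
have cpt : compact (chi @` cbox (- N, - N, - N) (N, N, N)).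
  by apply: continuous_compact; [exact: continuous_subspaceT|exact: cbox_compact].
have [C [_ HC]] := compact_bounded cpt.
exists (`|C| + 1) => x Dx; apply: HC; first by rewrite ltr_pwDr// ler_norm.
by exists x => //; exact: DN.
Qed.

Lemma test_partial_weight psi i j k : test_function D psi -> bounded_weight (partial i j k psi).
Proof.
move=> [sp _]; apply: continuous_bounded_weight => x; exact: differentiable_continuous (sp i j k x).
Qed.

Lemma test_weight psi : test_function D psi -> bounded_weight psi.
Proof. exact: (@test_partial_weight psi 0 0 0). Qed.

Lemma cintegral_weight f chi : cintegral D (fun x => f x * (chi x)%:C) =
  (\int[mu]_(x in D) (Re (f x) * chi x)) +i* (\int[mu]_(x in D) (Im (f x) * chi x)).
Proof.
by rewrite /cintegral; congr (_ +i* _); apply: eq_Rintegral => x _; rewrite ?ReMr ?ImMr.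
Qed.

Lemma L2_weight_int f chi : L2 D f -> bounded_weight chi ->
  mu.-integrable D (fun x => (Re (f x) * chi x)%:E) /\
  mu.-integrable D (fun x => (Im (f x) * chi x)%:E).
Proof.
move=> Lf [mchi [C HC]]; split.
  exact: (integrableM_bounded oD (L2_Re_int oD bD Lf) mchi HC).
exact: (integrableM_bounded oD (L2_Im_int oD bD Lf) mchi HC).
Qed.

Lemma cintegral_weightD f g chi : L2 D f -> L2 D g -> bounded_weight chi ->
  cintegral D (fun x => (f x + g x) * (chi x)%:C) =
  cintegral D (fun x => f x * (chi x)%:C) + cintegral D (fun x => g x * (chi x)%:C).
Proof.
move=> Lf Lg bchi; have [r1 j1] := L2_weight_int Lf bchi; have [r2 j2] := L2_weight_int Lg bchi.
rewrite !cintegral_weight; apply: complex_eq; rewrite /=.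
  rewrite -(@RintegralD _ _ _ mu D _ _ mD r1 r2).
  by apply: eq_Rintegral => x _; rewrite Re_add mulrDl.
rewrite -(@RintegralD _ _ _ mu D _ _ mD j1 j2).
by apply: eq_Rintegral => x _; rewrite Im_add mulrDl.
Qed.

Lemma cintegral_weightZ (c : R[i]) f chi : L2 D f -> bounded_weight chi ->
  cintegral D (fun x => c * f x * (chi x)%:C) = c * cintegral D (fun x => f x * (chi x)%:C).
Proof.
move=> Lf bchi; have [r1 j1] := L2_weight_int Lf bchi.
rewrite !cintegral_weight; apply: complex_eq; rewrite ?Re_mul ?Im_mul /=.
  rewrite -(@RintegralZl _ _ _ mu D _ (Re c) mD r1) -(@RintegralZl _ _ _ mu D _ (Im c) mD j1).
  rewrite -(@RintegralB _ _ _ mu D _ _ mD); last 2 first.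
  - exact: (@integrableZl _ _ _ mu D mD _ _ r1).
  - exact: (@integrableZl _ _ _ mu D mD _ _ j1).
  by apply: eq_Rintegral => x _; rewrite Re_mul; ring.
rewrite -(@RintegralZl _ _ _ mu D _ (Re c) mD j1) -(@RintegralZl _ _ _ mu D _ (Im c) mD r1).
rewrite -(@RintegralD _ _ _ mu D _ _ mD); last 2 first.
- exact: (@integrableZl _ _ _ mu D mD _ _ j1).
- exact: (@integrableZl _ _ _ mu D mD _ _ r1).
by apply: eq_Rintegral => x _; rewrite Im_mul; ring.
Qed.

Lemma cintegral_weight_ae f g chi : L2 D f -> L2 D g -> bounded_weight chi -> eq_ae D f g ->
  cintegral D (fun x => f x * (chi x)%:C) = cintegral D (fun x => g x * (chi x)%:C).
Proof.
move=> [rf jf _] [rg jg _] [mchi _] fg; rewrite !cintegral_weight.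
congr (_ +i* _); apply: (@ae_eq_Rintegral _ _ _ mu D) => //; try exact: measurable_funM.
  by apply: filterS fg => x H Dx; rewrite H.
by apply: filterS fg => x H Dx; rewrite H.
Qed.

Lemma L2_test_ae_eq f g : L2 D f -> L2 D g ->
  (forall psi, test_function D psi ->
    cintegral D (fun x => f x * (psi x)%:C) = cintegral D (fun x => g x * (psi x)%:C)) ->
  eq_ae D f g.
Proof.
move=> Lf Lg fg.
have part (p : R[i] -> R) : (forall z w, p (z - w) = p z - p w) ->
    mu.-integrable D (EFin \o (fun x => p (f x))) ->
    mu.-integrable D (EFin \o (fun x => p (g x))) ->
    (forall psi, test_function D psi ->
      \int[mu]_(x in D) (p (f x) * psi x) = \int[mu]_(x in D) (p (g x) * psi x)) ->
    {ae mu, forall x, D x -> p (f x) = p (g x)}.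
  move=> pB pf pg H.
  have : {ae mu, forall x, D x -> p (f x) - p (g x) = 0}.
    apply: (test_function_ae_eq0 oD (g := fun x => p (f x) - p (g x))).
      exact: (@integrableB _ _ _ mu D mD _ _ pf pg).
    move=> psi tpsi; have [mpsi [C HC]] := test_weight tpsi.
    have i1 := integrableM_bounded oD pf mpsi HC.
    have i2 := integrableM_bounded oD pg mpsi HC.
    under eq_Rintegral do rewrite mulrBl.
    by rewrite (@RintegralB _ _ _ mu D _ _ mD i1 i2) H// subrr.
  by apply: filterS => x Hx Dx; apply/eqP; rewrite -subr_eq0; apply/eqP/Hx.
have H1 := part (@complex.Re R) _ (L2_Re_int oD bD Lf) (L2_Re_int oD bD Lg).
have H2 := part (@complex.Im R) _ (L2_Im_int oD bD Lf) (L2_Im_int oD bD Lg).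
have {}H1 : {ae mu, forall x, D x -> Re (f x) = Re (g x)}.
  apply: H1 => [z w|psi tpsi]; first by rewrite Re_add Re_opp.
  by have := fg psi tpsi; rewrite !cintegral_weight => -[].
have {}H2 : {ae mu, forall x, D x -> Im (f x) = Im (g x)}.
  apply: H2 => [z w|psi tpsi]; first by rewrite Im_add Im_opp.
  by have := fg psi tpsi; rewrite !cintegral_weight => -[].
apply: filterS2 H1 H2 => x H1 H2 Dx; apply: complex_eq; [exact: H1|exact: H2].
Qed.

Lemma weak_partial_unique i j k f g g' :
  is_weak_partial D i j k f g -> is_weak_partial D i j k f g' -> eq_ae D g g'.
Proof.
move=> [Lg Hg] [Lg' Hg']; apply: L2_test_ae_eq => // psi tpsi.
have := Hg psi tpsi; rewrite Hg'// => /(can_inj (signrMK _)) ->//.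
Qed.

Lemma is_weak_partial0 f : L2 D f -> is_weak_partial D 0 0 0 f f.
Proof. by move=> Lf; split=> // psi tpsi; rewrite expr0 mul1r. Qed.

Lemma is_weak_partialD i j k f g f' g' : L2 D f -> L2 D g ->
  is_weak_partial D i j k f f' -> is_weak_partial D i j k g g' ->
  is_weak_partial D i j k (fun x => f x + g x) (fun x => f' x + g' x).
Proof.
move=> Lf Lg [Lf' Hf] [Lg' Hg]; split; first exact: L2D.
move=> psi tpsi; rewrite cintegral_weightD//; last exact: test_partial_weight.
by rewrite cintegral_weightD ?Hf ?Hg ?mulrDr//; exact: test_weight.
Qed.

Lemma is_weak_partialZ i j k (c : R[i]) f f' : L2 D f ->
  is_weak_partial D i j k f f' ->
  is_weak_partial D i j k (fun x => c * f x) (fun x => c * f' x).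
Proof.
move=> Lf [Lf' Hf]; split; first exact: L2Z.
move=> psi tpsi; rewrite cintegral_weightZ//; last exact: test_partial_weight.
by rewrite cintegral_weightZ ?Hf//; [rewrite mulrCA|exact: test_weight].
Qed.

Lemma is_weak_partial_ae i j k f g f' : L2 D f -> L2 D g -> eq_ae D f g ->
  is_weak_partial D i j k f f' -> is_weak_partial D i j k g f'.
Proof.
move=> Lf Lg fg [Lf' Hf]; split=> // psi tpsi; rewrite -Hf//.
apply/esym/cintegral_weight_ae => //; exact: test_partial_weight.
Qed.

Lemma weak_partialP i j k f : H2 D f -> (i + j + k <= 2)%N ->
  is_weak_partial D i j k f (weak_partial D i j k f).
Proof.
move=> [_ Hf] /Hf[g Hg].
exact: (@xgetPex _ _ [set g | is_weak_partial D i j k f g]) (ex_intro _ g Hg).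
Qed.

Lemma H2D f g : H2 D f -> H2 D g -> H2 D (fun x => f x + g x).
Proof.
move=> Hf Hg; have [Lf _] := Hf; have [Lg _] := Hg; split; first exact: L2D.
move=> i j k ijk; eexists; apply: is_weak_partialD => //; exact: weak_partialP.
Qed.

Lemma H2Z (c : R[i]) f : H2 D f -> H2 D (fun x => c * f x).
Proof.
move=> Hf; have [Lf _] := Hf; split; first exact: L2Z.
move=> i j k ijk; eexists; apply: is_weak_partialZ => //; exact: weak_partialP.
Qed.

Lemma H2_ae f g : H2 D f -> L2 D g -> eq_ae D f g -> H2 D g.
Proof.
move=> Hf Lg fg; have [Lf _] := Hf; split=> // i j k ijk; eexists.
apply: (is_weak_partial_ae Lf Lg fg); exact: weak_partialP.
Qed.

Lemma H2_0 : H2 D (fun=> 0).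
Proof.
have L0 : L2 D (fun=> 0) by exact: L2_0.
split=> // i j k _; exists (fun=> 0); split=> // psi tpsi.
have c0 chi : cintegral D (fun x => 0 * (chi x)%:C) = 0.
  rewrite (_ : (fun x => _) = fun=> 0); last by apply/funext => x; rewrite mul0r.
  by rewrite /cintegral /= (@Rintegral_cst _ _ _ mu D mD) mul0r.
by rewrite !c0 mulr0.
Qed.

Lemma H2_sum (I : Type) (s : seq I) (F : I -> R3 R -> R[i]) :
  (forall i, H2 D (F i)) -> H2 D (fun x => \sum_(i <- s) F i x).
Proof.
move=> HF; elim: s => [|i s ih].
  by rewrite (_ : (fun x => _) = fun=> 0); [exact: H2_0|apply/funext => x; rewrite big_nil].
rewrite (_ : (fun x => _) = fun x => F i x + \sum_(j <- s) F j x); first exact: H2D.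
by apply/funext => x; rewrite big_cons.
Qed.

(** [weak_partial] is a choice; this lets [H2norm] be computed from any explicit weak derivative. *)
Lemma L2norm_weak_partial i j k f g : H2 D f -> (i + j + k <= 2)%N ->
  is_weak_partial D i j k f g -> L2norm D (weak_partial D i j k f) = L2norm D g.
Proof.
move=> Hf ijk Hg; have Hw := weak_partialP Hf ijk.
apply: L2norm_ae; [exact: oD|by case: Hw|by case: Hg|exact: weak_partial_unique Hw Hg].
Qed.

Lemma H2norm_sqr f : H2norm D f ^+ 2 =
  \sum_(i < 3) \sum_(j < 3) \sum_(k < 3 | (i + j + k <= 2)%N)
    L2norm D (weak_partial D i j k f) ^+ 2.
Proof. by rewrite sqr_sqrtr//; do 3 (apply: sumr_ge0 => ? _); exact: sqr_ge0. Qed.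

Lemma L2norm_le_H2norm f : H2 D f -> L2norm D f <= H2norm D f.
Proof.
move=> Hf; have [Lf _] := Hf.
rewrite -(@ler_pXn2r _ 2)// ?nnegrE ?sqrtr_ge0// H2norm_sqr.
have sum_ge (n : nat) (P : pred 'I_n.+1) (F : 'I_n.+1 -> R) :
    (forall i, 0 <= F i) -> P ord0 -> F ord0 <= \sum_(i | P i) F i.
  by move=> F0 P0; rewrite (bigD1 ord0)// lerDl sumr_ge0.
have -> : L2norm D f = L2norm D (weak_partial D (@ord0 2) (@ord0 2) (@ord0 2) f).
  exact/esym/(L2norm_weak_partial Hf _ (is_weak_partial0 Lf)).
apply: le_trans (sum_ge 2 xpredT _ _ _) => //; last first.
  by move=> i; do 2 (apply: sumr_ge0 => ? _); exact: sqr_ge0.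
apply: le_trans (sum_ge 2 xpredT _ _ _) => //; last first.
  by move=> j; apply: sumr_ge0 => ? _; exact: sqr_ge0.
by apply: (sum_ge 2 _ (fun k => L2norm D (weak_partial D _ _ k f) ^+ 2)) => // k; exact: sqr_ge0.
Qed.

Lemma eq_H2norm f g :
  (forall i j k, (i + j + k <= 2)%N ->
    L2norm D (weak_partial D i j k f) = L2norm D (weak_partial D i j k g)) ->
  H2norm D f = H2norm D g.
Proof.
move=> H; rewrite /H2norm; apply: (congr1 Num.sqrt).
apply: eq_bigr => i _; apply: eq_bigr => j _; apply: eq_bigr => k ijk.
by apply: (congr1 (fun t => t ^+ 2)); exact: H.
Qed.

Lemma H2norm_ae f g : H2 D f -> H2 D g -> eq_ae D f g -> H2norm D f = H2norm D g.
Proof.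
move=> Hf Hg fg; apply: eq_H2norm => i j k ijk; apply/esym.
apply: L2norm_weak_partial => //.
apply: (is_weak_partial_ae _ _ fg); [by case: Hf|by case: Hg|exact: weak_partialP].
Qed.

Lemma H2normZD_sqr_le (c : R[i]) f g : H2 D f -> H2 D g ->
  H2norm D (fun x => c * f x + g x) ^+ 2 <=
  2 * (normc c ^+ 2 * H2norm D f ^+ 2 + H2norm D g ^+ 2).
Proof.
move=> Hf Hg; have [Lf _] := Hf; have [Lg _] := Hg.
have subst_le (k a b d a' b' d' : R) : a = a' -> b = b' -> d = d' ->
  a' <= 2 * (k * b' + d') -> a <= 2 * (k * b + d) by move=> -> -> ->.
apply: (subst_le _ _ _ _ _ _ _ (H2norm_sqr _) (H2norm_sqr f) (H2norm_sqr g)).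
rewrite !mulr_sumr -big_split/= mulr_sumr; apply: ler_sum => i _.
rewrite !mulr_sumr -big_split/= mulr_sumr; apply: ler_sum => j _.
rewrite !mulr_sumr -big_split/= mulr_sumr; apply: ler_sum => k ijk.
have Wf := weak_partialP Hf ijk; have Wg := weak_partialP Hg ijk.
have W := is_weak_partialD (L2Z oD c Lf) Lg (is_weak_partialZ c Lf Wf) Wg.
rewrite (L2norm_weak_partial _ ijk W); last by apply: H2D => //; exact: H2Z.
have [Lf' _] := Wf; have [Lg' _] := Wg.
apply: (le_trans (L2normD_sqr_le oD (L2Z oD c Lf') Lg')).
by rewrite (L2normZ_sqr oD c Lf').
Qed.

End weak_partial_theory.

(** * Reflection of the dimer *)

Section reflection_invariance.
Context {R : realType}.
Local Notation mu := (leb3 R).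
Implicit Types (f g : R3 R -> R[i]) (D : set (R3 R)).

Lemma reflect1K : involutive (@reflect1 R).
Proof. by move=> [[x y] z]; rewrite /reflect1 /= opprK. Qed.

Lemma reflect1_continuous : continuous (@reflect1 R).
Proof.
move=> x.
have c1 : (fun y : R3 R => - y.1.1) @ x --> - x.1.1.
  by apply: cvgN; apply: (@cvg_comp _ _ _ fst fst _ (nbhs x.1)); exact: cvg_fst.
have c2 : (fun y : R3 R => y.1.2) @ x --> x.1.2.
  by apply: (@cvg_comp _ _ _ fst snd _ (nbhs x.1)); [exact: cvg_fst|exact: cvg_snd].
have c3 : (fun y : R3 R => y.2) @ x --> x.2 by exact: cvg_snd.
exact: (cvg_pair (cvg_pair c1 c2) c3).
Qed.

Lemma Rintegral_reflect D (f : R3 R -> R) : (forall x, D x -> D (reflect1 x)) ->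
  \int[mu]_(x in D) f (reflect1 x) = \int[mu]_(x in D) f x.
Proof.
move=> DR; congr fine.
exact: (@integral_involution _ _ R mu reflect1 (@reflect1_measurable R) reflect1K
  (@leb3_reflect R) D (fun x => (f x)%:E) DR).
Qed.

Lemma cintegral_reflect D f : (forall x, D x -> D (reflect1 x)) ->
  cintegral D (fun x => f (reflect1 x)) = cintegral D f.
Proof.
move=> DR; rewrite /cintegral (@Rintegral_reflect D (fun x => Re (f x)))//.
by rewrite (@Rintegral_reflect D (fun x => Im (f x))).
Qed.

Lemma ae_reflect (P : R3 R -> Prop) : {ae mu, forall x, P x} -> {ae mu, forall x, P (reflect1 x)}.
Proof.
move=> [A [mA A0 AP]]; exists (reflect1 @^-1` A); split.
- by rewrite -[X in measurable X]setTI; apply: (@reflect1_measurable R).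
- by rewrite -A0; exact: (@leb3_reflect R).
- by move=> x nP; apply: AP.
Qed.

Lemma eq_ae_reflect D f g : (forall x, D x -> D (reflect1 x)) ->
  eq_ae D f g -> eq_ae D (f \o reflect1) (g \o reflect1).
Proof. by move=> DR /ae_reflect; apply: filterS => x H Dx; apply: H; exact: DR. Qed.

Lemma enorm_reflect (x y : R3 R) : enorm (reflect1 x - reflect1 y) = enorm (x - y).
Proof. by rewrite /enorm /=; congr Num.sqrt; ring. Qed.

(** A change of variables, as the kernel depends only on the distance of [x] and [y]. *)
Lemma helmholtz_pot_reflect D om f x : (forall x, D x -> D (reflect1 x)) ->
  helmholtz_pot D om (f \o reflect1) x = helmholtz_pot D om f (reflect1 x).
Proof.
move=> DR; rewrite /helmholtz_pot.
pose F y := cexp ('i%C * om * (enorm (reflect1 x - y))%:C) /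
  (4 * pi * enorm (reflect1 x - y))%:C * f y.
rewrite -[RHS](@cintegral_reflect D F DR); congr cintegral.
by apply/funext => y; rewrite /F /comp enorm_reflect.
Qed.

Lemma measurable_fun_reflect D (f : R3 R -> R) : measurable D ->
  (forall x, D x -> D (reflect1 x)) ->
  measurable_fun D f -> measurable_fun D (f \o reflect1).
Proof.
move=> mD DR mf; apply: (@measurable_comp _ _ _ _ _ _ D) => //.
  by move=> _ [x Dx <-]; exact: DR.
by apply: measurable_funTS; exact: (@reflect1_measurable R).
Qed.

Lemma L2_reflect D f : measurable D -> (forall x, D x -> D (reflect1 x)) ->
  L2 D f -> L2 D (f \o reflect1).
Proof.
move=> mD DR [rf jf if2]; split.
- exact: (@measurable_fun_reflect D (fun x => Re (f x))).
- exact: (@measurable_fun_reflect D (fun x => Im (f x))).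
have mf2 : measurable_fun D (fun x => normc (f x) ^+ 2).
  by apply/measurable_EFinP; exact: measurable_int if2.
apply/integrableP; split.
  by apply/measurable_EFinP; exact: (@measurable_fun_reflect D (fun x => normc (f x) ^+ 2)).
have /integrableP[_] := if2; apply: le_lt_trans.
rewrite le_eqVlt; apply/orP; left; apply/eqP.
exact: (@integral_involution _ _ R mu reflect1 (@reflect1_measurable R) reflect1K
  (@leb3_reflect R) D (fun x => `|(normc (f x) ^+ 2)%:E|%E) DR).
Qed.

Lemma L2norm_reflect D f : (forall x, D x -> D (reflect1 x)) ->
  L2norm D (f \o reflect1) = L2norm D f.
Proof.
by move=> DR; congr Num.sqrt; exact: (@Rintegral_reflect D (fun x => normc (f x) ^+ 2)).
Qed.

Lemma translateE (v : R3 R) (A : set (R3 R)) : translate v A = (fun x => x - v) @^-1` A.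
Proof.
apply/seteqP; split => [_ [x Ax <-]|x Ax]; first by rewrite /= addrK.
by exists (x - v) => //; rewrite subrK.
Qed.

Lemma image_reflect1 (A : set (R3 R)) : reflect1 @` A = reflect1 @^-1` A.
Proof.
apply/seteqP; split => [_ [x Ax <-]|x Ax]; first by rewrite /= reflect1K.
by exists (reflect1 x) => //; rewrite reflect1K.
Qed.

(** The reflection exchanges the two halves of the dimer. *)
Lemma dimer_reflect D : symmetric_dimer D -> forall x, D x -> D (reflect1 x).
Proof.
move=> [D0 [L [_ _ _ [_ _ ->]]]] x; rewrite !translateE image_reflect1.
case=> Dx; [right|left]; move: Dx; rewrite /= /reflect1 /=.
  congr (D0 _); congr (_, _, _) => //=; ring.
congr (D0 _); congr (_, _, _) => /=; ring.
Qed.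

Lemma dimer_open D : symmetric_dimer D -> open D.
Proof.
move=> [D0 [L [[_ oD0 _ _] _ _ [_ _ ->]]]].
have ot (v : R3 R) (A : set (R3 R)) : open A -> open (translate v A).
  move=> oA; rewrite translateE; apply: open_comp => // x _.
  by apply: cvgB; [exact: cvg_id|exact: cvg_cst].
apply: openU; apply: ot => //; rewrite image_reflect1; apply: open_comp => // x _.
exact: reflect1_continuous.
Qed.

Lemma dimer_nonempty D : symmetric_dimer D -> D !=set0.
Proof.
move=> [D0 [L [[[x D0x] _ _ _] _ _ [_ _ ->]]]].
by exists (x + (- L, 0, 0)); left; exists x.
Qed.

Lemma norm_reflect1 (x : R3 R) : `|reflect1 x| = `|x|.
Proof. by rewrite !prod_normE /= normrN. Qed.

Lemma dimer_bounded D : symmetric_dimer D -> bounded_set D.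
Proof.
move=> [D0 [L [[_ _ _ [M [_ MD]]] _ _ [_ _ ->]]]].
have bD x : D0 x -> `|x| <= `|M| + 1 by apply: MD; rewrite ltr_pwDr// ler_norm.
exists (`|M| + 1 + Num.max `|((- L, 0, 0) : R3 R)| `|((L, 0, 0) : R3 R)|).
split; first exact: num_real.
move=> K HK x Dx; apply: le_trans (ltW HK).
case: Dx => [[y D0y <-]|[_ [y D0y <-] <-]]; apply: (le_trans (ler_normD _ _)); apply: lerD.
- exact: bD.
- by rewrite le_max lexx.
- by rewrite norm_reflect1; exact: bD.
- by rewrite le_max lexx orbT.
Qed.

End reflection_invariance.

(** * Complex integrals and the L^2 inner product *)

Section cintegral_theory.
Context {R : realType} (D : set (R3 R)).
Hypothesis mD : measurable D.
Local Notation mu := (leb3 R).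
Implicit Types f g : R3 R -> R[i].

Definition cintegrable f :=
  mu.-integrable D (fun x => (Re (f x))%:E) /\
  mu.-integrable D (fun x => (Im (f x))%:E).

(** Stated for signs and arbitrary [f], so that it applies inside the Helmholtz potential;
    [cintegralZ] treats general scalars for integrable [f]. *)
Lemma cintegralZ_sign f (b : bool) :
  cintegral D (fun x => (-1) ^+ b * f x) = (-1) ^+ b * cintegral D f.
Proof.
case: b; last by rewrite mul1r; congr cintegral; apply/funext => x; rewrite mul1r.
rewrite expr1 mulN1r; apply: complex_eq; rewrite ?Re_opp ?Im_opp /= -RintegralN;
  by apply: eq_Rintegral => x _; rewrite mulN1r ?Re_opp ?Im_opp.
Qed.

Lemma cintegralD f g : cintegrable f -> cintegrable g ->
  cintegral D (fun x => f x + g x) = cintegral D f + cintegral D g.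
Proof.
move=> [fr fi] [gr gi]; apply: complex_eq; rewrite ?Re_add ?Im_add /=.
  by rewrite -(@RintegralD _ _ _ mu D _ _ mD fr gr); apply: eq_Rintegral => x _; rewrite Re_add.
by rewrite -(@RintegralD _ _ _ mu D _ _ mD fi gi); apply: eq_Rintegral => x _; rewrite Im_add.
Qed.

Lemma cintegralZ (c : R[i]) f : cintegrable f ->
  cintegral D (fun x => c * f x) = c * cintegral D f.
Proof.
move=> [r1 j1]; rewrite /cintegral; apply: complex_eq; rewrite ?Re_mul ?Im_mul /=.
  rewrite -(@RintegralZl _ _ _ mu D _ (Re c) mD r1) -(@RintegralZl _ _ _ mu D _ (Im c) mD j1).
  rewrite -(@RintegralB _ _ _ mu D _ _ mD); last 2 first.
  - exact: (@integrableZl _ _ _ mu D mD _ _ r1).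
  - exact: (@integrableZl _ _ _ mu D mD _ _ j1).
  by apply: eq_Rintegral => x _; rewrite Re_mul.
rewrite -(@RintegralZl _ _ _ mu D _ (Re c) mD j1) -(@RintegralZl _ _ _ mu D _ (Im c) mD r1).
rewrite -(@RintegralD _ _ _ mu D _ _ mD); last 2 first.
- exact: (@integrableZl _ _ _ mu D mD _ _ j1).
- exact: (@integrableZl _ _ _ mu D mD _ _ r1).
by apply: eq_Rintegral => x _; rewrite Im_mul.
Qed.

Lemma cintegral_ae f g : cintegrable f -> cintegrable g -> eq_ae D f g ->
  cintegral D f = cintegral D g.
Proof.
move=> [r1 j1] [r2 j2] fg; congr (_ +i* _); apply: (@ae_eq_Rintegral _ _ _ mu D) => //.
- by apply/measurable_EFinP; exact: measurable_int r1.
- by apply/measurable_EFinP; exact: measurable_int r2.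
- by apply: filterS fg => x H Dx; rewrite H.
- by apply/measurable_EFinP; exact: measurable_int j1.
- by apply/measurable_EFinP; exact: measurable_int j2.
- by apply: filterS fg => x H Dx; rewrite H.
Qed.

Lemma L2inner_integrable f g : L2 D f -> L2 D g ->
  cintegrable (fun x => conjc (f x) * g x).
Proof.
move=> [rf jf if2] [rg jg ig2].
have i2 := @integrableD _ _ _ mu D mD _ _ if2 ig2.
have Rc z : Re (conjc z) = Re z :> R by case: z.
have Ic z : Im (conjc z) = - Im z :> R by case: z.
split; apply: (@le_integrable _ _ _ mu D mD _ _ _ _ i2).
- apply/measurable_EFinP.
  rewrite (_ : (fun x => _) = fun x => Re (f x) * Re (g x) + Im (f x) * Im (g x)).
    by apply: measurable_funD; exact: measurable_funM.
  by apply/funext => x; rewrite Re_mul Rc Ic mulNr opprK.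
- move=> x Dx /=; rewrite lee_fin Re_mul Rc Ic !normc_sqr mulNr opprK.
  rewrite [leRHS]ger0_norm ?addr_ge0 ?sqr_ge0// ler_norml.
  have := sqr_ge0 (Re (f x) - Re (g x)); have := sqr_ge0 (Im (f x) - Im (g x)).
  have := sqr_ge0 (Re (f x) + Re (g x)); have := sqr_ge0 (Im (f x) + Im (g x)).
  by move=> *; apply/andP; split; nra.
- apply/measurable_EFinP.
  rewrite (_ : (fun x => _) = fun x => Re (f x) * Im (g x) - Im (f x) * Re (g x)).
    by apply: measurable_funB; exact: measurable_funM.
  by apply/funext => x; rewrite Im_mul Rc Ic mulNr.
- move=> x Dx /=; rewrite lee_fin Im_mul Rc Ic !normc_sqr mulNr.
  rewrite [leRHS]ger0_norm ?addr_ge0 ?sqr_ge0// ler_norml.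
  have := sqr_ge0 (Re (f x) - Im (g x)); have := sqr_ge0 (Im (f x) - Re (g x)).
  have := sqr_ge0 (Re (f x) + Im (g x)); have := sqr_ge0 (Im (f x) + Re (g x)).
  by move=> *; apply/andP; split; nra.
Qed.

Lemma L2innerD f g h : L2 D f -> L2 D g -> L2 D h ->
  L2inner D f (fun x => g x + h x) = L2inner D f g + L2inner D f h.
Proof.
move=> Lf Lg Lh; rewrite /L2inner -cintegralD; [|exact: L2inner_integrable..].
by congr cintegral; apply/funext => x; rewrite mulrDr.
Qed.

Lemma L2innerZ (c : R[i]) f g : L2 D f -> L2 D g ->
  L2inner D f (fun x => c * g x) = c * L2inner D f g.
Proof.
move=> Lf Lg; rewrite /L2inner -cintegralZ; last exact: L2inner_integrable.
by congr cintegral; apply/funext => x; rewrite mulrCA.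
Qed.

Lemma L2inner_ae f f' g g' : L2 D f -> L2 D f' -> L2 D g -> L2 D g' ->
  eq_ae D f f' -> eq_ae D g g' -> L2inner D f g = L2inner D f' g'.
Proof.
move=> Lf Lf' Lg Lg' ff gg; apply: cintegral_ae; [exact: L2inner_integrable..|].
by apply: filterS2 ff gg => x H1 H2 Dx; rewrite H1 ?H2.
Qed.

Lemma L2inner_diag f : L2norm D f = 1 -> L2inner D f f = 1.
Proof.
move=> f1; have := L2norm_sqr D f; rewrite f1 expr1n => I1.
apply: complex_eq; rewrite /= ?I1.
  by apply: eq_Rintegral => x _; rewrite normc_sqr; case: (f x) => a b /=; ring.
rewrite (_ : Rintegral _ _ _ = \int[mu]_(x in D) 0).
  by rewrite (@Rintegral_cst _ _ _ mu D mD) mul0r.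
by apply: eq_Rintegral => x _; case: (f x) => a b /=; ring.
Qed.

End cintegral_theory.

(** * Parity of simple eigenfunctions and action of the reflection on resonances *)

Section parity.
Context {R : realType} (D : set (R3 R)).
Hypothesis HD : symmetric_dimer D.
Local Notation mu := (leb3 R).
Implicit Types f g : R3 R -> R[i].

Let DR := dimer_reflect HD.
Let oD := dimer_open HD.
Let bD := dimer_bounded HD.
Let mD : measurable D := open_measurable3 oD.

(** The boolean sign treats symmetric and antisymmetric modes at once in all that follows. *)
Lemma simple_eigenfunction_parity lam phi : simple_eigenvalue D lam ->
  eigenfunction D lam phi ->
  exists b : bool, eq_ae D (phi \o reflect1) (fun x => (-1) ^+ b * phi x).
Proof.
move=> [_ simp] ephi; have [Lp np Kp] := ephi.
have eR : eigenfunction D lam (phi \o reflect1).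
  split; first exact: L2_reflect.
    move=> p0; apply: np; move/(eq_ae_reflect DR): p0.
    by apply: filterS => x H Dx; have := H Dx; rewrite /= reflect1K.
  move/(eq_ae_reflect DR): Kp; apply: filterS => x H Dx.
  by rewrite /newton_pot helmholtz_pot_reflect//; exact: H.
have [c pc] := simp _ _ ephi eR.
have c2 : c ^+ 2 = 1.
  apply/eqP; rewrite -subr_eq0; apply/negP => c1; apply: np.
  apply: filterS2 pc (eq_ae_reflect DR pc) => x H1 H2 Dx.
  have := H2 Dx; rewrite /= reflect1K; have := H1 Dx; rewrite /= => -> /eqP.
  rewrite mulrA -expr2 -subr_eq0 -{1}[phi x]mul1r -mulrBl mulf_eq0.
  case/orP => /eqP // H; by move: c1; rewrite -oppr_eq0 opprB H eqxx.
move/eqP: c2; rewrite sqrf_eq1 => /orP[/eqP c1|/eqP c1]; [exists false|exists true];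
  by apply: filterS pc => x H Dx; rewrite H// c1.
Qed.

Lemma reflect1_differentiable (x : R3 R) : differentiable (@reflect1 R) x.
Proof.
have c11 : continuous (fst \o fst : R3 R -> R).
  by move=> y; apply: (@cvg_comp _ _ _ fst fst _ (nbhs y.1)); exact: cvg_fst.
have c12 : continuous (snd \o fst : R3 R -> R).
  by move=> y; apply: (@cvg_comp _ _ _ fst snd _ (nbhs y.1)); [exact: cvg_fst|exact: cvg_snd].
have c2 : continuous (snd : R3 R -> R) by move=> y; exact: cvg_snd.
have d11 : differentiable (fst \o fst : R3 R -> R) x by exact: linear_differentiable.
have d12 : differentiable (snd \o fst : R3 R -> R) x by exact: linear_differentiable.
have d2 : differentiable (snd : R3 R -> R) x by exact: linear_differentiable.
exact: (differentiable_pair (differentiable_pair (differentiableN d11) d12) d2).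
Qed.

Lemma derive_reflect (f : R3 R -> R) (v x : R3 R) :
  'D_v (f \o reflect1) x = 'D_(reflect1 v) f (reflect1 x).
Proof.
have E : (fun h : R => h^-1 *: (((f \o reflect1) \o shift x) (h *: v) - (f \o reflect1) x)) =
    (fun h => h^-1 *: ((f \o shift (reflect1 x)) (h *: reflect1 v) - f (reflect1 x))).
  apply/funext => h /=; congr (_ *: (f _ - _)).
  by rewrite /reflect1 /=; congr (_, _, _); rewrite /= /GRing.scale /=; ring.
by rewrite /derive E.
Qed.

(** The second and third basis vectors are fixed by the reflection. The first is reversed, and
    differentiability makes the derivative along [- v] the opposite of the one along [v], one sign
    for each of the [i] derivations. *)
Lemma partial_reflect (psi : R3 R -> R) i j k : smooth psi ->
  partial i j k (psi \o reflect1) = fun x => (-1) ^+ i * partial i j k psi (reflect1 x).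
Proof.
move=> sp.
pose P (v : R3 R) (g : R3 R -> R) x := 'D_v g x.
have inv v n (g : R3 R -> R) : reflect1 v = v ->
    iter n (P v) (g \o reflect1) = iter n (P v) g \o reflect1.
  by move=> vv; elim: n => [//|n ih]; apply/funext => x; rewrite /= ih /P derive_reflect vv.
pose g0 := iter k (P (0, 0, 1)) psi; pose g := iter j (P (0, 1, 0)) g0.
have e2 : reflect1 (0, 1, 0) = (0, 1, 0) :> R3 R by rewrite /reflect1 /= oppr0.
have e3 : reflect1 (0, 0, 1) = (0, 0, 1) :> R3 R by rewrite /reflect1 /= oppr0.
have -> : partial i j k (psi \o reflect1) = iter i (P (1, 0, 0)) (g \o reflect1).
  by rewrite /g -(inv _ _ _ e2) /g0 -(inv _ _ _ e3).
have -> : partial i j k psi = iter i (P (1, 0, 0)) g by [].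
have dg n x : differentiable (iter n (P (1, 0, 0)) g) x by exact: (sp n j k x).
elim: i => [|i ih]; first by apply/funext => x; rewrite mul1r.
apply/funext => x; rewrite [LHS]/= ih /P.
rewrite (_ : (fun x => _) = (-1) ^+ i \*: (iter i (P (1, 0, 0)) g \o reflect1))//.
have dgR y : differentiable (iter i (P (1, 0, 0)) g \o reflect1) y.
  by apply: differentiable_comp; [exact: reflect1_differentiable|exact: dg].
rewrite deriveZ; last exact: diff_derivable.
rewrite derive_reflect exprSr -mulrA; congr (_ * _).
rewrite deriveE//= deriveE// mulN1r -linearN; congr ('d _ _ _).
by rewrite [RHS](_ : _ = (- 1, - 0, - 0))// oppr0.
Qed.

Lemma test_function_reflect psi : test_function D psi -> test_function D (psi \o reflect1).
Proof.
move=> [sp [K [cK KD K0]]]; split.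
  move=> i j k x; rewrite partial_reflect//.
  apply: (@differentiableZ _ _ _ (partial i j k psi \o reflect1)).
  by apply: differentiable_comp; [exact: reflect1_differentiable|exact: sp].
exists (reflect1 @` K); split.
- apply: continuous_compact => //; apply: continuous_subspaceT; exact: reflect1_continuous.
- by move=> _ [x Kx <-]; apply: DR; exact: KD.
- by move=> x nK; apply: K0 => Kx; apply: nK; exists (reflect1 x); rewrite ?reflect1K.
Qed.

Lemma is_weak_partial_reflect i j k f g : L2 D f -> is_weak_partial D i j k f g ->
  is_weak_partial D i j k (f \o reflect1) (fun x => (-1) ^+ i * g (reflect1 x)).
Proof.
move=> Lf [Lg Hg]; have LgR := L2_reflect mD DR Lg.
split; first exact: (L2Z oD _ LgR).
move=> psi tpsi; have tR := test_function_reflect tpsi.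
have E x : partial i j k psi x = (-1) ^+ i * partial i j k (psi \o reflect1) (reflect1 x).
  rewrite partial_reflect; last by case: tpsi.
  by rewrite reflect1K mulrA -exprMn mulrNN mulr1 expr1n mul1r.
transitivity (cintegral D (fun x => (-1) ^+ i * f x * (partial i j k (psi \o reflect1) x)%:C)).
  rewrite -[RHS](cintegral_reflect _ DR); congr cintegral; apply/funext => x /=.
  by rewrite E rmorphM rmorphXn rmorphN1; ring.
rewrite cintegral_weightZ//; last exact: test_partial_weight.
rewrite Hg// (cintegral_weightZ oD bD _ LgR); last exact: test_weight tpsi.
rewrite mulrCA; congr (_ * (_ * _)).
rewrite -(cintegral_reflect _ DR); congr cintegral; apply/funext => x /=.
by rewrite reflect1K.
Qed.

(** Its fixed points are the functions of parity [b], so symmetry of a state becomes a fixed-point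
    equation. *)
Definition signed_reflect (b : bool) f x : R[i] := (-1) ^+ b * f (reflect1 x).

Lemma L2_signed_reflect b f : L2 D f -> L2 D (signed_reflect b f).
Proof. by move=> Lf; apply: (L2Z oD); exact: L2_reflect. Qed.

Lemma is_weak_partial_signed_reflect b i j k f g : L2 D f -> is_weak_partial D i j k f g ->
  is_weak_partial D i j k (signed_reflect b f) (fun x => (-1) ^+ b * ((-1) ^+ i * g (reflect1 x))).
Proof.
move=> Lf Hg; apply: is_weak_partialZ => //; first exact: L2_reflect.
exact: is_weak_partial_reflect.
Qed.

Lemma H2_signed_reflect b f : H2 D f -> H2 D (signed_reflect b f).
Proof.
move=> Hf; have [Lf _] := Hf; split; first exact: L2_signed_reflect.
move=> i j k ijk; eexists; apply: is_weak_partial_signed_reflect => //; exact: weak_partialP.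
Qed.

Lemma normc_sign_sqr n : normc ((-1) ^+ n : R[i]) ^+ 2 = 1.
Proof.
rewrite -signr_odd; case: (odd n); rewrite ?expr1 ?expr0 normc_sqr /=; ring.
Qed.

Lemma H2norm_signed_reflect b f : H2 D f -> H2norm D (signed_reflect b f) = H2norm D f.
Proof.
move=> Hf; have [Lf _] := Hf.
apply: eq_H2norm => i j k ijk; have W := weak_partialP Hf ijk; have [Lw _] := W.
rewrite (L2norm_weak_partial oD bD (H2_signed_reflect b Hf) ijk
  (is_weak_partial_signed_reflect b Lf W)).
set w := weak_partial _ _ _ _ _ in W Lw *.
have LwR := L2_reflect mD DR Lw.
have S := L2normZ_sqr oD ((-1) ^+ b) (L2Z oD ((-1) ^+ i) LwR).
rewrite (L2normZ_sqr oD ((-1) ^+ i) LwR) !normc_sign_sqr !mul1r L2norm_reflect// in S.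
by move/eqP: S; rewrite eqrXn2 ?L2norm_ge0// => /eqP.
Qed.

(** The cubic term is odd in [u], because its modulus factor ignores signs; the sign therefore
    passes through the integral together with the reflection. *)
Lemma resonance_signed_reflect b tau om u : resonance D tau om u ->
  resonance D tau om (signed_reflect b u).
Proof.
move=> [Hu Eu]; split; first exact: H2_signed_reflect.
move/(eq_ae_reflect DR): Eu; apply: filterS => x H Dx.
rewrite {1}/signed_reflect [X in _ * X](H Dx) /= mulrCA; congr (_ * _).
rewrite -helmholtz_pot_reflect// /helmholtz_pot -cintegralZ_sign; congr cintegral.
apply/funext => y; rewrite mulrCA; congr (_ * _).
by rewrite /signed_reflect /= normcM_sqr normc_sign_sqr mul1r mulrDr; congr (_ + _); rewrite mulrCA.
Qed.

End parity.

(** * Symmetry of the nonlinear states *)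

Section pairing.
Context {R : realType} (D : set (R3 R)) (p : R[i] -> R) (chi : R3 R -> R).
Hypotheses (oD : open D) (bD : bounded_set D).
Hypotheses (pD : forall z w, p (z + w) = p z + p w)
  (pZ : forall (k : R) z, p (k%:C * z) = k * p z)
  (pm : forall f : R3 R -> R[i], L2 D f -> measurable_fun D (p \o f))
  (pn : forall z, p z ^+ 2 <= normc z ^+ 2) (wchi : bounded_weight D chi).
Local Notation mu := (leb3 R).
Implicit Types f g : R3 R -> R[i].

Let mD : measurable D := open_measurable3 oD.

(** Real-valued, with [p] the real or imaginary part, so that the identity principle for real
    functions applies. *)
Definition pairing f : R := \int[mu]_(x in D) (p (f x) * chi x).

Let pairing_int f : L2 D f -> mu.-integrable D (fun x => (p (f x) * chi x)%:E).
Proof.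
move=> Lf; have [mchi [C HC]] := wchi.
exact: (integrableM_bounded oD (L2_part oD bD Lf (pm Lf) pn) mchi HC).
Qed.

Lemma pairingD f g : L2 D f -> L2 D g -> pairing (fun x => f x + g x) = pairing f + pairing g.
Proof.
move=> Lf Lg; rewrite /pairing -(@RintegralD _ _ _ mu D _ _ mD (pairing_int Lf) (pairing_int Lg)).
by apply: eq_Rintegral => x _; rewrite pD mulrDl.
Qed.

Lemma pairingZ (k : R) f : L2 D f -> pairing (fun x => k%:C * f x) = k * pairing f.
Proof.
move=> Lf; rewrite /pairing -(@RintegralZl _ _ _ mu D _ k mD (pairing_int Lf)).
by apply: eq_Rintegral => x _; rewrite pZ mulrA.
Qed.

Lemma pairing0 : pairing (fun=> 0) = 0.
Proof.
have p0 : p 0 = 0 by have := pZ 0 0; rewrite mulr0 mul0r.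
rewrite /pairing -[RHS](mul0r (fine (mu D))) -(@Rintegral_cst _ _ _ mu D mD).
by apply: eq_Rintegral => x _; rewrite p0 mul0r.
Qed.

Lemma pairing_sum (I : Type) (s : seq I) (F : I -> R3 R -> R[i]) :
  (forall i, L2 D (F i)) ->
  pairing (fun x => \sum_(i <- s) F i x) = \sum_(i <- s) pairing (F i).
Proof.
move=> LF; elim: s => [|i s ih].
  rewrite big_nil -[RHS]pairing0; congr pairing; apply/funext => x.
  by rewrite big_nil.
rewrite big_cons -ih -pairingD//; last exact: L2_sum.
by congr pairing; apply/funext => x; rewrite big_cons.
Qed.

Lemma pairing_le : exists2 C, 0 <= C & forall f, H2 D f -> `|pairing f| <= C * H2norm D f.
Proof.
have [mchi [C HC]] := wchi.
exists (`|C| * (fine (mu D) + 1)).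
  by rewrite mulr_ge0// addr_ge0// fine_ge0.
move=> f Hf; have [Lf _] := Hf.
apply: (le_trans (L2_pairing_le oD bD Lf (pm Lf) pn mchi HC)).
rewrite ler_wpM2l//; first by rewrite mulr_ge0// addr_ge0// fine_ge0.
exact: L2norm_le_H2norm.
Qed.

(** By [pairing_le] the pairing is linear and bounded in the H^2 norm, hence maps an expansion of
    [u] term by term to one with real coefficients, at the price of a constant factor in the
    bound. *)
Lemma pairing_analytic (P : set (R * R)) (u : R -> R -> R3 R -> R[i]) :
  real_analytic (E := R3 R -> R[i]^o) (H2 D) (H2norm D) P u ->
  (forall a t, P (a, t) -> H2 D (u a t)) ->
  forall a0 t0, P (a0, t0) -> exists (r M : R) (d : nat -> nat -> R),
    [/\ 0 < r, forall m n, `|d m n| * r ^+ (m + n) <= M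
      & forall a t, P (a, t) -> `|a - a0| < r -> `|t - t0| < r ->
        (fun N => \sum_(m < N) \sum_(n < N) ((a - a0) ^+ m * (t - t0) ^+ n) * d m n)
          @ \oo --> pairing (u a t)].
Proof.
move=> uan Hu a0 t0 P0; have [r [M [c [r0 cM uc]]]] := uan _ _ P0.
have [C C0 HC] := pairing_le.
exists r, (C * M), (fun m n => pairing (c m n)); split => //.
  move=> m n; have [Hc cMmn] := cM m n.
  apply: (@le_trans _ _ (C * H2norm D (c m n) * r ^+ (m + n))).
    by apply: ler_wpM2r; [rewrite exprn_ge0// ltW|exact: HC].
  by rewrite -mulrA ler_wpM2l.
move=> a t Pat ar tr.
pose S N : R3 R -> R[i] := fun x => \sum_(m < N) \sum_(n < N)
  (((a - a0) ^+ m * (t - t0) ^+ n)%:C * c m n x).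
have Hc m n : H2 D (c m n) by case: (cM m n).
have HS N : H2 D (S N).
  by apply: (H2_sum oD bD) => m; apply: (H2_sum oD bD) => n; apply: H2Z.
have pS N : pairing (S N) = \sum_(m < N) \sum_(n < N) ((a - a0) ^+ m * (t - t0) ^+ n) * pairing (c m n).
  rewrite pairing_sum; last first.
    move=> m; apply: (L2_sum oD) => n; apply: (L2Z oD); by case: (Hc m n).
  apply: eq_bigr => m _; rewrite pairing_sum; last first.
    by move=> n; apply: (L2Z oD); case: (Hc m n).
  by apply: eq_bigr => n _; rewrite pairingZ//; case: (Hc m n).
have Lu : L2 D (u a t) by case: (Hu _ _ Pat).
have HuS N : H2 D (fun x => u a t x + (-1)%:C * S N x).
  by apply: (H2D oD bD); [exact: Hu|exact: H2Z].
have pd N : pairing (u a t) - pairing (S N) = pairing (fun x => u a t x + (-1)%:C * S N x).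
  have LS : L2 D (S N) by case: (HS N).
  rewrite pairingD//; last exact: (L2Z oD).
  by rewrite pairingZ// mulN1r.
have := uc a t ar tr; move/cvgr0Pnorm_le => cv.
apply/cvgrPdist_le => e e0.
have e' : 0 < e / (C + 1) by rewrite divr_gt0// ltr_wpDl.
near=> N.
rewrite -pS pd; apply: (le_trans (HC _ (HuS N))).
have : `|H2norm D (fun x => u a t x + (-1)%:C * S N x)| <= e / (C + 1).
  have -> : (fun x => u a t x + (-1)%:C * S N x) =
    ((u a t : R3 R -> R[i]^o) - \sum_(m < N) \sum_(n < N)
                   ((a - a0) ^+ m * (t - t0) ^+ n)%:C *: (c m n : R3 R -> R[i]^o)).
    apply/funext => x; rewrite /GRing.opp/= rmorphN1 mulN1r; congr (_ - _).
    rewrite fct_sumE; apply: eq_bigr => m _; rewrite fct_sumE.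
    by apply: eq_bigr => n _.
  by near: N; exact: cv.
rewrite ger0_norm ?sqrtr_ge0// => He.
apply: (le_trans (ler_wpM2l C0 He)).
rewrite mulrCA ler_piMr ?(ltW e0)// ler_pdivrMr ?ltr_wpDl// mul1r.
by rewrite lerDl.
Unshelve. all: by end_near. Qed.

End pairing.

Lemma right_pinfty_near (R : realType) (A : set (R * R)) :
  filter_prod (0 : R)^'+ (pinfty_nbhs R) A ->
  exists e T, 0 < e /\ forall a t, 0 < a -> a < e -> T < t -> A (a, t).
Proof.
move=> [[S U] /= [/nbhs_ballP[e /= e0 eS] [T [_ TU]]] SUA].
exists e, T; split=> // a t a0 ae Tt; apply: SUA; split=> /=; last exact: TU.
by apply: eS => //; rewrite /ball/= sub0r normrN gtr0_norm.
Qed.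

Lemma parameters_itvl (R : realType) (delta t : R) :
  is_interval [set a | parameters delta (a, t)].
Proof.
move=> x y [/= x0 t0 _] [/= _ _ yd] z /andP[xz zy].
by split=> //=; [exact: lt_le_trans xz|rewrite (le_lt_trans _ yd)// lerD2r].
Qed.

Lemma parameters_itvr (R : realType) (delta a : R) :
  is_interval [set t | parameters delta (a, t)].
Proof.
move=> x y [/= a0 x0 xd] [/= _ y0 _] z /andP[xz zy].
have z0 : 0 < z by exact: lt_le_trans xz.
by split=> //=; rewrite (le_lt_trans _ xd)// lerD2l lef_pV2// posrE.
Qed.

(* Continuation along lines parallel to the axes: first in [a], then in [t]. *)
Lemma analytic_parameters_eq0 (R : realType) (delta : R) (F : R -> R -> R) (e T : R) :
  (forall a0 t0, parameters delta (a0, t0) -> exists (r M : R) (d : nat -> nat -> R),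
    [/\ 0 < r, forall m n, `|d m n| * r ^+ (m + n) <= M
      & forall a t, parameters delta (a, t) -> `|a - a0| < r -> `|t - t0| < r ->
        (fun N => \sum_(m < N) \sum_(n < N) ((a - a0) ^+ m * (t - t0) ^+ n) * d m n)
          @ \oo --> F a t]) ->
  0 < e -> (forall a t, parameters delta (a, t) -> a < e -> T < t -> F a t = 0) ->
  forall a t, parameters delta (a, t) -> F a t = 0.
Proof.
move=> Fan e0 F0.
(* On a line parallel to an axis one increment is 0, and [0 ^+ 0 = 1] keeps exactly the terms of
   index 0. The upper limit is [N.+1] because the empty sum lacks that term. *)
have sum0 N (v : nat -> R) : \sum_(n < N.+1) 0 ^+ n * v n = v 0%N.
  rewrite big_ord_recl expr0 mul1r big1 ?addr0// => i _.
  by rewrite expr0n /= mul0r.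
have FT a t : parameters delta (a, t) -> T < t -> F a t = 0.
  move=> Pat Tt; have [/= a0 t0 at_delta] := Pat.
  (* The interval of radius [s] around [s] stays below [e], and [s <= a] keeps [(s, t)] among the
     parameters. *)
  pose s := Num.min e a / 2.
  have m0 : 0 < Num.min e a by rewrite lt_min e0.
  have s0 : 0 < s by rewrite divr_gt0.
  have se : s + s <= e by rewrite -splitr ge_min lexx.
  have sa : s <= a.
    by rewrite ler_pdivrMr// (@le_trans _ _ a)// ?ge_min ?lexx ?orbT// mulr2n mulrDr mulr1 lerDl ltW.
  apply: (@analytic_eq0 _ [set a | parameters delta (a, t)] (fun a => F a t) s s) => //.
  - exact: parameters_itvl.
  - move=> a1 /= P1; have [r [M [d [r0 dM Fd]]]] := Fan _ _ P1.
    exists r, M, (d ^~ 0%N); split=> // [n|a2 P2 ar]; first by have := dM n 0%N; rewrite addn0.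
    have := Fd a2 t P2 ar; rewrite subrr normr0 => /(_ r0).
    rewrite -(cvg_shiftS) -[in X in _ -> X](cvg_shiftS).
    apply: cvg_trans; apply: near_eq_cvg; near=> N.
    apply: eq_bigr => m _; rewrite -(sum0 N (fun n => (a2 - a1) ^+ m * d m n)).
    by apply: eq_bigr => n _; ring.
  - by split=> //=; rewrite (le_lt_trans _ at_delta)// lerD2r.
  - move=> a2 /= P2; rewrite ltr_distl => /andP[_ a2s].
    by apply: F0 => //; exact: lt_le_trans se.
move=> a t Pat; have [/= a0 t0 at_delta] := Pat.
(* Every point within distance 1 of [s] exceeds [T], and [t <= s] keeps [(a, s)] among the
   parameters. *)
pose s := Num.max T t + 2.
have st : t <= s by rewrite /s (@le_trans _ _ (Num.max T t)) ?le_max ?lexx ?orbT// lerDl.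
have sT : T <= s - 2 by rewrite /s addrK le_max lexx.
have s0 : 0 < s by exact: lt_le_trans st.
apply: (@analytic_eq0 _ [set t | parameters delta (a, t)] (fun t => F a t) s 1) => //.
- exact: parameters_itvr.
- move=> t1 /= P1; have [r [M [d [r0 dM Fd]]]] := Fan _ _ P1.
  exists r, M, (d 0%N); split=> // t2 P2 tr.
  have := Fd a t2 P2; rewrite subrr normr0 => /(_ r0 tr).
  rewrite -(cvg_shiftS) -[in X in _ -> X](cvg_shiftS).
  apply: cvg_trans; apply: near_eq_cvg; near=> N.
  rewrite /= exchange_big /=.
  apply: eq_bigr => n _; rewrite -(sum0 N (fun m => (t2 - t1) ^+ n * d m n)).
  by apply: eq_bigr => m _; ring.
- by split=> //=; rewrite (le_lt_trans _ at_delta)// lerD2l lef_pV2// posrE.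
- move=> t2 /= P2; rewrite ltr_distl => /andP[t2s _].
  by apply: FT => //; lra.
Unshelve. all: by end_near. Qed.

(** * Parity of the small-amplitude family *)

Section small_amplitude.
Context {R : realType} (D : set (R3 R)).
Hypothesis HD : symmetric_dimer D.
Local Notation mu := (leb3 R).
Implicit Types f g : R3 R -> R[i].

Let DR := dimer_reflect HD.
Let oD := dimer_open HD.
Let bD := dimer_bounded HD.
Let mD : measurable D := open_measurable3 oD.

(** Moving the reflection to the weight makes the defect of symmetry a single pairing of [u], to
    which analyticity of [u] applies. *)
Lemma pairing_signed_reflect (p : R[i] -> R) (b : bool) (psi : R3 R -> R) f :
  (forall (k : R) z, p (k%:C * z) = k * p z) ->
  pairing D p psi (signed_reflect b f) =
  pairing D p (fun x => (-1) ^+ b * psi (reflect1 x)) f.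
Proof.
move=> pZ; rewrite /pairing -[LHS](Rintegral_reflect _ DR).
apply: eq_Rintegral => x _; rewrite /signed_reflect reflect1K.
rewrite (_ : (-1) ^+ b = ((-1) ^+ b)%:C); last by rewrite rmorphXn rmorphN1.
by rewrite pZ -mulrA mulrCA.
Qed.

(** Used twice: the amplitude is preserved, as local uniqueness requires, and the remaining phase is
    read off from the same pairing. *)
Lemma L2inner_signed_reflect (b : bool) phi f : L2 D phi -> L2 D f ->
  eq_ae D (phi \o reflect1) (fun x => (-1) ^+ b * phi x) ->
  L2inner D phi (signed_reflect b f) = L2inner D phi f.
Proof.
move=> Lphi Lf phib.
transitivity (L2inner D (signed_reflect b phi) f).
  rewrite /L2inner -(cintegral_reflect _ DR); congr cintegral; apply/funext => x.
  rewrite /signed_reflect reflect1K rmorphM rmorphXn rmorphN1.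
  by rewrite mulrCA mulrA.
apply: L2inner_ae => //; first exact: L2_signed_reflect.
  apply: filterS phib => x H Dx; rewrite /signed_reflect; have /= -> := H Dx; rewrite mulrA -exprMn.
  by rewrite mulrNN mulr1 expr1n mul1r.
by apply: filterE.
Qed.

Context (lam : R) (phi : R3 R -> R[i]) (delta : R) (om : R -> R -> R[i])
  (u h : R -> R -> R3 R -> R[i]) (b : bool).
Hypotheses (Lphi : L2 D phi) (phi1 : L2norm D phi = 1)
  (phib : eq_ae D (phi \o reflect1) (fun x => (-1) ^+ b * phi x))
  (SF : small_amplitude_family D lam phi delta om u h).

Lemma small_amplitude_H2 a t : parameters delta (a, t) -> H2 D (u a t).
Proof. by move=> /(u_resonance SF)[]. Qed.

Let Lu a t : parameters delta (a, t) -> L2 D (u a t).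
Proof. by move=> /small_amplitude_H2[]. Qed.

(** An eigenfunction is only given in L^2; its H^2 regularity is recovered from [a phi = u - h] with
    [a > 0]. *)
Lemma small_amplitude_mode_H2 a t : parameters delta (a, t) -> H2 D phi.
Proof.
move=> Pat; have [/= a0 _ _] := Pat.
have [Hh _ ud] := u_decomposition SF Pat.
have H : H2 D (fun x => (a^-1)%:C * (u a t x + (-1) * h a t x)).
  by apply: H2Z => //; apply: H2D => //; [exact: small_amplitude_H2|exact: H2Z].
apply: (H2_ae oD bD H) => //; apply: filterS ud => x ux Dx.
by rewrite ux// mulN1r addrK mulrA -rmorphM mulVf ?gt_eqF// mul1r.
Qed.

Lemma small_amplitude_inner a t : parameters delta (a, t) ->
  L2inner D phi (u a t) = a%:C.
Proof.
move=> Pat; have [[Lh _] ph ud] := u_decomposition SF Pat.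
have Laphi := L2Z oD a%:C Lphi.
rewrite (@L2inner_ae _ _ mD phi phi (u a t) (fun x => a%:C * phi x + h a t x))//.
- by rewrite L2innerD// L2innerZ// L2inner_diag// ph mulr1 addr0.
- exact: Lu.
- exact: L2D.
- exact: filterE.
Qed.

Lemma small_amplitude_parity_near : exists e T, 0 < e /\
  forall a t, parameters delta (a, t) -> a < e -> T < t ->
    eq_ae D (signed_reflect b (u a t)) (u a t).
Proof.
have [rho rho0 uniq] := local_uniqueness SF.
have r2 : 0 < rho / 2 by rewrite divr_gt0.
have /cvgr0Pnorm_lt/(_ _ rho0)/right_pinfty_near[e1 [T1 [e10 H1]]] := om_limit SF.
have /cvgr0Pnorm_lt/(_ _ r2)/right_pinfty_near[e2 [T2 [e20 H2']]] := h_limit SF.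
pose N := H2norm D phi.
have N0 : 0 <= N by exact: sqrtr_ge0.
have N1 : 0 < N + 1 by rewrite ltr_wpDl.
(* For [a < e3] the part [a phi] has H^2 norm below [rho / 2], like [h]. Two such halves fit the
   factor 2 of [H2normZD_sqr_le]: twice the sum of two squares below [rho^2 / 4] is below
   [rho^2]. *)
pose e3 := rho / 2 / (N + 1).
have e30 : 0 < e3 by rewrite divr_gt0.
exists (Num.min e1 (Num.min e2 e3)), (Num.max T1 T2); split; first by rewrite !lt_min e10 e20.
move=> a t Pat; rewrite !lt_min gt_max => /and3P[ae1 ae2 ae3] /andP[Tt1 Tt2].
have [/= a0 t0 _] := Pat.
have Hphi := small_amplitude_mode_H2 Pat.
have Hu := small_amplitude_H2 Pat.
have [Hh _ ud] := u_decomposition SF Pat.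
have na : normc (a%:C) = a by rewrite /normc /= expr0n /= addr0 sqrtr_sqr gtr0_norm.
have om_lt : normc ((Num.sqrt t)%:C * om a t - ((Num.sqrt lam)^-1)%:C) < rho.
  exact: le_lt_trans (ler_norm _) (H1 a t a0 ae1 Tt1).
have h_lt : H2norm D (h a t) < rho / 2.
  exact: le_lt_trans (ler_norm _) (H2' a t a0 ae2 Tt2).
have u_lt : H2norm D (u a t) < rho.
  rewrite (H2norm_ae oD bD Hu _ ud); last by apply: H2D => //; exact: H2Z.
  have := H2normZD_sqr_le oD bD a%:C Hphi Hh; rewrite na -/N.
  have : 0 <= H2norm D (h a t) by exact: sqrtr_ge0.
  have aN : a * N < rho / 2.
    have : a * (N + 1) < rho / 2 by rewrite -ltr_pdivlMr.
    by rewrite mulrDr mulr1; lra.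
  have aN0 : 0 <= a * N by rewrite mulr_ge0// ltW.
  have : 0 <= H2norm D (fun x => a%:C * phi x + h a t x) by exact: sqrtr_ge0.
  move: h_lt; move: (H2norm D (h a t)) (H2norm D (fun x => _)) => y z.
  rewrite -exprMn; move: (a * N) aN aN0 => x xr x0 yr z0 y0 zle.
  rewrite ltNge; apply/negP => rz; nra.
have [_ [theta vu]] : om a t = om a t /\ exists theta : R,
    eq_ae D (signed_reflect b (u a t)) (fun x => cexp ('i%C * theta%:C) * u a t x).
  have ru := resonance_signed_reflect HD b (u_resonance SF Pat).
  apply: (uniq _ _ _ _ Pat ru om_lt).
    exact: (eq_ind_r (fun y => y < rho) u_lt (H2norm_signed_reflect HD b Hu)).
  by rewrite (L2inner_signed_reflect Lphi (Lu Pat) phib) (small_amplitude_inner Pat).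
have Lua := Lu Pat.
have : L2inner D phi (signed_reflect b (u a t)) =
    L2inner D phi (fun x => cexp ('i%C * theta%:C) * u a t x).
  apply: L2inner_ae => //.
  - exact: L2_signed_reflect.
  - exact: L2Z.
  - exact: filterE.
rewrite L2inner_signed_reflect// L2innerZ// small_amplitude_inner// => E.
have c1 : cexp ('i%C * theta%:C) = 1.
  have /mulIf : a%:C != 0 :> R[i] by rewrite (inj_eq (@complexI _)) gt_eqF.
  by apply; rewrite -E mul1r.
by apply: filterS vu => x H Dx; rewrite H// c1 mul1r.
Qed.

Lemma small_amplitude_parity a t : parameters delta (a, t) ->
  eq_ae D (signed_reflect b (u a t)) (u a t).
Proof.
have [e [T [e0 near_eq]]] := small_amplitude_parity_near.
suff part0 (p : R[i] -> R) (psi : R3 R -> R) :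
    (forall z w, p (z + w) = p z + p w) ->
    (forall (k : R) z, p (k%:C * z) = k * p z) ->
    (forall f, L2 D f -> measurable_fun D (p \o f)) ->
    (forall z, p z ^+ 2 <= normc z ^+ 2) -> test_function D psi ->
    forall a t, parameters delta (a, t) ->
      pairing D p psi (signed_reflect b (u a t)) = pairing D p psi (u a t).
  move=> Pat; apply: L2_test_ae_eq => //; [exact: L2_signed_reflect (Lu Pat)|exact: Lu|].
  move=> psi tpsi; rewrite !cintegral_weight; congr (_ +i* _).
    apply: (part0 (@complex.Re R)) => //; [exact: Re_add|move=> k z|by move=> f []|move=> z].
      by rewrite Re_mul /= mul0r subr0.
    by rewrite normc_sqr lerDl sqr_ge0.
  apply: (part0 (@complex.Im R)) => //; [exact: Im_add|move=> k z|by move=> f []|move=> z].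
    by rewrite Im_mul /= mul0r addr0.
  by rewrite normc_sqr lerDr sqr_ge0.
move=> pD pZ pm pn tpsi {}a {}t.
have w1 : bounded_weight D (fun x => (-1) ^+ b * psi (reflect1 x)).
  have [m1 [C C1]] := test_weight bD (test_function_reflect HD tpsi).
  split; first exact: (measurable_funM (measurable_cst _) m1).
  by exists C => x Dx; rewrite normrM normrX normrN1 expr1n mul1r; exact: C1.
have w2 := test_weight bD tpsi.
have pB f : L2 D f ->
    pairing D p psi (signed_reflect b f) - pairing D p psi f =
    pairing D p (fun x => (-1) ^+ b * psi (reflect1 x) - psi x) f.
  move=> Lf; rewrite pairing_signed_reflect// /pairing.
  rewrite -(@RintegralB _ _ _ mu D _ _ mD).
  - by apply: eq_Rintegral => x _; rewrite mulrBr.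
  - have [m1 [C C1]] := w1.
    exact: (integrableM_bounded oD (L2_part oD bD Lf (pm _ Lf) pn) m1 C1).
  - have [m1 [C C1]] := w2.
    exact: (integrableM_bounded oD (L2_part oD bD Lf (pm _ Lf) pn) m1 C1).
have wchi : bounded_weight D (fun x => (-1) ^+ b * psi (reflect1 x) - psi x).
  have [m1 [C C1]] := w1; have [m2 [C' C2]] := w2.
  split; first exact: measurable_funB.
  by exists (C + C') => x Dx; rewrite (le_trans (ler_normB _ _))// lerD ?C1 ?C2.
move=> Pat; apply/eqP; rewrite -subr_eq0 (pB _ (Lu Pat)); apply/eqP; move: a t Pat.
apply: (@analytic_parameters_eq0 _ _ _ e T _ e0).
  exact: (pairing_analytic oD bD pD pZ pm pn wchi (u_analytic SF) small_amplitude_H2).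
move=> a t Pat ae Tt; rewrite -(pB _ (Lu Pat)).
apply/eqP; rewrite subr_eq0; apply/eqP.
have Lua := Lu Pat; have LuR := L2_signed_reflect HD b Lua.
have [m1 _] := w2.
apply: (@ae_eq_Rintegral _ _ _ mu D) => //.
- by apply: measurable_funM => //; exact: pm.
- by apply: measurable_funM => //; exact: pm.
- by apply: filterS (near_eq _ _ Pat ae Tt) => x H Dx; rewrite H.
Qed.

End small_amplitude.

(** * The principal eigenvalue of the Newtonian potential *)

Section newton_kernel.
Context {R : realType}.
Local Notation mu := (leb3s R).
Local Notation mR3 := (measurableTypeR R * measurableTypeR R * measurableTypeR R)%type.
Implicit Types x y : R3 R.

Definition newton_kernel x y : R := (4 * pi * enorm (x - y))^-1.

Let enorm_ge0 x : 0 <= enorm x. Proof. exact: sqrtr_ge0. Qed.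

Let pi4_ge1 : 1 <= 4 * pi :> R.
Proof. by have := pi_ge2 R; lra. Qed.

Let pi4_gt0 : 0 < 4 * pi :> R. Proof. exact: lt_le_trans pi4_ge1. Qed.

Let sq_ge0 x : 0 <= x.1.1 ^+ 2 + x.1.2 ^+ 2 + x.2 ^+ 2.
Proof. by rewrite !addr_ge0// sqr_ge0. Qed.

Lemma newton_kernel_ge0 x y : 0 <= newton_kernel x y.
Proof. by rewrite invr_ge0 mulr_ge0// ltW. Qed.

Lemma newton_kernelC x y : newton_kernel x y = newton_kernel y x.
Proof.
congr (_ * _)^-1; congr Num.sqrt => /=; ring.
Qed.

Lemma newton_kernel_gt0 x y : x <> y -> 0 < newton_kernel x y.
Proof.
move=> xy; rewrite invr_gt0 mulr_gt0// lt_neqAle enorm_ge0 andbT eq_sym sqrtr_eq0 -ltNge.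
rewrite lt_neqAle sq_ge0 andbT eq_sym; apply/eqP => /eqP.
rewrite !paddr_eq0 ?addr_ge0 ?sqr_ge0// !sqrf_eq0 /= !subr_eq0.
move=> /andP[/andP[/eqP h1 /eqP h2] /eqP h3]; apply: xy.
by case: x h1 h2 h3 => [[? ?] ?]; case: y => [[? ?] ?] /= -> -> ->.
Qed.

Lemma newton_kernel_measurable :
  measurable_fun setT (fun z : mR3 * mR3 => newton_kernel z.1 z.2).
Proof.
(* Real powers are measurable, and the exponents -1 and 1/2 give the inverse and the square root
   also at 0. *)
rewrite (_ : (fun z => _) = (@powR R ^~ (-1)) \o (fun z => 4 * pi *
  ((@powR R ^~ 2^-1) \o (fun z : mR3 * mR3 => (z.1.1.1 - z.2.1.1) ^+ 2 +
    (z.1.1.2 - z.2.1.2) ^+ 2 + (z.1.2 - z.2.2) ^+ 2)) z)); last first.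
  apply/funext => -[x y] /=.
  have S0 := sq_ge0 (x - y).
  by rewrite powR12_sqrt// powR_inv1// mulr_ge0 ?sqrtr_ge0// ltW.
apply: measurableT_comp; first exact: measurable_powR.
apply: measurable_funM => //.
apply: measurableT_comp; first exact: measurable_powR.
by apply: measurable_funD; [apply: measurable_funD|]; apply: measurable_funX;
  apply: measurable_funB; repeat (apply: measurableT_comp => //).
Qed.

Lemma obox_volume (p q : R3 R) : p.1.1 < q.1.1 -> p.1.2 < q.1.2 -> p.2 < q.2 ->
  mu (obox p q) = ((q.1.1 - p.1.1) * (q.1.2 - p.1.2) * (q.2 - p.2))%:E.
Proof.
move=> h1 h2 h3; rewrite /leb3s /leb2s /obox.
rewrite product_measure1E//=; [|exact: measurableX].
by rewrite product_measure1E//= !lebesgue_measure_itv/= !lte_fin h1 h2 h3 -!EFinD -!EFinM.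
Qed.

Lemma set1_triple x : [set x] = ([set x.1.1] `*` [set x.1.2]) `*` [set x.2].
Proof.
by apply/seteqP; split => [_ ->//|[[a b] c] /= [[-> ->] ->]]; case: x => [[]].
Qed.

Lemma leb3_set1 x : mu [set x] = 0.
Proof.
rewrite set1_triple.
have m1 (a : measurableTypeR R) : measurable [set a] by exact: measurable_set1.
rewrite /leb3s product_measure1E//; last by apply: measurableX.
rewrite -[RHS](mule0 (leb2s R ([set x.1.1] `*` [set x.1.2]))); congr (_ * _)%E.
exact: (lebesgue_measure_set1 x.2).
Qed.

Let cube x (n : nat) : set (R3 R) :=
  let r := 2^-1 ^+ n in
  obox (x.1.1 - r, x.1.2 - r, x.2 - r) (x.1.1 + r, x.1.2 + r, x.2 + r).

Let cube_volume x n : mu (cube x n) = (8 * 8^-1 ^+ n)%:E.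
Proof.
have r0 : 0 < 2^-1 ^+ n :> R by rewrite exprn_gt0.
rewrite /cube obox_volume /=; [|lra..].
congr EFin; rewrite (_ : 8^-1 = 2^-1 ^+ 3 :> R); last by field.
by rewrite -exprM mulnC exprM; move: (_ ^+ n) => r; ring.
Qed.

Let shell x n y : R := 4 ^+ n.+1 * \1_(cube x n) y.

Let shell_ge0 x n y : 0 <= shell x n y.
Proof. by rewrite mulr_ge0// exprn_ge0. Qed.

(* Dyadic shells: [4^(n+1)] dominates the squared kernel where
   [2^-(n+1) <= enorm (x - y) < 2^-n]. *)
Lemma newton_kernel_sqr_le x y : ((newton_kernel x y ^+ 2)%:E <=
  1 + \sum_(0 <= n <oo) (shell x n y)%:E)%E.
Proof.
have s0 : (0 <= \sum_(0 <= n <oo) (shell x n y)%:E)%E.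
  by apply: nneseries_ge0 => n _ _; rewrite lee_fin.
have [e0|e0] := eqVneq (enorm (x - y)) 0.
  by rewrite /newton_kernel e0 mulr0 invr0 expr0n adde_ge0.
have e_gt0 : 0 < enorm (x - y) by rewrite lt_neqAle eq_sym e0 enorm_ge0.
have ke : newton_kernel x y ^+ 2 <= (enorm (x - y) ^+ 2)^-1.
  rewrite -exprVn; apply: lerXn2r; rewrite ?nnegrE ?newton_kernel_ge0 ?invr_ge0//.
  rewrite /newton_kernel lef_pV2; [by apply: ler_peMl|by rewrite posrE mulr_gt0|by []].
have [e1|e1] := leP 1 (enorm (x - y)).
  apply: (@le_trans _ _ 1%E); last by rewrite leeDl.
  rewrite lee_fin (le_trans ke)// invf_le1 ?exprn_gt0//.
  by rewrite exprn_ege1.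
have ex : exists n, 2^-1 ^+ n.+1 <= enorm (x - y).
  have /cvgrPdist_lt/(_ _ e_gt0) : (fun n => 2^-1 ^+ n : R) @ \oo --> 0.
    by apply: cvg_expr; rewrite ger0_norm// invf_lt1// ltr1n.
  move=> [N _ /(_ N.+1 (leqnSn N))] /=; rewrite sub0r normrN ger0_norm ?exprn_ge0// => /ltW.
  by exists N.
(* Minimality of [n] gives the outer radius: the distance is below [2^-n], which for [n = 0] is the
   case assumption [e1]. *)
have [n en nmin] := ex_minnP ex.
have en1 : enorm (x - y) < 2^-1 ^+ n.
  case: n nmin {en} => [_|n nmin]; first by rewrite expr0.
  by rewrite ltNge; apply/negP => /nmin; rewrite ltnn.
have cn : cube x n y.
  have xy (a b c : R) : a ^+ 2 + b ^+ 2 + c ^+ 2 = enorm (x - y) ^+ 2 -> `|a| < 2^-1 ^+ n.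
    move=> S; apply: le_lt_trans en1; rewrite -ler_sqr ?nnegrE// -S real_normK ?num_real//.
    by rewrite -addrA lerDl addr_ge0 ?sqr_ge0.
  have S : enorm (x - y) ^+ 2 = (x.1.1 - y.1.1) ^+ 2 + (x.1.2 - y.1.2) ^+ 2 + (x.2 - y.2) ^+ 2.
    by rewrite sqr_sqrtr.
  have h1 : `|x.1.1 - y.1.1| < 2^-1 ^+ n by apply: xy; exact/esym/S.
  have h2 : `|x.1.2 - y.1.2| < 2^-1 ^+ n.
    by apply: (xy _ (x.1.1 - y.1.1) (x.2 - y.2)); rewrite S; ring.
  have h3 : `|x.2 - y.2| < 2^-1 ^+ n.
    by apply: (xy _ (x.1.1 - y.1.1) (x.1.2 - y.1.2)); rewrite S; ring.
  by apply/oboxE; split => /=; rewrite -ltr_distlC.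
apply: (@le_trans _ _ (shell x n y)%:E).
  rewrite /shell indicE mem_set// mulr1 lee_fin (le_trans ke)//.
  have -> : 4 ^+ n.+1 = ((2^-1 ^+ n.+1) ^+ 2)^-1 :> R.
    by rewrite -exprM mulnC exprM -exprVn; congr (_ ^+ _); field.
  by rewrite lef_pV2 ?posrE ?exprn_gt0// lerXn2r ?nnegrE ?exprn_ge0.
apply: (@le_trans _ _ (\sum_(0 <= n <oo) (shell x n y)%:E)%E); last by rewrite leeDr.
apply: le_trans (nneseries_lim_ge n.+1 _); last by move=> i _ _; rewrite lee_fin.
rewrite big_nat_recr//= leeDr// sume_ge0// => i _.
by rewrite lee_fin.
Qed.

(** The singularity [|x - y|^-2] is integrable in dimension 3: the weights of the dyadic cubes grow
    like [4^n] while their volumes shrink like [8^-n]. The bound is independent of [x]. *)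
Lemma newton_kernel_sqr_int (D : set (R3 R)) x : measurable D -> (mu D < +oo)%E ->
  (\int[mu]_(y in D) (newton_kernel x y ^+ 2)%:E <= (fine (mu D) + 64)%:E)%E.
Proof.
move=> mD fD.
have mcube n : measurable (cube x n) by exact: obox_measurable.
pose g n y := (shell x n y)%:E : \bar R.
have g0 n y : (0 <= g n y)%E by rewrite lee_fin.
have mg n : measurable_fun D (g n).
  apply/measurable_EFinP; apply: measurable_funM; first exact: measurable_cst.
  exact: (measurable_funTS (measurable_indic (mcube n))).
have mg_sum : measurable_fun D (fun y => \sum_(0 <= n <oo) g n y)%E :=
  ge0_emeasurable_sum (P := xpredT) (fun n y _ _ => g0 n y) (fun n _ => mg n).
have mk : measurable_fun D (fun y => (newton_kernel x y ^+ 2)%:E).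
  have m1 := measurableT_comp newton_kernel_measurable (pair1_measurable x).
  by apply/measurable_EFinP; apply: measurable_funX; exact: (measurable_funTS m1).
apply: (@le_trans _ _ (\int[mu]_(y in D) (1 + \sum_(0 <= n <oo) g n y))%E).
  apply: ge0_le_integral => //.
  - by move=> y _; rewrite lee_fin sqr_ge0.
  - apply: emeasurable_funD; first exact: measurable_cst.
    exact: mg_sum.
  - by move=> y _; exact: newton_kernel_sqr_le.
rewrite ge0_integralD//; last by move=> y _; exact: nneseries_ge0.
rewrite integral_cst// mul1e EFinD fineK; last first.
  by rewrite ge0_fin_numE.
apply: leeD2l; rewrite integral_nneseries//.
(* Weight [4^(n+1)] times volume [8 * 8^-n] is [64 / 2^(n+1)], and these sum to 64. *)
have term n : (\int[mu]_(y in D) g n y <= (64 / (2 ^ n.+1)%:R)%:E)%E.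
  rewrite /g /shell; under eq_integral do rewrite EFinM.
  rewrite (ge0_integralZl mu mD); last 3 first.
  - by apply/measurable_EFinP; exact: (measurable_funTS (measurable_indic (mcube n))).
  - by move=> y _; rewrite lee_fin.
  - by rewrite lee_fin exprn_ge0.
  rewrite (@integral_indic _ _ _ mu D mD _ (mcube n)).
  apply: (@le_trans _ _ ((4 ^+ n.+1)%:E * mu (cube x n))%E).
    apply: lee_wpmul2l; first by rewrite lee_fin exprn_ge0.
    apply: le_measure; [|by rewrite inE; exact: mcube|exact: subIsetl].
    by rewrite inE; exact: (measurableI _ _ (mcube n) mD).
  rewrite cube_volume -EFinM lee_fin le_eqVlt; apply/orP; left; apply/eqP.
  rewrite natrX -exprVn !exprS (_ : 2^-1 ^+ n = 4 ^+ n * 8^-1 ^+ n :> R); first by field.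
  by rewrite -exprMn; congr (_ ^+ _); field.
have e64 : 0 <= 64 :> R by [].
apply: le_trans (epsilon_trick0 xpredT e64); apply: lee_nneseries => [n _ _|n _].
  exact: integral_ge0.
exact: term.
Qed.

End newton_kernel.

Section newton_potential.
Context {R : realType}.
Local Notation mu := (leb3s R).
Implicit Types (D : set (R3 R)) (f : R3 R -> R[i]).

Lemma newton_potE D f x : newton_pot D f x =
  (\int[mu]_(y in D) (newton_kernel x y * Re (f y))) +i*
  (\int[mu]_(y in D) (newton_kernel x y * Im (f y))).
Proof.
have E y : cexp ('i%C * 0 * (enorm (x - y))%:C) / (4 * pi * enorm (x - y))%:C =
    (newton_kernel x y)%:C.
  rewrite mulr0 mul0r /cexp /= expR0 cos0 sin0 mul1r mulr0.
  by rewrite (_ : 1 +i* 0 = 1)// mul1r /newton_kernel fmorphV.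
rewrite /newton_pot /helmholtz_pot /cintegral; congr (_ +i* _);
  apply: eq_Rintegral => y _; rewrite E ?Re_mul ?Im_mul /= mul0r ?subr0 ?addr0//.
Qed.

Lemma newton_kernel_reflect (x y : R3 R) :
  newton_kernel (reflect1 x) (reflect1 y) = newton_kernel x y.
Proof. by rewrite /newton_kernel enorm_reflect. Qed.

Lemma open_volume_gt0 D : open D -> D !=set0 -> (0 < mu D)%E.
Proof.
move=> oD [x Dx]; have mD : measurable D by exact: open_measurable3.
move: Dx; rewrite (open_rat_boxes oD) => -[n /= nD]; set p := (rat_box n).1; set q := (rat_box n).2.
move=> /oboxE[/andP[h1 h1'] /andP[h2 h2'] /andP[h3 h3']].
have pq1 := lt_trans h1 h1'; have pq2 := lt_trans h2 h2'; have pq3 := lt_trans h3 h3'.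
rewrite -(open_rat_boxes oD); apply: (@lt_le_trans _ _ (mu (obox p q))).
  by rewrite obox_volume// lte_fin !mulr_gt0// subr_gt0.
apply: le_measure; rewrite ?inE//; first exact: obox_measurable.
by rewrite [X in _ `<=` X](open_rat_boxes oD) => y yo; exists n.
Qed.

Lemma bounded_on_L2 D (f : R3 R -> R) : open D -> bounded_set D -> bounded_on D f ->
  L2 D (fun x => (f x)%:C).
Proof.
move=> oD bD bf; have mD := bounded_open_measurable oD.
have [mf _] := bf; split; [exact: measurable_funTS|exact: measurable_cst|].
have := @bounded_on_int _ _ _ mu D mD (bounded_open_finite oD bD) _ (bounded_onM bf bf).
apply: eq_integrable => // x _.
by rewrite normc_sqr /= expr0n addr0 expr2.
Qed.

Lemma bounded_on_reflect D (f : R3 R -> R) : (forall x, D x -> D (reflect1 x)) ->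
  bounded_on D f -> bounded_on D (f \o reflect1).
Proof.
move=> DR [mf [M fM]]; split; last by exists M => x Dx; exact/fM/DR.
by apply: measurableT_comp => //; exact: reflect1_measurable.
Qed.

End newton_potential.

(** * The principal eigenfunction on the dimer *)

Section principal_eigenvalue.
Context {R : realType} (D : set (R3 R)).
Hypothesis HD : symmetric_dimer D.
Local Notation mu := (leb3s R).
Local Notation k := (@newton_kernel R).

Let DR := dimer_reflect HD.
Let oD := dimer_open HD.
Let bD := dimer_bounded HD.
Let mD : measurable D := open_measurable3 oD.
Let fD : (mu D < +oo)%E := bounded_open_finite oD bD.
Let D0 : (0 < mu D)%E := open_volume_gt0 oD (dimer_nonempty HD).
Let kB x := newton_kernel_sqr_int x mD fD.

(** The sum of a positive eigenfunction and its reflection is again a positive eigenfunction for the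
    same eigenvalue. The kernel is 0 on the diagonal by convention, so its positivity is claimed off
    a null singleton. *)
Lemma newton_symmetric_eigenfunction : exists m (E : R3 R -> R),
  [/\ 0 < m, bounded_on D E, forall x, D x -> 0 < E x, forall x, E (reflect1 x) = E x
    & forall x, D x -> kernel_op mu D k E x = m * E x].
Proof.
have kpos x : {ae mu, forall y, D y -> 0 < k x y}.
  exists [set x]; split; [|exact: leb3_set1|].
    by rewrite set1_triple; apply: measurableX; [apply: measurableX|]; exact: measurable_set1.
  move=> y /= ny; apply/esym; apply: contra_notP ny => xy _.
  exact: newton_kernel_gt0.
have [m [E [m0 bE E0 KE]]] := @positive_kernel_eigenfunction _ _ R mu D mD fD D0 k _
  (@newton_kernel_measurable R) (@newton_kernel_ge0 R) (@newton_kernelC R) kB kpos.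
have bER := bounded_on_reflect DR bE.
have KR x : kernel_op mu D k (E \o reflect1) x = kernel_op mu D k E (reflect1 x).
  rewrite /kernel_op -[RHS](Rintegral_reflect _ DR).
  by apply: eq_Rintegral => y _; rewrite newton_kernel_reflect.
exists m, (fun x => E x + (E \o reflect1) x); split=> //.
- exact: bounded_onD.
- by move=> x Dx; rewrite addr_gt0 ?E0//; exact: DR.
- by move=> x; rewrite /= reflect1K addrC.
move=> x Dx.
rewrite (kernel_opD (mu := mu) mD fD (@newton_kernel_measurable R) (@newton_kernel_ge0 R)
  kB x bE bER).
by rewrite KR !KE//; [rewrite mulrDr|exact: DR].
Qed.

(** The kernel is real, so the real and imaginary parts of [phi] satisfy the eigenvalue equation
    separately, and one of them is not null. Its absolute value satisfies [nu |psi| <= K |psi|], as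
    [kernel_eigenvalue_le] requires. *)
Lemma newton_eigenvalue_le m (E : R3 R -> R) nu : 0 < m -> bounded_on D E ->
  (forall x, D x -> 0 < E x) -> (forall x, D x -> kernel_op mu D k E x = m * E x) ->
  Defs.eigenvalue D nu -> nu <= m.
Proof.
move=> m0 bE E0 KE [phi [Lphi nphi Kphi]].
have KE' x : D x -> (\int[mu]_(y in D) (k x y * E y)%:E = (m * E x)%:E)%E.
  move=> Dx; rewrite -KE// /kernel_op /Rintegral fineK//.
  have iE := kernel_int (mu := mu) mD fD (@newton_kernel_measurable R)
    (@newton_kernel_ge0 R) kB x bE.
  by apply: integrable_fin_num => //; exact: iE.
suff part (p : R[i] -> R) : measurable_fun D (p \o phi) ->
    (forall z, p z ^+ 2 <= normc z ^+ 2) ->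
    {ae mu, forall x, D x -> \int[mu]_(y in D) (k x y * p (phi y)) = nu * p (phi x)} ->
    ~ {ae mu, forall x, D x -> p (phi x) = 0} -> nu <= m.
  have [|nre] := pselect {ae mu, forall x, D x -> Re (phi x) = 0}; last first.
    apply: (part (@complex.Re R)) => //; first by case: Lphi.
      by move=> z; rewrite normc_sqr lerDl sqr_ge0.
    apply: filterS Kphi => x H Dx; have := H Dx; rewrite newton_potE.
    by move/(congr1 (@complex.Re R)) => /= ->; rewrite Re_mul /= mul0r subr0.
  have [|nim] := pselect {ae mu, forall x, D x -> Im (phi x) = 0}; last first.
    move=> _; apply: (part (@complex.Im R)) => //; first by case: Lphi.
      by move=> z; rewrite normc_sqr lerDr sqr_ge0.
    apply: filterS Kphi => x H Dx; have := H Dx; rewrite newton_potE.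
    by move/(congr1 (@complex.Im R)) => /= ->; rewrite Im_mul /= mul0r addr0.
  move=> im0 re0; exfalso; apply: nphi.
  apply: filterS2 im0 re0 => x H1 H2 Dx.
  by apply: complex_eq; [rewrite H2|rewrite H1].
move=> mp pn Kp np.
have ip := L2_part oD bD Lphi mp pn.
apply: (@kernel_eigenvalue_le _ _ R mu D k m nu E (fun x => `|p (phi x)|)) => //.
- exact: newton_kernel_measurable.
- exact: newton_kernel_ge0.
- exact: newton_kernelC.
- exact: (integrable_norm ip).
- move=> H; apply: np; apply: filterS H => x H Dx; apply/eqP.
  by rewrite -normr_eq0 H.
- apply: filterS Kp => x H Dx.
  have mk : measurable_fun D (k x).
    exact: (measurable_funTS (measurableT_comp (@newton_kernel_measurable R) (pair1_measurable x))).
  apply: (@le_trans _ _ (`|nu * p (phi x)|)%:E).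
    by rewrite lee_fin normrM ler_wpM2r// ler_norm.
  rewrite -(H Dx) /Rintegral.
  apply: (@le_trans _ _ `|\int[mu]_(y in D) (k x y * p (phi y))%:E|%E).
    (* Passing from the real to the extended integral only increases the absolute value, as [fine]
       sends infinite values to 0. *)
    have fine_le (z : \bar R) : ((`|fine z|)%:E <= `|z|)%E.
      by case: z => [r||] //=; rewrite normr0 ?leey.
    exact: fine_le.
  have mkp : measurable_fun D (fun y => (k x y * p (phi y))%:E).
    by apply/measurable_EFinP; exact: measurable_funM.
  apply: (le_trans (le_abse_integral mu mD mkp)).
  rewrite le_eqVlt; apply/orP; left; apply/eqP; apply: eq_integral => y _.
  by rewrite abse_EFin normrM (ger0_norm (newton_kernel_ge0 x y)).
Qed.

Lemma newton_principal_eigenvalue : exists lam0 phi0,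
  [/\ largest_eigenvalue D lam0, eigenfunction D lam0 phi0,
      L2norm D phi0 = 1, forall x, D x -> 0 < phi0 x & symmetric_mode D phi0].
Proof.
have [m [E [m0 bE E0 ER KE]]] := newton_symmetric_eigenfunction.
pose F x := (E x)%:C; have LF : L2 D F by exact: bounded_on_L2.
have N2 : 0 < L2norm D F ^+ 2.
  rewrite L2norm_sqr.
  apply: (@Rintegral_pos _ _ _ mu D mD fD D0).
    rewrite (_ : (fun x => _) = fun x => E x * E x); first exact: bounded_onM.
    by apply/funext => x; rewrite normc_sqr /= expr0n addr0 expr2.
  by move=> x Dx; rewrite normc_sqr /= expr0n addr0 exprn_gt0// E0.
pose N := L2norm D F.
have N0 : 0 < N.
  rewrite lt_neqAle L2norm_ge0 andbT eq_sym; apply: contraTneq N2.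
  by rewrite -/N => ->; rewrite expr0n ltxx.
pose phi0 x := (N^-1)%:C * F x.
have L0 : L2 D phi0 by exact: L2Z.
have norm1 : L2norm D phi0 = 1.
  have := L2normZ_sqr oD (N^-1)%:C LF; rewrite -/N normc_sqr /= expr0n addr0 -exprMn mulVf ?gt_eqF//.
  by move/eqP; rewrite eqrXn2 ?L2norm_ge0// => /eqP.
have eig : eigenfunction D m phi0.
  split=> //.
    move=> z0; have /eqP := L2norm_ae oD L0 (L2_0 oD) z0; rewrite norm1 /L2norm.
    under eq_Rintegral do rewrite normc_sqr /= expr0n addr0.
    by rewrite (@Rintegral_cst _ _ _ mu D mD) mul0r sqrtr0 oner_eq0.
  apply: filterE => x Dx; rewrite newton_potE; apply: complex_eq; rewrite [LHS]/=.
    rewrite (_ : Rintegral _ _ _ = kernel_op mu D k (fun y => N^-1 * E y) x).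
      rewrite (kernel_opZ (mu := mu) mD fD (@newton_kernel_measurable R)
        (@newton_kernel_ge0 R) kB _ x bE).
      by rewrite KE// /phi0 !Re_mul !Im_mul /=; ring.
    by apply: eq_Rintegral => y _; rewrite mul0r subr0.
  rewrite (_ : Rintegral _ _ _ = \int[mu]_(y in D) 0).
    by rewrite (@Rintegral_cst _ _ _ mu D mD) mul0r /phi0 Im_mul Im_mul Re_mul /=; ring.
  by apply: eq_Rintegral => y _; rewrite mul0r mulr0 addr0 mulr0.
exists m, phi0; split=> //.
- by split; [exists phi0|move=> nu; exact: (newton_eigenvalue_le m0 bE E0 KE)].
- by move=> x Dx; rewrite /phi0 -rmorphM ltcR mulr_gt0 ?invr_gt0// E0.
- by apply: filterE => x Dx; rewrite /phi0 /F /= ER.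
Qed.

End principal_eigenvalue.

Theorem corollary4p3 (R : realType) (D : set (R3 R)) (HD : symmetric_dimer D) :
  (forall (lam : R) (phi : R3 R -> R[i]),
      simple_eigenvalue D lam -> eigenfunction D lam phi -> L2norm D phi = 1 ->
      (symmetric_mode D phi \/ antisymmetric_mode D phi) /\
      (forall (delta : R) (om : R -> R -> R[i]) (u h : R -> R -> R3 R -> R[i]),
          small_amplitude_family D lam phi delta om u h ->
          forall a tau : R, parameters delta (a, tau) ->
            (symmetric_mode D phi -> symmetric_mode D (u a tau)) /\
            (antisymmetric_mode D phi -> antisymmetric_mode D (u a tau)))) /\
  (exists (lam0 : R) (phi0 : R3 R -> R[i]),
      [/\ largest_eigenvalue D lam0, eigenfunction D lam0 phi0,
          L2norm D phi0 = 1, forall x, D x -> 0 < phi0 x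
        & symmetric_mode D phi0]).
Proof.
have parityP (b : bool) (f : R3 R -> R[i]) :
    eq_ae D (f \o reflect1) (fun x => (-1) ^+ b * f x) <->
    if b then antisymmetric_mode D f else symmetric_mode D f.
  by case: b; split; apply: filterS => x H Dx; rewrite H// ?expr0 ?mul1r// mulN1r.
split; last exact: newton_principal_eigenvalue.
move=> lam phi simp ephi phi1; split.
  have [b /parityP] := simple_eigenfunction_parity HD simp ephi.
  by case: b; [right|left].
move=> delta om u h SF a tau Pat.
have [Lphi _ _] := ephi.
suff parity (b : bool) : eq_ae D (phi \o reflect1) (fun x => (-1) ^+ b * phi x) ->
    eq_ae D (u a tau \o reflect1) (fun x => (-1) ^+ b * u a tau x).
  by split=> [/(parityP false)|/(parityP true)] /parity /parityP.
move=> phib; have := small_amplitude_parity HD Lphi phi1 phib SF Pat.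
apply: filterS => x H Dx; rewrite -[in RHS]H// /signed_reflect mulrA -exprMn.
by rewrite mulrNN mulr1 expr1n mul1r.
Qed.
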